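(* Let $f=u+iv$ be analytic in the open unit disc $|z|<1$ with $f(0)=0$, where $u=\Re f$, $v=\Im f$. Suppose that there are constants $H,K>0$ with $u(z)\le H$ and $\frac{\partial v}{\partial\theta}(z)\le K$ for all $|z|<1$. Then $$|v(z_1)-v(z_2)|\le\sqrt{2\pi}\,\sqrt{HK}\quad\text{for all }|z_1|,|z_2|<1.$$ Moreover $\sqrt{2\pi}$ is sharp: for every $c<\sqrt{2\pi}$ there exist such $f,H,K$ and points $|z_1|,|z_2|<1$ with $|v(z_1)-v(z_2)|>c\sqrt{HK}$.
   Context: Polar coordinates are normalized as $z=re^{2\pi i\theta}$ with $\theta\in[0,1)$, and $\frac{\partial v}{\partial\theta}$ is the derivative of $v(re^{2\pi i\theta})$ with respect to $\theta$. *)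

(* Defs.v *)
From Stdlib Require Import Reals.
From Coquelicot Require Import Coquelicot.
Open Scope R_scope.

Definition holo_disc (f : C -> C) : Prop :=
  forall z : C, Cmod z < 1 -> @ex_derive C_AbsRing C_NormedModule f z.

Definition polar (r t : R) : C := (r * cos (2 * PI * t), r * sin (2 * PI * t)).

Definition dv_dtheta (f : C -> C) (r t : R) : R :=
  Derive (fun s => Im (f (polar r s))) t.

Definition admissible (f : C -> C) (H K : R) : Prop :=
  holo_disc f /\ f (RtoC 0) = RtoC 0 /\ 0 < H /\ 0 < K /\
  (forall z : C, Cmod z < 1 -> Re (f z) <= H) /\
  (forall r t : R, 0 <= r < 1 -> 0 <= t < 1 -> dv_dtheta f r t <= K).

(* Main.v *)
Require Import Defs.
From Stdlib Require Import Reals Lra Psatz.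
From Coquelicot Require Import Coquelicot.
Open Scope R_scope.

(** Put [z = e^{2 pi i (x + i y)}], so that [W = H - u] is a positive harmonic function of
    the upper half-plane, 1-periodic in [x], with mean [H] on every horizontal line and, by
    the Cauchy-Riemann equations, [W_y = v_x <= K].  Integrating [f] around the rectangle
    over [[x1, x2] * [y, y + n]] gives
      int_y^{y+n} (v(x1, s) - v(x2, s)) ds = int_{x1}^{x2} (W(x, y) - W(x, y + n)) dx.
    The right side is bounded by duality.  Let [Sigma] be the half-stadium, equal to 1 on
    [[x1, x2]] with quarter ellipses of half-width [a] attached at both ends.  It is a supremum of
    translates of [sqrt (1 - x^2 / a^2)], whose harmonic extension decreases at rate at most
    [1 / a]; hence [P_n Sigma >= Sigma - n / a] for the Poisson semigroup [P_n], and
      int Sigma (W(x, y) - W(x, y + n)) dx <= n H / a.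
    As [W(x, y) - W(x, y + n) >= - K n] and the ellipses have total area [pi a / 2], letting
    [n -> 0] gives [v(x1) - v(x2) <= H / a + pi a K / 2], and [a = sqrt (2 H / (pi K))] is
    optimal.  If the stadium does not fit in one period, then [v_x <= K] on the short
    complementary arc suffices.

    For sharpness, with [M = (1 + z) / (1 - z)] and [R = sqrt (1 - p^2 + p^2 M^2)], take
      f = Ln (M + R) - Ln (M + 1) - p Ln (p M + R) + p ln (1 + p),
    for which [z f'(z) = (1 - R) / 2] and [df/dM = - p^2 / (1 + R)].  Then [K = pi], [Re f] is at
    most [p^2 (1 + p) / 2], and [v] drops by [p pi] across [z = 1]; let [p -> 0]. *)

(** The half-ellipse is the profile on which the generator of the Poisson semigroup is constant: the
    extension of sqrt (1 - x^2) to the upper half-plane is Re (sqrt (1 - zeta^2)) - y with zeta = x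
    + i y, and the root term has zero normal derivative on (-1, 1). This is the source of the rate 1
    / a. Nothing is known about f on the unit circle, and its derivative is not assumed continuous.
    So Goursat's theorem is proved by bisection, and derivatives in the height are replaced by
    differences over [y, y + n]. Points at different radii are compared through the Poisson formula:
    the value at the smaller radius is an average over the larger circle. The extremal f realises
    the equality case. On the circle, R is imaginary near z = 1, so the angular derivative of v is
    exactly pi there; on the remaining arc R is real, so u is constant there, at its supremum. *)

(* Equalities between Riemann integrals live in a carrier that [ring] does not recognise as [R]. *)
Ltac ringR := match goal with |- @eq _ ?a ?b => change (@eq R a b) end; ring.

(** * Complex derivatives *)

Definition cderiv (h : C -> C) (z l : C) : Prop := @is_derive C_AbsRing C_NormedModule h z l.
(** The product and chain rules are stated for C as a module over itself, the theorem for
    [C_NormedModule]; the components of the two derivative predicates agree by conversion. *)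
Lemma cderiv_alt h z l : cderiv h z l <-> @is_derive C_AbsRing (AbsRing_NormedModule C_AbsRing) h z l.
Proof.
split; intros [[a b c] H]; split.
- split; [exact a|exact b|exact c].
- exact H.
- split; [exact a|exact b|exact c].
- exact H.
Qed.
Lemma cderiv_mult f g z df dg : cderiv f z df -> cderiv g z dg -> cderiv (fun w => Cmult (f w) (g w)) z (Cplus (Cmult df (g z)) (Cmult (f z) dg)).
Proof.
intros H1 H2. apply cderiv_alt. apply cderiv_alt in H1. apply cderiv_alt in H2.
apply (@is_derive_mult C_AbsRing f g z df dg H1 H2 Cmult_comm).
Qed.
Lemma cderiv_comp f g z df dg : cderiv f (g z) df -> cderiv g z dg -> cderiv (fun w => f (g w)) z (Cmult dg df).
Proof.
intros H1 H2. apply cderiv_alt. apply cderiv_alt in H1. apply cderiv_alt in H2.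
apply (@is_derive_comp C_AbsRing (AbsRing_NormedModule C_AbsRing) f g z df dg H1 H2).
Qed.
Lemma cderiv_eps h z l : cderiv h z l <-> 
 (forall eps, 0 < eps -> exists d, 0 < d /\ forall w, Cmod (w - z) < d -> Cmod (h w - h z - l * (w - z)) <= eps * Cmod (w - z)).
Proof.
split.
- intros [_ H] e He.
  specialize (H z (fun P HP => HP) (mkposreal e He)).
  destruct H as [d Hd]. exists d. split. apply cond_pos.
  intros w Hw. specialize (Hd w Hw). 
  replace (l * (w - z))%C with ((w-z)*l)%C by ring. exact Hd.
- intros H. split. 
  + apply is_linear_scal_l.
  + intros x Hx e. 
    apply (is_filter_lim_locally_unique (V:=AbsRing_NormedModule C_AbsRing)) in Hx. subst x.
    destruct (H e (cond_pos e)) as [d [Hd H']].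
    exists (mkposreal d Hd). intros w Hw. specialize (H' w Hw).
    replace (l * (w - z))%C with ((w-z)*l)%C in H' by ring. exact H'.
Qed.
Lemma Im_le_Cmod z : Rabs (Im z) <= Cmod z.
Proof.
apply Rle_trans with (2 := Rmax_Cmod z). apply Rmax_r.
Qed.
Lemma Cmod_le_Rabs z : Cmod z <= Rabs (Re z) + Rabs (Im z).
Proof.
destruct z as [x y]. unfold Cmod, Re, Im; simpl fst; simpl snd.
apply Rsqr_incr_0_var. rewrite Rsqr_sqrt by nra.
assert (H1 := Rsqr_abs x). assert (H2 := Rsqr_abs y).
assert (0 <= Rabs x) by apply Rabs_pos. assert (0 <= Rabs y) by apply Rabs_pos.
unfold Rsqr in *. nra.
assert (0 <= Rabs x) by apply Rabs_pos. assert (0 <= Rabs y) by apply Rabs_pos. lra.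
Qed.
Lemma Cmod_lt_box (z : C) d : Rabs (fst z) < d / 2 -> Rabs (snd z) < d / 2 -> Cmod z < d.
Proof. intros. apply Rle_lt_trans with (1 := Cmod_le_Rabs z). unfold Re, Im. lra. Qed.

(** The Cauchy-Riemann equations as an equivalence: the converse differentiates [cexp] and [Ln] from
    their real formulas, the direct part feeds [cderiv_path]. *)
Lemma cderiv_CR h x y l : cderiv h (x,y) l <->
  differentiable_pt_lim (fun u v => Re (h (u,v))) x y (Re l) (- Im l) /\
  differentiable_pt_lim (fun u v => Im (h (u,v))) x y (Im l) (Re l).
Proof.
rewrite cderiv_eps. split.
- intros H. 
  assert (G : forall eps : posreal, locally_2d (fun u v => Cmod (h (u,v) - h (x,y) - l * ((u,v)-(x,y))) <= eps * Rmax (Rabs (u - x)) (Rabs (v - y))) x y).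
  { intros e. destruct (H (e/2)) as [d [Hd H']]. { assert (He := cond_pos e). lra. }
    assert (Hd2 : 0 < d/2) by lra.
    exists (mkposreal _ Hd2). intros u v Hu Hv. simpl in Hu, Hv.
    eapply Rle_trans. apply H'. apply Cmod_lt_box; simpl; assumption.
    eapply Rle_trans. apply Rmult_le_compat_l. { assert (He := cond_pos e). lra. }
    apply Cmod_le_Rabs. simpl. 
    assert (H1 := Rmax_l (Rabs (u-x)) (Rabs (v-y))). assert (H2 := Rmax_r (Rabs (u-x)) (Rabs (v-y))).
    assert (He := cond_pos e). unfold Rminus in *. nra. }
  split; intros e; destruct (G e) as [d Hd]; exists d; intros u v Hu Hv; specialize (Hd u v Hu Hv);
  eapply Rle_trans; try exact Hd.
  + eapply Rle_trans; [|apply re_le_Cmod]. right. apply (f_equal Rabs). unfold Re, Im; simpl. ring.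
  + eapply Rle_trans; [|apply Im_le_Cmod]. right. apply (f_equal Rabs). unfold Re, Im; simpl. ring.
- intros [H1 H2] e He.
  assert (He2 : 0 < e/2) by lra.
  destruct (H1 (mkposreal _ He2)) as [d1 Hd1]. destruct (H2 (mkposreal _ He2)) as [d2 Hd2].
  exists (Rmin d1 d2). split. apply Rmin_pos; apply cond_pos.
  intros [u v] Hw. simpl in Hd1, Hd2.
  assert (Hb := Rmax_Cmod ((u,v)-(x,y))%C). simpl in Hb.
  assert (B1 := Rmax_l (Rabs (u+-x)) (Rabs (v+-y))). assert (B2 := Rmax_r (Rabs (u+-x)) (Rabs (v+-y))).
  assert (B3 := Rmin_l d1 d2). assert (B4 := Rmin_r d1 d2).
  eapply Rle_trans. apply Cmod_le_Rabs.
  specialize (Hd1 u v). specialize (Hd2 u v). unfold Rminus in *.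
  assert (C1 := Hd1 ltac:(lra) ltac:(lra)). assert (C2 := Hd2 ltac:(lra) ltac:(lra)).
  replace (Re (h (u, v) - h (x, y) - l * ((u, v) - (x, y)))) with (Re (h (u, v)) + - Re (h (x, y)) + - (Re l * (u + - x) + - Im l * (v + - y))) by (unfold Re, Im; simpl; ring).
  replace (Im (h (u, v) - h (x, y) - l * ((u, v) - (x, y)))) with (Im (h (u, v)) + - Im (h (x, y)) + - (Im l * (u + - x) + Re l * (v + - y))) by (unfold Re, Im; simpl; ring).
  assert (0 <= Cmod ((u, v) - (x, y))) by apply Cmod_ge_0.
  eapply Rle_trans. apply Rplus_le_compat. exact C1. exact C2.
  nra.
Qed.

Lemma cderiv_ext_loc (f g : C -> C) z l : (exists d, 0 < d /\ forall w, Cmod (w - z) < d -> f w = g w) -> cderiv f z l -> cderiv g z l.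
Proof.
intros [d [Hd E]]. rewrite !cderiv_eps. intros H e He.
destruct (H e He) as [d' [Hd' H']]. exists (Rmin d d'). split. apply Rmin_pos; assumption.
intros w Hw. assert (B1 := Rmin_l d d'). assert (B2 := Rmin_r d d').
rewrite <- !E. apply H'. lra. replace (z-z)%C with (RtoC 0) by ring. rewrite Cmod_0. lra. lra.
Qed.
Lemma cderiv_ext (f g : C -> C) z l : (forall w, f w = g w) -> cderiv f z l -> cderiv g z l.
Proof.
intros E. apply cderiv_ext_loc. exists 1. split. lra. intros; apply E.
Qed.
Lemma cderiv_const (c z : C) : cderiv (fun _ => c) z (RtoC 0).
Proof.
rewrite cderiv_eps. intros e He. exists 1. split. lra. intros w _.
replace (c - c - 0 * (w - z))%C with (RtoC 0) by ring. rewrite Cmod_0.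
assert (0 <= Cmod (w - z)) by apply Cmod_ge_0. nra.
Qed.
Lemma cderiv_id z : cderiv (fun w => w) z (RtoC 1).
Proof.
rewrite cderiv_eps. intros e He. exists 1. split. lra. intros w _.
replace (w - z - 1 * (w - z))%C with (RtoC 0) by ring. rewrite Cmod_0.
assert (0 <= Cmod (w - z)) by apply Cmod_ge_0. nra.
Qed.
Lemma cderiv_plus f g z df dg : cderiv f z df -> cderiv g z dg -> cderiv (fun w => Cplus (f w) (g w)) z (Cplus df dg).
Proof.
intros H1 H2. exact (is_derive_plus (V:=C_NormedModule) f g z df dg H1 H2).
Qed.
Lemma cderiv_scal c f z df : cderiv f z df -> cderiv (fun w => Cmult c (f w)) z (Cmult c df).
Proof.
intros H. assert (A := cderiv_mult _ _ _ _ _ (cderiv_const c z) H). simpl in A.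
replace (c * df)%C with (0 * f z + c * df)%C by ring. exact A.
Qed.
Lemma cderiv_opp f z df : cderiv f z df -> cderiv (fun w => Copp (f w)) z (Copp df).
Proof.
intros H. apply cderiv_ext with (fun w => Cmult (- RtoC 1) (f w)). intros; ring.
replace (-df)%C with (- RtoC 1 * df)%C by ring. now apply cderiv_scal.
Qed.
Lemma cderiv_minus f g z df dg : cderiv f z df -> cderiv g z dg -> cderiv (fun w => Cminus (f w) (g w)) z (Cminus df dg).
Proof.
intros H1 H2. apply cderiv_plus. exact H1. now apply cderiv_opp.
Qed.
Lemma Cmod_reverse z w : Cmod z - Cmod (w - z) <= Cmod w.
Proof.
assert (H := Cmod_triangle w (-(w-z))). replace (w + - (w - z))%C with z in H by ring. rewrite Cmod_opp in H. lra.
Qed.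
(** For [Cinv] and [csqrt] the remainder is an explicit fraction with numerator (w - z)^2, so only
    its denominator has to be bounded from below. *)
Lemma cderiv_quad (h : C -> C) z l M d : 0 < d -> 
  (forall w, Cmod (w - z) < d -> Cmod (h w - h z - l * (w - z)) <= M * Cmod (w - z) * Cmod (w - z)) -> cderiv h z l.
Proof.
intros Hd H. rewrite cderiv_eps. intros e He.
exists (Rmin d (e / (Rabs M + 1))). assert (HM := Rabs_pos M). assert (HM' := Rle_abs M).
split. apply Rmin_pos. assumption. apply Rdiv_lt_0_compat; lra.
intros w Hw. assert (B1 := Rmin_l d (e / (Rabs M + 1))). assert (B2 := Rmin_r d (e / (Rabs M + 1))).
eapply Rle_trans. apply H. lra.
assert (P := Cmod_ge_0 (w-z)).
apply Rmult_le_compat_r. exact P.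
assert (Cmod (w - z) <= e / (Rabs M + 1)) by lra.
apply Rle_trans with ((Rabs M + 1) * (e / (Rabs M + 1))). 
apply Rle_trans with ((Rabs M + 1) * Cmod (w-z)). nra. apply Rmult_le_compat_l; lra.
right. field. lra.
Qed.
(** The remainder is (w - z)^2 / (w z^2), and |w| >= |z| / 2 when w is within |z| / 2 of z. *)
Lemma cderiv_inv z : z <> RtoC 0 -> cderiv Cinv z (- / (z * z))%C.
Proof.
intros Hz. assert (Pz : 0 < Cmod z) by now apply Cmod_gt_0.
apply cderiv_quad with (M := 2 / (Cmod z * (Cmod z * Cmod z))) (d := Cmod z / 2). lra.
intros w Hw. assert (Rv := Cmod_reverse z w).
assert (Hw0 : w <> RtoC 0). { intros ->. rewrite Cmod_0 in Rv. lra. }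
replace (/ w - / z - - / (z * z) * (w - z))%C with ((w-z)*(w-z) / (w * (z*z)))%C by (field; split; assumption).
assert (w * (z*z) <> RtoC 0)%C by (repeat apply Cmult_neq_0; assumption).
rewrite Cmod_div by assumption. rewrite !Cmod_mult.
rewrite (Rmult_assoc (2 / _)), (Rmult_comm (2 / _)). unfold Rdiv at 1.
apply Rmult_le_compat_l. assert (P := Cmod_ge_0 (w-z)). nra.
apply Rle_trans with (/ ((Cmod z / 2) * (Cmod z * Cmod z))).
apply Rinv_le_contravar. repeat apply Rmult_lt_0_compat; lra. apply Rmult_le_compat_r. nra. lra.
right. field. lra.
Qed.
Lemma cderiv_path (h : C -> C) (c1 c2 : R -> R) t d1 d2 l :
  cderiv h (c1 t, c2 t) l -> is_derive c1 t d1 -> is_derive c2 t d2 ->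
  is_derive (fun s => Re (h (c1 s, c2 s))) t (Re (l * (d1,d2))) /\
  is_derive (fun s => Im (h (c1 s, c2 s))) t (Im (l * (d1,d2))).
Proof.
intros H H1 H2. apply cderiv_CR in H. destruct H as [HU HV].
apply is_derive_Reals in H1. apply is_derive_Reals in H2.
split; apply is_derive_Reals.
- replace (Re (l * (d1, d2))) with (Re l * d1 + - Im l * d2) by (unfold Re, Im; simpl; ring).
  exact (derivable_pt_lim_comp_2d _ _ _ _ _ _ _ _ HU H1 H2).
- replace (Im (l * (d1, d2))) with (Im l * d1 + Re l * d2) by (unfold Re, Im; simpl; ring).
  exact (derivable_pt_lim_comp_2d _ _ _ _ _ _ _ _ HV H1 H2).
Qed.
Lemma cderiv_cont_Re h x y l : cderiv h (x,y) l -> continuity_2d_pt (fun u v => Re (h (u,v))) x y.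
Proof.
intros H. apply cderiv_CR in H. apply differentiable_continuity_pt. exists (Re l), (-Im l). apply H.
Qed.
Lemma differentiable_pt_lim_Rmult x y : differentiable_pt_lim Rmult x y y x.
Proof.
apply filterdiff_differentiable_pt_lim.
apply filterdiff_ext_lin with (fun t : R*R => plus (mult (fst t) y) (mult x (snd t))).
apply (filterdiff_mult (K:=R_AbsRing) (x,y)). exact (fun P HP => HP). apply Rmult_comm.
intros [u v]. simpl. unfold plus, mult; simpl. ring.
Qed.
Lemma differentiable_pt_lim_comp1 (f : R -> R) (g : R -> R -> R) x y a b l : derivable_pt_lim f (g x y) l -> differentiable_pt_lim g x y a b ->
  differentiable_pt_lim (fun u v => f (g u v)) x y (l * a) (l * b).
Proof.
intros H1 H2.
apply (differentiable_pt_lim_proj1_0 f (g x y) (g x y) l) in H1.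
assert (H := differentiable_pt_lim_comp (fun u _ => f u) g g x y _ _ _ _ _ _ H1 H2 H2).
replace (l * a) with (l * a + 0 * a) by ring. replace (l*b) with (l*b+0*b) by ring. exact H.
Qed.
Lemma differentiable_pt_lim_fst x y : differentiable_pt_lim (fun u _ => u) x y 1 0.
Proof. apply (differentiable_pt_lim_proj1_0 (fun u => u)). apply derivable_pt_lim_id. Qed.
Lemma differentiable_pt_lim_snd x y : differentiable_pt_lim (fun _ v => v) x y 0 1.
Proof.
intros e. exists e. intros u v _ _. replace (v - y - (0*(u-x)+1*(v-y))) with 0 by ring. rewrite Rabs_R0.
assert (B := Rmax_l (Rabs (u-x)) (Rabs (v-y))). assert (0 <= Rabs (u-x)) by apply Rabs_pos. assert (P := cond_pos e). nra.
Qed.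
Lemma differentiable_pt_lim_mult f g x y a b c d : differentiable_pt_lim f x y a b -> differentiable_pt_lim g x y c d ->
  differentiable_pt_lim (fun u v => f u v * g u v) x y (g x y * a + f x y * c) (g x y * b + f x y * d).
Proof.
intros H1 H2. exact (differentiable_pt_lim_comp Rmult f g x y _ _ _ _ _ _ (differentiable_pt_lim_Rmult _ _) H1 H2).
Qed.

(** * Exponential, logarithm and square root *)

Definition cexp (z : C) : C := (exp (Re z) * cos (Im z), exp (Re z) * sin (Im z)).
Lemma cderiv_cexp z : cderiv cexp z (cexp z).
Proof.
destruct z as [x y]. apply cderiv_CR.
assert (He : differentiable_pt_lim (fun u _ => exp u) x y (exp x) 0).
{ apply (differentiable_pt_lim_proj1_0 exp). apply derivable_pt_lim_exp. }
assert (Hc := differentiable_pt_lim_comp1 cos _ x y _ _ _ (derivable_pt_lim_cos y) (differentiable_pt_lim_snd x y)).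
assert (Hs := differentiable_pt_lim_comp1 sin _ x y _ _ _ (derivable_pt_lim_sin y) (differentiable_pt_lim_snd x y)).
assert (P1 := differentiable_pt_lim_mult _ _ _ _ _ _ _ _ He Hc). assert (P2 := differentiable_pt_lim_mult _ _ _ _ _ _ _ _ He Hs).
simpl in *. split.
- replace (exp x * cos y) with (cos y * exp x + exp x * (- sin y * 0)) by ring.
  replace (-(exp x * sin y)) with (cos y * 0 + exp x * (- sin y * 1)) by ring. exact P1.
- replace (exp x * sin y) with (sin y * exp x + exp x * (cos y * 0)) by ring.
  replace (exp x * cos y) with (sin y * 0 + exp x * (cos y * 1)) by ring. exact P2.
Qed.

(** The principal logarithm on the right half-plane only: elsewhere [atan (y / x)] is not the
    principal argument. *)
Definition Ln (z : C) : C := (ln (Re z * Re z + Im z * Im z) / 2, atan (Im z / Re z)).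
Lemma cderiv_Ln z : 0 < Re z -> cderiv Ln z (/ z)%C.
Proof.
destruct z as [x y]. simpl. intros Hx. apply cderiv_CR.
assert (N : 0 < x * x + y * y) by nra.
assert (Hxx := differentiable_pt_lim_mult _ _ _ _ _ _ _ _ (differentiable_pt_lim_fst x y) (differentiable_pt_lim_fst x y)).
assert (Hyy := differentiable_pt_lim_mult _ _ _ _ _ _ _ _ (differentiable_pt_lim_snd x y) (differentiable_pt_lim_snd x y)).
assert (Pl : forall a b, differentiable_pt_lim Rplus a b 1 1).
{ intros a b e. exists e. intros u v _ _. replace (u + v - (a+b) - (1*(u-a)+1*(v-b))) with 0 by ring. rewrite Rabs_R0.
assert (B := Rmax_l (Rabs (u-a)) (Rabs (v-b))). assert (0 <= Rabs (u-a)) by apply Rabs_pos. assert (P := cond_pos e). nra. }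
assert (Hn := differentiable_pt_lim_comp Rplus _ _ x y _ _ _ _ _ _ (Pl _ _) Hxx Hyy).
assert (D1 : derivable_pt_lim (fun u => ln u / 2) (x*x+y*y) (/ (x*x+y*y) / 2)).
{ apply is_derive_Reals. auto_derive. exact N. field. lra. }
assert (L1 := differentiable_pt_lim_comp1 _ _ x y _ _ _ D1 Hn).
assert (D2 : derivable_pt_lim Rinv x (- / (x * x))).
{ apply is_derive_Reals. auto_derive. lra. field. lra. }
assert (Hi := differentiable_pt_lim_comp1 _ _ x y _ _ _ D2 (differentiable_pt_lim_fst x y)).
assert (Hq := differentiable_pt_lim_mult _ _ _ _ _ _ _ _ (differentiable_pt_lim_snd x y) Hi).
assert (D3 := derivable_pt_lim_atan (y / x)).
assert (L2 := differentiable_pt_lim_comp1 _ _ x y _ _ _ D3 Hq).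
split.
- eapply eq_rect with (P := fun a => differentiable_pt_lim _ x y _ a); [eapply eq_rect with (P := fun a => differentiable_pt_lim _ x y a _)|].
  exact L1. simpl. field. nra. simpl. field. nra.
- eapply eq_rect with (P := fun a => differentiable_pt_lim _ x y _ a); [eapply eq_rect with (P := fun a => differentiable_pt_lim _ x y a _)|].
  exact L2. simpl. field. nra. simpl. field. nra.
Qed.

(** The root with positive real part: the half-angle formula gives its real part r, and 2 r Im = Im
    z gives the other. On the cut r = 0, hence the hypothesis [slit], which means lying off the
    nonpositive reals. *)
Definition csqrt (z : C) : C := let r := sqrt ((Cmod z + Re z) / 2) in (r, Im z / (2 * r)).
Definition slit (z : C) : Prop := 0 < Re z \/ Im z <> 0.
Lemma slit_pos z : slit z -> 0 < Cmod z + Re z.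
Proof.
intros H. assert (A := Cmod2_alt z). assert (B := Cmod_ge_0 z). destruct H as [H|H].
lra. assert (0 < Im z ^2). { apply pow2_gt_0. assumption. } nra.
Qed.
Lemma csqrt_Re z : slit z -> 0 < Re (csqrt z).
Proof. intros H. apply slit_pos in H. simpl. apply sqrt_lt_R0. lra. Qed.
Lemma csqrt_sqr z : slit z -> (csqrt z * csqrt z = z)%C.
Proof.
intros H. assert (P := csqrt_Re z H). apply slit_pos in H. unfold csqrt in *.
set (r := sqrt _) in *. simpl in P. assert (Q : r * r = (Cmod z + Re z)/2). { apply sqrt_sqrt. lra. }
assert (A := Cmod2_alt z). assert (B := Cmod_ge_0 z). destruct z as [x y]. simpl in *. 
unfold Cmult; simpl. f_equal.
- assert (E : y * y = 4 * (r * r) * (r * r - x)). { nra. }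
  replace (r * r - y/(2*r) * (y/(2*r))) with (r*r - (y*y)/(4*(r*r))) by (field; lra). rewrite E. field. lra.
- field. lra.
Qed.
Lemma slit_open z : slit z -> exists d, 0 < d /\ forall w, Cmod (w - z) < d -> slit w.
Proof.
intros [H|H].
- exists (Re z). split. exact H. intros w Hw. left. 
  assert (A := re_le_Cmod (w-z)%C). simpl in A.
  assert (B : Rabs (fst w + - fst z) < Re z) by lra. apply Rabs_def2 in B. unfold Re in *. lra.
- exists (Rabs (Im z)). split. now apply Rabs_pos_lt. intros w Hw. right.
  assert (A := Im_le_Cmod (w-z)%C). simpl in A. intros E. unfold Im in *. rewrite E in A.
  rewrite Rplus_0_l, Rabs_Ropp in A. lra.
Qed.
(** With s and t the roots of z and w, the remainder is - (w - z)^2 / (2 s (t + s)^2). Both roots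
    have positive real part, so |t + s| >= Re s. *)
Lemma cderiv_csqrt z : slit z -> cderiv csqrt z (/ (2 * csqrt z))%C.
Proof.
intros Hz. destruct (slit_open z Hz) as [d [Hd Ho]].
assert (P := csqrt_Re z Hz). assert (Sz := csqrt_sqr z Hz). set (s := csqrt z) in *.
assert (s0 : s <> RtoC 0). { intros E. rewrite E in P. simpl in P. lra. }
assert (Ps := re_le_Cmod s). rewrite Rabs_right in Ps by lra.
apply cderiv_quad with (M := / (2 * Re s * (Re s * Re s))) (d := d). exact Hd.
intros w Hw. specialize (Ho w Hw). assert (Pw := csqrt_Re w Ho). assert (Sw := csqrt_sqr w Ho).
fold s. set (t := csqrt w) in *.
assert (Pt := re_le_Cmod (t + s)%C). rewrite Rabs_right in Pt by (simpl in *; unfold Re in *; lra).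
assert (Pt' : Re s <= Cmod (t + s)). { simpl in *. unfold Re in *. lra. }
assert (t0 : (t + s <> RtoC 0)%C). { intros E. rewrite E, Cmod_0 in Pt'. lra. }
replace (t - s - / (2 * s) * (w - z))%C with (- ((w - z) * (w - z)) / (2 * s * ((t + s) * (t + s))))%C.
2:{ rewrite <- Sw, <- Sz. field. split; assumption. }
rewrite Cmod_div by (repeat apply Cmult_neq_0; try assumption; try (intros E; apply RtoC_inj in E; lra)). rewrite Cmod_opp, !Cmod_mult.
rewrite (Rmult_assoc (/ _)), (Rmult_comm (/ _)). unfold Rdiv. apply Rmult_le_compat_l. assert (Q := Cmod_ge_0 (w-z)). nra.
apply Rinv_le_contravar. repeat apply Rmult_lt_0_compat; lra. rewrite Cmod_R, Rabs_right by lra.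
apply Rmult_le_compat; nra.
Qed.

(** * Goursat's theorem on rectangles *)

Definition cdiff (h : C -> C) (z : C) : Prop := exists l, cderiv h z l.

Lemma cdiff_continuous h (c1 c2 : R -> R) t : cdiff h (c1 t, c2 t) -> ex_derive c1 t -> ex_derive c2 t ->
  continuous (fun s => Re (h (c1 s, c2 s))) t /\ continuous (fun s => Im (h (c1 s, c2 s))) t.
Proof.
intros [l Hl] [d1 H1] [d2 H2]. destruct (cderiv_path h c1 c2 t d1 d2 l Hl H1 H2) as [A B].
split; apply (ex_derive_continuous (V:=R_NormedModule)); eexists; eassumption.
Qed.

Lemma continuous_Re_h h x y : cdiff h (x,y) -> continuous (fun s => Re (h (s,y))) x.
Proof. intros H. exact (proj1 (cdiff_continuous h (fun s => s) (fun _ => y) x H (ex_derive_id _) (ex_derive_const _ _))). Qed.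
Lemma continuous_Im_h h x y : cdiff h (x,y) -> continuous (fun s => Im (h (s,y))) x.
Proof. intros H. exact (proj2 (cdiff_continuous h (fun s => s) (fun _ => y) x H (ex_derive_id _) (ex_derive_const _ _))). Qed.
Lemma continuous_Im_v h x y : cdiff h (x,y) -> continuous (fun s => Im (h (x,s))) y.
Proof. intros H. exact (proj2 (cdiff_continuous h (fun _ => x) (fun s => s) y H (ex_derive_const _ _) (ex_derive_id _))). Qed.

Lemma ex_RInt_cont (f : R -> R) a b : a <= b -> (forall x, a <= x <= b -> continuous f x) -> ex_RInt f a b.
Proof.
intros Hab H. apply (ex_RInt_continuous (V:=R_CompleteNormedModule)). intros z. rewrite Rmin_left, Rmax_right by lra. apply H.
Qed.

Lemma RInt_plusR (f g : R -> R) a b : ex_RInt f a b -> ex_RInt g a b -> RInt (fun x => f x + g x) a b = RInt f a b + RInt g a b.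
Proof. intros. apply (RInt_plus (V:=R_CompleteNormedModule)); assumption. Qed.
Lemma RInt_minusR (f g : R -> R) a b : ex_RInt f a b -> ex_RInt g a b -> RInt (fun x => f x - g x) a b = RInt f a b - RInt g a b.
Proof. intros. apply (RInt_minus (V:=R_CompleteNormedModule)); assumption. Qed.
Lemma RInt_scalR (f : R -> R) c a b : ex_RInt f a b -> RInt (fun x => c * f x) a b = c * RInt f a b.
Proof. intros. apply (RInt_scal (V:=R_CompleteNormedModule)); assumption. Qed.
Lemma RInt_ChaslesR (f : R -> R) a b c : ex_RInt f a b -> ex_RInt f b c -> RInt f a b + RInt f b c = RInt f a c.
Proof. intros. apply (RInt_Chasles (V:=R_CompleteNormedModule)); assumption. Qed.
Lemma RInt_constR (c a b : R) : RInt (fun _ => c) a b = (b - a) * c.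
Proof. rewrite RInt_const. reflexivity. Qed.
Lemma ex_RInt_minusR (f g : R -> R) a b : ex_RInt f a b -> ex_RInt g a b -> ex_RInt (fun x => f x - g x) a b.
Proof. intros. apply (ex_RInt_minus (V:=R_NormedModule)); assumption. Qed.
Lemma ex_RInt_constR (c a b : R) : ex_RInt (fun _ => c) a b.
Proof. apply (ex_RInt_const (V:=R_NormedModule)). Qed.

Lemma RInt_extR (f g : R -> R) a b : a <= b -> (forall x, a <= x <= b -> f x = g x) -> RInt f a b = RInt g a b.
Proof. intros Hab H. apply RInt_ext. rewrite Rmin_left, Rmax_right by lra. intros x Hx. apply H. lra. Qed.

Section Goursat.
Variable h : C -> C.

(** The real part of the counterclockwise contour integral of h dz. *)
Definition rect_int x1 x2 y1 y2 : R :=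
  RInt (fun x => Re (h (x,y1)) - Re (h (x,y2))) x1 x2 - RInt (fun y => Im (h (x2,y)) - Im (h (x1,y))) y1 y2.
Definition holo_rect x1 x2 y1 y2 := forall x y, x1 <= x <= x2 -> y1 <= y <= y2 -> cdiff h (x,y).

Lemma rect_ex_h x1 x2 y1 y2 y y' : holo_rect x1 x2 y1 y2 -> x1 <= x2 -> y1 <= y <= y2 -> y1 <= y' <= y2 ->
  ex_RInt (fun x => Re (h (x,y)) - Re (h (x,y'))) x1 x2.
Proof.
intros H Hx Hy Hy'. apply ex_RInt_minusR; apply ex_RInt_cont; try assumption; intros x Hx'; apply continuous_Re_h; apply H; assumption.
Qed.
Lemma rect_ex_v x1 x2 y1 y2 x x' : holo_rect x1 x2 y1 y2 -> y1 <= y2 -> x1 <= x <= x2 -> x1 <= x' <= x2 ->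
  ex_RInt (fun y => Im (h (x,y)) - Im (h (x',y))) y1 y2.
Proof.
intros H Hx Hy Hy'. apply ex_RInt_minusR; apply ex_RInt_cont; try assumption; intros y Hx'; apply continuous_Im_v; apply H; assumption.
Qed.

Lemma holo_rect_sub x1 x2 y1 y2 x1' x2' y1' y2' : holo_rect x1 x2 y1 y2 -> x1 <= x1' -> x2' <= x2 -> y1 <= y1' -> y2' <= y2 -> holo_rect x1' x2' y1' y2'.
Proof. intros H ? ? ? ? x y ? ?. apply H; lra. Qed.

Lemma rect_split_h x1 m x2 y1 y2 : holo_rect x1 x2 y1 y2 -> x1 <= m <= x2 -> y1 <= y2 ->
  rect_int x1 x2 y1 y2 = rect_int x1 m y1 y2 + rect_int m x2 y1 y2.
Proof.
intros H Hm Hy. unfold rect_int. 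
rewrite <- (RInt_ChaslesR (fun x => Re (h (x,y1)) - Re (h (x,y2))) x1 m x2).
2,3: eapply rect_ex_h; [eapply holo_rect_sub with (1:=H)|..]; try apply Rle_refl; lra.
replace (RInt (fun y => Im (h (x2, y)) - Im (h (x1, y))) y1 y2) with (RInt (fun y => Im (h (m, y)) - Im (h (x1, y))) y1 y2 + RInt (fun y => Im (h (x2, y)) - Im (h (m, y))) y1 y2). ring.
rewrite <- RInt_plusR by (eapply rect_ex_v; [exact H|lra..]).
apply RInt_extR. lra. intros; ring.
Qed.
Lemma rect_split_v x1 x2 y1 m y2 : holo_rect x1 x2 y1 y2 -> x1 <= x2 -> y1 <= m <= y2 ->
  rect_int x1 x2 y1 y2 = rect_int x1 x2 y1 m + rect_int x1 x2 m y2.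
Proof.
intros H Hm Hy. unfold rect_int. 
rewrite <- (RInt_ChaslesR (fun y => Im (h (x2,y)) - Im (h (x1,y))) y1 m y2).
2,3: eapply rect_ex_v; [eapply holo_rect_sub with (1:=H)|..]; try apply Rle_refl; lra.
replace (RInt (fun x => Re (h (x, y1)) - Re (h (x, y2))) x1 x2) with (RInt (fun x => Re (h (x, y1)) - Re (h (x, m))) x1 x2 + RInt (fun x => Re (h (x, m)) - Re (h (x, y2))) x1 x2). ring.
rewrite <- RInt_plusR by (eapply rect_ex_h; [exact H|lra..]).
apply RInt_extR. lra. intros; ring.
Qed.

(** The affine part of h contributes Im l (y2 - y1) (x2 - x1) to both integrals and cancels. What
    remains is at most e L on each of the four sides, L being half the perimeter. *)
Lemma rect_int_local x0 y0 l e d x1 x2 y1 y2 : 0 < e ->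
  (forall w, Cmod (w - (x0,y0)) < d -> Cmod (h w - h (x0,y0) - l * (w - (x0,y0))) <= e * Cmod (w - (x0,y0))) ->
  holo_rect x1 x2 y1 y2 -> x1 <= x0 <= x2 -> y1 <= y0 <= y2 -> (x2 - x1) + (y2 - y1) < d ->
  Rabs (rect_int x1 x2 y1 y2) <= 2 * e * ((x2 - x1) + (y2 - y1)) ^ 2.
Proof.
intros He H Hh Hx Hy Hd. set (L := (x2 - x1) + (y2 - y1)) in *.
assert (K : forall x y, x1 <= x <= x2 -> y1 <= y <= y2 -> Cmod (h (x,y) - h (x0,y0) - l * ((x,y) - (x0,y0))) <= e * L).
{ intros x y Kx Ky. 
  assert (Cmod ((x,y)-(x0,y0)) <= L).
  { eapply Rle_trans. apply Cmod_le_Rabs. simpl. unfold L. 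
    apply Rplus_le_compat; apply Rabs_le; lra. }
  eapply Rle_trans. apply H. lra. apply Rmult_le_compat_l; lra. }
assert (HRe : forall x y, x1 <= x <= x2 -> y1 <= y <= y2 -> Rabs (Re (h (x,y)) - (Re (h (x0,y0)) + Re l * (x - x0) - Im l * (y - y0))) <= e * L).
{ intros x y Kx Ky. eapply Rle_trans; [|apply (K x y Kx Ky)]. eapply Rle_trans; [|apply re_le_Cmod].
  right. apply (f_equal Rabs). unfold Re, Im; simpl. ring. }
assert (HIm : forall x y, x1 <= x <= x2 -> y1 <= y <= y2 -> Rabs (Im (h (x,y)) - (Im (h (x0,y0)) + Im l * (x - x0) + Re l * (y - y0))) <= e * L).
{ intros x y Kx Ky. eapply Rle_trans; [|apply (K x y Kx Ky)]. eapply Rle_trans; [|apply Im_le_Cmod].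
  right. apply (f_equal Rabs). unfold Re, Im; simpl. ring. }
assert (E1 := rect_ex_h _ _ _ _ y1 y2 Hh ltac:(lra) ltac:(lra) ltac:(lra)).
assert (E2 := rect_ex_v _ _ _ _ x2 x1 Hh ltac:(lra) ltac:(lra) ltac:(lra)).
unfold rect_int.
replace (RInt (fun x => Re (h (x, y1)) - Re (h (x, y2))) x1 x2 - RInt (fun y => Im (h (x2, y)) - Im (h (x1, y))) y1 y2)
 with (RInt (fun x => (Re (h (x, y1)) - Re (h (x, y2))) - Im l * (y2 - y1)) x1 x2 - RInt (fun y => (Im (h (x2, y)) - Im (h (x1, y))) - Im l * (x2 - x1)) y1 y2).
2:{ rewrite (RInt_minusR (fun x => Re (h (x, y1)) - Re (h (x, y2))) (fun _ => Im l * (y2 - y1))) by (assumption || apply ex_RInt_constR).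
    rewrite (RInt_minusR (fun y => Im (h (x2, y)) - Im (h (x1, y))) (fun _ => Im l * (x2 - x1))) by (assumption || apply ex_RInt_constR).
    rewrite !RInt_constR. ring. }
assert (B1 : Rabs (RInt (fun x => (Re (h (x, y1)) - Re (h (x, y2))) - Im l * (y2 - y1)) x1 x2) <= (x2 - x1) * (2 * (e * L))).
{ apply abs_RInt_le_const. lra. apply ex_RInt_minusR. exact E1. apply ex_RInt_constR.
  intros x Kx. assert (A1 := HRe x y1 Kx ltac:(lra)). assert (A2 := HRe x y2 Kx ltac:(lra)).
  apply Rabs_le_between in A1. apply Rabs_le_between in A2. apply Rabs_le. lra. }
assert (B2 : Rabs (RInt (fun y => (Im (h (x2, y)) - Im (h (x1, y))) - Im l * (x2 - x1)) y1 y2) <= (y2 - y1) * (2 * (e * L))).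
{ apply abs_RInt_le_const. lra. apply ex_RInt_minusR. exact E2. apply ex_RInt_constR.
  intros y Ky. assert (A1 := HIm x1 y ltac:(lra) Ky). assert (A2 := HIm x2 y ltac:(lra) Ky).
  apply Rabs_le_between in A1. apply Rabs_le_between in A2. apply Rabs_le. lra. }
eapply Rle_trans. apply Rabs_triang. rewrite Rabs_Ropp.
replace (2 * e * L ^ 2) with ((x2 - x1) * (2 * (e * L)) + (y2 - y1) * (2 * (e * L))) by (unfold L; ring).
apply Rplus_le_compat; assumption.
Qed.

(* [quarter] selects a quarter of the rectangle on which the bound [small] still fails. *)
Section Bisection.
Variable eps : R.
Definition small x y w k := Rabs (rect_int x (x + w) y (y + k)) <= eps * (w + k) ^ 2.
Definition quarter (p : R * R) w k : R * R :=
  let (x, y) := p in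
  if Rle_dec (Rabs (rect_int x (x + w) y (y + k))) (eps * (w + k) ^ 2) then
    if Rle_dec (Rabs (rect_int (x + w) (x + w + w) y (y + k))) (eps * (w + k) ^ 2) then
      if Rle_dec (Rabs (rect_int x (x + w) (y + k) (y + k + k))) (eps * (w + k) ^ 2) then (x + w, y + k)
      else (x, y + k)
    else (x + w, y)
  else (x, y).
Lemma quarter_bounds p w k : 0 <= w -> 0 <= k -> fst p <= fst (quarter p w k) <= fst p + w /\ snd p <= snd (quarter p w k) <= snd p + k.
Proof.
intros. destruct p as [x y]. unfold quarter. repeat destruct Rle_dec; simpl; lra.
Qed.
Lemma quarter_not_small p w k : 0 <= w -> 0 <= k -> holo_rect (fst p) (fst p + 2 * w) (snd p) (snd p + 2 * k) ->
  ~ small (fst p) (snd p) (2 * w) (2 * k) -> ~ small (fst (quarter p w k)) (snd (quarter p w k)) w k.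
Proof.
intros Hw Hk Hh H. destruct p as [x y]. unfold quarter. simpl in Hh, H.
repeat destruct Rle_dec; simpl; try assumption.
(* [quarter] returns the fourth quarter without testing it. If it were small too, the four bounds
   would add up to the bound for the whole, since 4 (w + k)^2 = (2 w + 2 k)^2. *)
intros S4. apply H. unfold small in *. 
rewrite (rect_split_h x (x+w)), (rect_split_v x (x+w) y (y+k)), (rect_split_v (x+w) _ y (y+k)) by
 (first [lra | eapply holo_rect_sub with (1:=Hh); lra]).
replace (x + 2 * w) with (x + w + w) by ring. replace (y + 2 * k) with (y + k + k) by ring.
replace (eps * (2 * w + 2 * k) ^ 2) with (eps * (w+k)^2 + eps * (w+k)^2 + (eps * (w+k)^2 + eps * (w+k)^2)) by ring.
eapply Rle_trans. apply Rabs_triang. apply Rplus_le_compat; (eapply Rle_trans; [apply Rabs_triang|]); apply Rplus_le_compat; assumption.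
Qed.
End Bisection.
End Goursat.

Lemma nested_intervals (u : nat -> R) w : 0 <= w -> (forall n, u n <= u (S n)) -> (forall n, u (S n) + w / 2 ^ (S n) <= u n + w / 2 ^ n) ->
  exists x, forall n, u n <= x <= u n + w / 2 ^ n.
Proof.
intros Hw H1 H2.
assert (Hp : forall n, 0 <= w / 2 ^ n). { intros n. apply Rdiv_le_0_compat. exact Hw. apply pow_lt; lra. }
assert (M1 : forall n k, u n <= u (n + k)%nat).
{ intros n k. induction k. rewrite Nat.add_0_r. lra. rewrite Nat.add_succ_r. specialize (H1 (n+k)%nat). lra. }
assert (M2 : forall n k, u (n + k)%nat + w / 2 ^ (n + k) <= u n + w / 2 ^ n).
{ intros n k. induction k. rewrite Nat.add_0_r. lra. rewrite Nat.add_succ_r. specialize (H2 (n+k)%nat). lra. }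
assert (M3 : forall m n, u m <= u n + w / 2 ^ n).
{ intros m n. assert (A := M1 m n). assert (B := M2 n m). rewrite (Nat.add_comm n m) in B. specialize (Hp (m+n)%nat). lra. }
destruct (completeness (fun r => exists n, r = u n)) as [x [Ub Lub]].
- exists (u O + w / 2 ^ 0). intros r [n ->]. apply M3.
- exists (u O). now exists O.
- exists x. intros n. split. apply Ub. now exists n. apply Lub. intros r [m ->]. apply M3.
Qed.

(** It is enough to bound the integral by e L^2 for every e > 0. A rectangle violating this contains
    nested violating quarters; differentiability at their common point, with error e / 2,
    contradicts the violation on a small one. *)
Lemma goursat h x1 x2 y1 y2 : x1 <= x2 -> y1 <= y2 -> holo_rect h x1 x2 y1 y2 -> rect_int h x1 x2 y1 y2 = 0.
Proof.
intros Hx Hy Hh. 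
assert (forall e, 0 < e -> Rabs (rect_int h x1 x2 y1 y2) <= e * ((x2 - x1) + (y2 - y1)) ^ 2).
{ intros e He. destruct (Rle_dec (Rabs (rect_int h x1 x2 y1 y2)) (e * ((x2 - x1) + (y2 - y1)) ^ 2)) as [ok|no]. exact ok. exfalso.
  set (w := x2 - x1) in *. set (k := y2 - y1) in *.
  set (c := fix c n := match n with O => (x1,y1) | S n => quarter h e (c n) (w / 2 ^ (S n)) (k / 2 ^ (S n)) end).
  assert (Hs : forall t n, t / 2 ^ n = 2 * (t / 2 ^ (S n))). { intros t n. simpl. field. apply pow_nonzero. lra. }
  assert (Hw : forall n, 0 <= w / 2 ^ n). { intros n. apply Rdiv_le_0_compat. unfold w; lra. apply pow_lt; lra. }
  assert (Hk : forall n, 0 <= k / 2 ^ n). { intros n. apply Rdiv_le_0_compat. unfold k; lra. apply pow_lt; lra. }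
  assert (Hb : forall n, fst (c n) <= fst (c (S n)) <= fst (c n) + w / 2 ^ (S n) /\ snd (c n) <= snd (c (S n)) <= snd (c n) + k / 2 ^ (S n)).
  { intros n. simpl c. apply quarter_bounds. apply (Hw (S n)). apply (Hk (S n)). }
  destruct (nested_intervals (fun n => fst (c n)) w) as [x0 Hx0]. unfold w; lra. intros n; apply Hb. 
  { intros n. rewrite (Hs w n). specialize (Hb n). lra. }
  destruct (nested_intervals (fun n => snd (c n)) k) as [y0 Hy0]. unfold k; lra. intros n; apply Hb.
  { intros n. rewrite (Hs k n). specialize (Hb n). lra. }
  assert (Hin : forall n, x1 <= fst (c n) /\ fst (c n) + w / 2 ^ n <= x2 /\ y1 <= snd (c n) /\ snd (c n) + k / 2 ^ n <= y2).
  { induction n. simpl. unfold w, k. lra. specialize (Hb n). rewrite (Hs w n), (Hs k n) in IHn. lra. }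
  assert (Hn : forall n, ~ small h e (fst (c n)) (snd (c n)) (w / 2 ^ n) (k / 2 ^ n)).
  { induction n. 
    - simpl. unfold small. intros A. apply no. unfold w, k in *. 
      replace (x1 + (x2 - x1) / 1) with x2 in A by field. replace (y1 + (y2 - y1) / 1) with y2 in A by field.
      replace ((x2 - x1) / 1 + (y2 - y1) / 1) with (x2 - x1 + (y2 - y1)) in A by field. exact A.
    - change (c (S n)) with (quarter h e (c n) (w / 2 ^ (S n)) (k / 2 ^ (S n))).
      apply quarter_not_small. apply Hw. apply Hk. rewrite <- !Hs. specialize (Hin n). eapply holo_rect_sub; [exact Hh|lra..].
      rewrite <- !Hs. exact IHn. }
  assert (Hp := Hx0 O). assert (Hq := Hy0 O). assert (Hi0 := Hin O).
  destruct (Hh x0 y0) as [l Hl]. lra. lra.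
  rewrite cderiv_eps in Hl. destruct (Hl (e/2)) as [d [Hd H]]. lra.
  (* This index makes the half-perimeter (w + k) / 2^N smaller than d; the added 1 covers the
     degenerate case w + k = 0. *)
  destruct (pow_lt_1_zero (/2) ltac:(rewrite Rabs_right; lra) (d / (w + k + 1))) as [N HN].
  { apply Rdiv_lt_0_compat. exact Hd. unfold w, k. lra. }
  specialize (HN N (Nat.le_refl N)). 
  apply (Hn N). unfold small. replace e with (2 * (e/2)) by field.
  specialize (Hx0 N). specialize (Hy0 N). specialize (Hin N). simpl in Hx0, Hy0.
  replace (w / 2 ^ N + k / 2 ^ N) with ((fst (c N) + w / 2 ^ N - fst (c N)) + (snd (c N) + k / 2 ^ N - snd (c N))) by ring.
  apply (rect_int_local h x0 y0 l (e/2) d); try lra. exact H.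
  { eapply holo_rect_sub; [exact Hh|lra..]. }
  rewrite pow_inv in HN. assert (P2 : 0 < 2 ^ N) by (apply pow_lt; lra). 
  rewrite Rabs_right in HN by (left; apply Rinv_0_lt_compat; exact P2).
  assert (0 <= w + k) by (unfold w, k; lra).
  assert ((w + k + 1) * / 2 ^ N < d). { apply (Rmult_lt_compat_l (w+k+1)) in HN. 2: lra. replace ((w + k + 1) * (d / (w + k + 1))) with d in HN by (field; lra). exact HN. }
  assert (0 < / 2 ^ N) by now apply Rinv_0_lt_compat. unfold Rdiv. lra. }
apply Rabs_eq_0. apply Rle_antisym; [|apply Rabs_pos]. apply le_epsilon. intros e He. rewrite Rplus_0_l.
set (L := (x2 - x1) + (y2 - y1)) in *. assert (0 <= L) by (unfold L; lra).
eapply Rle_trans. apply (H (e / (L ^ 2 + 1))). apply Rdiv_lt_0_compat; nra.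
apply Rle_trans with (e / (L^2+1) * (L^2+1)). apply Rmult_le_compat_l. apply Rdiv_le_0_compat; nra. lra. right. field. nra.
Qed.

(** * The Poisson formula on horizontal lines *)

Lemma cdiff_const c z : cdiff (fun _ => c) z.
Proof. eexists. apply cderiv_const. Qed.
Lemma cdiff_id z : cdiff (fun w => w) z.
Proof. eexists. apply cderiv_id. Qed.
Lemma cdiff_plus f g z : cdiff f z -> cdiff g z -> cdiff (fun w => f w + g w)%C z.
Proof. intros [a Ha] [b Hb]. eexists. apply cderiv_plus; eassumption. Qed.
Lemma cdiff_minus f g z : cdiff f z -> cdiff g z -> cdiff (fun w => f w - g w)%C z.
Proof. intros [a Ha] [b Hb]. eexists. apply cderiv_minus; eassumption. Qed.
Lemma cdiff_mult f g z : cdiff f z -> cdiff g z -> cdiff (fun w => f w * g w)%C z.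
Proof. intros [a Ha] [b Hb]. eexists. apply cderiv_mult; eassumption. Qed.
Lemma cdiff_comp f g z : cdiff f (g z) -> cdiff g z -> cdiff (fun w => f (g w)) z.
Proof. intros [a Ha] [b Hb]. eexists. apply cderiv_comp; eassumption. Qed.
Lemma cdiff_div f g z : cdiff f z -> cdiff g z -> g z <> RtoC 0 -> cdiff (fun w => f w / g w)%C z.
Proof.
intros Hf Hg H. apply cdiff_mult. exact Hf. apply (cdiff_comp Cinv). eexists. now apply cderiv_inv. exact Hg.
Qed.

Definition expi (z : C) : C := cexp ((0, (2 * PI)%R) * z)%C.
Lemma cderiv_expi z : cderiv expi z ((0, (2 * PI)%R) * expi z)%C.
Proof.
apply (cderiv_comp cexp (fun w => ((0, (2 * PI)%R) * w)%C)). apply cderiv_cexp.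
assert (A := cderiv_scal (0, (2 * PI)%R) _ _ _ (cderiv_id z)). simpl in A. rewrite Cmult_1_r in A. exact A.
Qed.
Lemma cdiff_expi z : cdiff expi z.
Proof. eexists. apply cderiv_expi. Qed.
Lemma expi_pair x y : expi (x,y) = (exp (- (2 * PI * y)) * cos (2 * PI * x), exp (- (2 * PI * y)) * sin (2 * PI * x)).
Proof.
unfold expi, cexp. simpl. 
replace (0 * x - 2 * PI * y) with (- (2 * PI * y)) by ring. replace (0 * y + 2 * PI * x) with (2 * PI * x) by ring. reflexivity.
Qed.
Lemma expi_polar x y : expi (x,y) = polar (exp (- (2 * PI * y))) x.
Proof. apply expi_pair. Qed.
Lemma expi_period x y : expi (x + 1, y) = expi (x, y).
Proof.
rewrite !expi_pair. replace (2 * PI * (x + 1)) with (2 * PI * x + 2 * PI) by ring.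
rewrite cos_plus, sin_plus, cos_2PI, sin_2PI. f_equal; ring.
Qed.
Lemma Cmod_polar r x : 0 <= r -> Cmod (polar r x) = r.
Proof.
intros Hr. unfold Cmod, polar; simpl fst; simpl snd.
replace ((r * cos (2 * PI * x)) ^ 2 + (r * sin (2 * PI * x)) ^ 2) with (r ^ 2 * (Rsqr (sin (2*PI*x)) + Rsqr (cos (2*PI*x)))) by (unfold Rsqr; ring).
rewrite sin2_cos2, Rmult_1_r. apply sqrt_pow2. exact Hr.
Qed.
Lemma Cmod_expi x y : Cmod (expi (x,y)) = exp (- (2 * PI * y)).
Proof. rewrite expi_polar. apply Cmod_polar. left. apply exp_pos. Qed.
Lemma exp_lt_1 y : 0 < y -> exp (- (2 * PI * y)) < 1.
Proof. intros. rewrite <- exp_0. apply exp_increasing. assert (P := PI_RGT_0). nra. Qed.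
Lemma Cmod_expi_lt x y : 0 < y -> Cmod (expi (x,y)) < 1.
Proof. intros. rewrite Cmod_expi. now apply exp_lt_1. Qed.
Lemma one_minus_neq q : Cmod q < 1 -> (1 - q <> RtoC 0)%C.
Proof.
intros H E. assert (q = RtoC 1). { replace q with (1 - (1 - q))%C by ring. rewrite E. ring. }
subst q. rewrite Cmod_1 in H. lra.
Qed.

(** By periodicity the two vertical sides cancel in Goursat's theorem, which leaves the two
    horizontal ones. *)
Lemma hline_const h A y1 y2 : y1 <= y2 -> (forall x y, A <= x <= A + 1 -> y1 <= y <= y2 -> cdiff h (x,y)) ->
  (forall y, y1 <= y <= y2 -> h (A + 1, y) = h (A, y)) ->
  RInt (fun x => Re (h (x,y1))) A (A + 1) = RInt (fun x => Re (h (x,y2))) A (A + 1).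
Proof.
intros Hy Hh Hp. 
assert (G := goursat h A (A+1) y1 y2 ltac:(lra) Hy Hh). unfold rect_int in G.
rewrite RInt_minusR in G by (apply ex_RInt_cont; [lra|]; intros x Hx; apply continuous_Re_h; apply Hh; lra).
rewrite (RInt_extR (fun y => Im (h (A + 1, y)) - Im (h (A, y))) (fun _ => 0)), RInt_constR in G. lra. exact Hy.
intros y Hy'. rewrite Hp by exact Hy'. ring.
Qed.
(** The line can be raised to a height where h is as small as desired. *)
Lemma hline_zero h A y0 : (forall x y, A <= x <= A + 1 -> y0 <= y -> cdiff h (x,y)) ->
  (forall y, y0 <= y -> h (A + 1, y) = h (A, y)) ->
  (forall e, 0 < e -> exists Y, y0 <= Y /\ forall x, A <= x <= A + 1 -> Rabs (Re (h (x,Y))) <= e) ->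
  RInt (fun x => Re (h (x,y0))) A (A + 1) = 0.
Proof.
intros Hh Hp Hl. apply Rabs_eq_0. apply Rle_antisym; [|apply Rabs_pos]. apply le_epsilon. intros e He. rewrite Rplus_0_l.
destruct (Hl e He) as [Y [HY H]].
rewrite (hline_const h A y0 Y HY) by (intros; first [apply Hh; lra| apply Hp; lra]).
replace e with ((A + 1 - A) * e) by ring. apply abs_RInt_le_const. lra.
apply ex_RInt_cont. lra. intros x Hx. apply continuous_Re_h. apply Hh; lra. exact H.
Qed.

Definition disc_diff (F : C -> C) := forall z, Cmod z < 1 -> cdiff F z.
Lemma cdiff_comp_expi F x y : disc_diff F -> 0 < y -> cdiff (fun z => F (expi z)) (x,y).
Proof. intros H Hy. apply (cdiff_comp F expi). apply H. now apply Cmod_expi_lt. apply cdiff_expi. Qed.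

Lemma exp_small d : 0 < d -> exists Y, 0 < Y /\ forall y, Y <= y -> exp (- (2 * PI * y)) < d.
Proof.
intros Hd. assert (P := PI_RGT_0). exists (Rmax 1 (/ d / (2 * PI))). split. apply Rlt_le_trans with 1. lra. apply Rmax_l.
intros y Hy. assert (A := Rmax_l 1 (/ d / (2 * PI))). assert (B := Rmax_r 1 (/ d / (2 * PI))).
assert (B' : / d <= 2 * PI * y). { apply Rle_trans with (2 * PI * (/ d / (2 * PI))). right. field. split; lra. apply Rmult_le_compat_l; lra. }
assert (E := exp_ineq1 (2 * PI * y)). rewrite exp_Ropp.
assert (0 < / d) by now apply Rinv_0_lt_compat.
apply Rlt_le_trans with (/ / d). apply Rinv_lt_contravar. apply Rmult_lt_0_compat. assumption. apply exp_pos.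
specialize (E ltac:(nra)). lra. rewrite Rinv_inv. lra.
Qed.

Lemma cdiff_continuity h z : cdiff h z -> forall e, 0 < e -> exists d, 0 < d /\ forall w, Cmod (w - z) < d -> Cmod (h w - h z) < e.
Proof.
intros [l Hl] e He. rewrite cderiv_eps in Hl. destruct (Hl 1 ltac:(lra)) as [d [Hd H]].
assert (Pl := Cmod_ge_0 l).
exists (Rmin d (e / (Cmod l + 1 + 1))). split. apply Rmin_pos. exact Hd. apply Rdiv_lt_0_compat; lra.
intros w Hw. assert (B1 := Rmin_l d (e / (Cmod l + 1 + 1))). assert (B2 := Rmin_r d (e / (Cmod l + 1 + 1))).
specialize (H w ltac:(lra)). 
replace (h w - h z)%C with ((h w - h z - l * (w - z)) + l * (w - z))%C by ring.
eapply Rle_lt_trans. apply Cmod_triangle. rewrite Cmod_mult.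
assert (Pw := Cmod_ge_0 (w - z)).
apply Rle_lt_trans with ((Cmod l + 1 + 1) * Cmod (w - z)). nra.
apply Rlt_le_trans with ((Cmod l + 1 + 1) * (e / (Cmod l + 1 + 1))). apply Rmult_lt_compat_l; lra. right. field. lra.
Qed.

(** Large heights correspond to the centre of the disc, so [F (expi z) - F 0] vanishes at the top
    and [hline_zero] applies. *)
Lemma mean_value F A y : disc_diff F -> 0 < y -> RInt (fun t => Re (F (expi (t,y)))) A (A + 1) = Re (F (RtoC 0)).
Proof.
intros HF Hy. 
assert (Z : RInt (fun t => Re (F (expi (t,y)) - F (RtoC 0))) A (A + 1) = 0).
{ apply (hline_zero (fun z => F (expi z) - F (RtoC 0))%C).
  - intros. apply cdiff_minus. apply cdiff_comp_expi. exact HF. lra. apply cdiff_const.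
  - intros. now rewrite expi_period.
  - intros e He. destruct (cdiff_continuity F (RtoC 0) (HF (RtoC 0) ltac:(rewrite Cmod_0; lra)) e He) as [d [Hd H]].
    destruct (exp_small d Hd) as [Y [HY HE]]. exists (Rmax Y y). split. apply Rmax_r.
    intros x _. eapply Rle_trans. apply re_le_Cmod. left. apply H. replace (expi (x, Rmax Y y) - 0)%C with (expi (x, Rmax Y y)) by ring.
    rewrite Cmod_expi. apply HE. apply Rmax_l. }
rewrite (RInt_extR _ (fun t => Re (F (expi (t,y))) - Re (F (RtoC 0)))) in Z by (lra || (intros; unfold Re; simpl; ring)).
rewrite RInt_minusR, RInt_constR in Z. lra.
apply ex_RInt_cont. lra. intros. apply (continuous_Re_h (fun z => F (expi z))). now apply cdiff_comp_expi. apply ex_RInt_constR.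
Qed.

(** The Poisson kernel of the disc with ratio of radii exp (- 2 pi n) and angle 2 pi s: it carries
    the values on a horizontal line to the line n higher. *)
Definition poisson_kernel (n s : R) : R := let r := exp (- (2 * PI * n)) in (1 - r * r) / (1 - 2 * r * cos (2 * PI * s) + r * r).
(** The sum of q^k over k >= 1, with q = [expi z]. The constant term is left out so that the kernel
    vanishes at the top. *)
Definition cauchy_kernel (z : C) : C := (expi z / (1 - expi z))%C.
Lemma cdiff_cauchy_kernel x y : 0 < y -> cdiff cauchy_kernel (x,y).
Proof.
intros Hy. apply cdiff_div. apply cdiff_expi. apply cdiff_minus. apply cdiff_const. apply cdiff_expi.
apply one_minus_neq. now apply Cmod_expi_lt.
Qed.
Lemma poisson_kernel_den n s : 0 < n -> 0 < 1 - 2 * exp (- (2 * PI * n)) * cos (2 * PI * s) + exp (- (2 * PI * n)) * exp (- (2 * PI * n)).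
Proof.
intros Hn. assert (H1 := exp_lt_1 n Hn). assert (H2 := exp_pos (- (2 * PI * n))). assert (H3 := COS_bound (2 * PI * s)). nra.
Qed.
Lemma poisson_kernel_cauchy n s : 0 < n -> poisson_kernel n s = 1 + 2 * Re (cauchy_kernel (s, n)).
Proof.
intros Hn. assert (D := poisson_kernel_den n s Hn). unfold poisson_kernel, cauchy_kernel. rewrite expi_pair. set (r := exp _) in *. unfold Re; simpl.
assert (C2 := sin2_cos2 (2 * PI * s)). unfold Rsqr in C2. set (c := cos _) in *. set (si := sin _) in *.
assert (E : (1 + - (r * c)) * ((1 + - (r * c)) * 1) + (0 + - (r * si)) * ((0 + - (r * si)) * 1) = 1 - 2 * r * c + r * r).
{ replace (r * r) with (r * r * (si * si + c * c)) by (rewrite C2; ring). ring. }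
rewrite E. unfold Rdiv. apply Rmult_eq_reg_r with (1 - 2 * r * c + r * r). 2: lra. 
field_simplify. 2: lra. 2: lra. 
replace (si^2) with (1 - c ^ 2) by (rewrite <- C2; ring). ring.
Qed.
Lemma cauchy_kernel_conj n s : 0 < n -> cauchy_kernel (- s, n) = (Re (cauchy_kernel (s, n)), - Im (cauchy_kernel (s, n))).
Proof.
intros Hn. unfold cauchy_kernel. rewrite !expi_pair. replace (2 * PI * - s) with (- (2 * PI * s)) by ring. rewrite cos_neg, sin_neg.
set (r := exp _). set (c := cos _). set (si := sin _). unfold Re, Im, Cdiv, Cmult, Cinv, Cminus, Cplus, Copp, RtoC; simpl.
assert (E : (1 + - (r * c)) * ((1 + - (r * c)) * 1) + (0 + - (r * - si)) * ((0 + - (r * - si)) * 1) = (1 + - (r * c)) * ((1 + - (r * c)) * 1) + (0 + - (r * si)) * ((0 + - (r * si)) * 1)) by ring.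
rewrite E. unfold Rdiv. f_equal; ring.
Qed.
Lemma poisson_kernel_pos n s : 0 < n -> 0 < poisson_kernel n s.
Proof.
intros Hn. assert (H1 := exp_lt_1 n Hn). assert (H2 := exp_pos (- (2 * PI * n))). apply Rdiv_lt_0_compat. nra. now apply poisson_kernel_den.
Qed.
Lemma continuous_poisson_kernel_r n x0 t : 0 < n -> continuous (fun t => poisson_kernel n (x0 - t)) t.
Proof.
intros Hn. apply (ex_derive_continuous (V:=R_NormedModule)). unfold poisson_kernel. auto_derive.
assert (D := poisson_kernel_den n (x0 - t) Hn). unfold Rminus in *. lra.
Qed.
Lemma cauchy_kernel_period x y : cauchy_kernel (x + 1, y) = cauchy_kernel (x, y).
Proof. unfold cauchy_kernel. now rewrite expi_period. Qed.

Lemma cauchy_kernel_small e : 0 < e -> exists Y, 0 < Y /\ forall x y, Y <= y -> Cmod (cauchy_kernel (x,y)) <= e.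
Proof.
intros He. destruct (exp_small (Rmin (1/2) (e/2))) as [Y [HY H]]. apply Rmin_pos; lra.
exists Y. split. exact HY. intros x y Hy. specialize (H y Hy).
assert (B1 := Rmin_l (1/2) (e/2)). assert (B2 := Rmin_r (1/2) (e/2)).
assert (N := one_minus_neq (expi (x,y)) (Cmod_expi_lt x y ltac:(lra))).
unfold cauchy_kernel. rewrite Cmod_div by exact N.
assert (T := Cmod_reverse 1 (1 - expi (x,y))). replace (1 - expi (x, y) - 1)%C with (- expi (x,y))%C in T by ring.
rewrite Cmod_opp, Cmod_1 in T. rewrite Cmod_expi in *. 
apply Rle_div_l. lra. nra.
Qed.
Lemma bounded_near_top F : disc_diff F -> exists Y, 0 < Y /\ forall x y, Y <= y -> Cmod (F (expi (x,y))) <= Cmod (F (RtoC 0)) + 1.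
Proof.
intros HF.
destruct (cdiff_continuity F (RtoC 0) (HF (RtoC 0) ltac:(rewrite Cmod_0; lra)) 1 ltac:(lra)) as [d [Hd H]].
destruct (exp_small d Hd) as [Y [HY HE]]. exists Y. split. exact HY.
intros x y Hy. specialize (H (expi (x,y))). assert (T := Cmod_reverse (F (expi (x,y))) (F (RtoC 0))).
replace (F (RtoC 0) - F (expi (x, y)))%C with (- (F (expi (x, y)) - F (RtoC 0)))%C in T by ring. rewrite Cmod_opp in T.
assert (Cmod (F (expi (x, y)) - F 0) < 1). { apply H. replace (expi (x, y) - 0)%C with (expi (x, y)) by ring. rewrite Cmod_expi. now apply HE. }
lra.
Qed.

Lemma cdiff_cauchy_kernel_shift x0 y0 x y : y0 < y -> cdiff (fun z => cauchy_kernel (z - (x0,y0))%C) (x,y).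
Proof.
intros H. apply (cdiff_comp cauchy_kernel (fun z => z - (x0,y0))%C).
change ((x, y) - (x0, y0))%C with (x + - x0, y + - y0). apply cdiff_cauchy_kernel. lra.
apply cdiff_minus. apply cdiff_id. apply cdiff_const.
Qed.
Lemma cdiff_cauchy_kernel_refl x0 y0 x y : y < y0 -> cdiff (fun z => cauchy_kernel ((x0,y0) - z)%C) (x,y).
Proof.
intros H. apply (cdiff_comp cauchy_kernel (fun z => (x0,y0) - z)%C).
change ((x0, y0) - (x, y))%C with (x0 + - x, y0 + - y). apply cdiff_cauchy_kernel. lra.
apply cdiff_minus. apply cdiff_const. apply cdiff_id.
Qed.

Lemma poisson_kernel_RInt A x0 n : 0 < n -> RInt (fun t => poisson_kernel n (x0 - t)) A (A + 1) = 1.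
Proof.
intros Hn.
assert (Z : RInt (fun t => Re (cauchy_kernel ((t,n) - (x0,0)))) A (A + 1) = 0).
{ apply (hline_zero (fun z => cauchy_kernel (z - (x0,0)))).
  - intros. apply cdiff_cauchy_kernel_shift. lra.
  - intros y Hy. change (((A + 1)%R, y) - (x0, 0))%C with (A + 1 + - x0, y + - 0). 
    replace (A + 1 + - x0) with (A + - x0 + 1) by ring. apply cauchy_kernel_period.
  - intros e He. destruct (cauchy_kernel_small e He) as [Y [HY H]]. exists (Rmax n Y). split. apply Rmax_l.
    intros x _. eapply Rle_trans. apply re_le_Cmod. change ((x, Rmax n Y) - (x0, 0))%C with (x + - x0, Rmax n Y + - 0). apply H. assert (K := Rmax_r n Y). lra. }
rewrite (RInt_extR _ (fun t => 1 + 2 * Re (cauchy_kernel ((t,n) - (x0,0))))).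
assert (Ex : ex_RInt (fun t => Re (cauchy_kernel ((t,n) - (x0,0)))) A (A + 1)).
{ apply ex_RInt_cont; [lra|]; intros x Hx; apply (continuous_Re_h (fun z => cauchy_kernel (z - (x0,0)))); apply cdiff_cauchy_kernel_shift; lra. }
rewrite RInt_plusR, RInt_constR, RInt_scalR, Z; try assumption. ringR.
apply ex_RInt_constR. apply (ex_RInt_scal (V:=R_NormedModule)). exact Ex.
lra.
intros t Ht. rewrite poisson_kernel_cauchy by exact Hn. change ((t, n) - (x0, 0))%C with (t + - x0, n + - 0). 
replace (t + - x0) with (- (x0 - t)) by ring. replace (n + - 0) with n by ring. rewrite cauchy_kernel_conj by exact Hn. reflexivity.
Qed.

(* On the line of height [y] the conjugate of the Cauchy kernel extends holomorphically upwards
   and vanishes at infinity, so it contributes nothing to the integral against [F]. *)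
Lemma poisson_as_cauchy F A x0 Y y : disc_diff F -> 0 < y < Y ->
  RInt (fun t => Re (F (expi (t,y))) * poisson_kernel (Y - y) (x0 - t)) A (A + 1) =
  RInt (fun t => Re (F (expi (t,y)) * (1 + cauchy_kernel ((x0,Y) - (t,y))))) A (A + 1).
Proof.
intros HF Hy.
(* The pole (x0, y - (Y - y)) is the mirror image of (x0, Y) in the line of height y. On that line
   the factor is therefore the conjugate of [cauchy_kernel] with pole (x0, Y), but it is holomorphic
   on the line and above. *)
assert (Z : RInt (fun t => Re (F (expi (t,y)) * cauchy_kernel ((t,y) - (x0,y - (Y - y))))) A (A + 1) = 0).
{ apply (hline_zero (fun z => F (expi z) * cauchy_kernel (z - (x0,(y - (Y - y))%R)))%C).
  - intros x y' Hx Hy'. apply cdiff_mult. apply cdiff_comp_expi. exact HF. lra. apply cdiff_cauchy_kernel_shift. lra.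
  - intros y' Hy'. rewrite expi_period. f_equal. change (((A + 1)%R, y') - (x0, (y - (Y - y))%R))%C with (A + 1 + - x0, y' + - (y - (Y - y))). 
    replace (A + 1 + - x0) with (A + - x0 + 1) by ring. apply cauchy_kernel_period.
  - intros e He. destruct (bounded_near_top F HF) as [Y1 [HY1 H1]]. 
    set (M := Cmod (F (RtoC 0)) + 1) in *. assert (0 < M). { unfold M. assert (P := Cmod_ge_0 (F (RtoC 0))). lra. }
    destruct (cauchy_kernel_small (e / M)) as [Y2 [HY2 H2]]. apply Rdiv_lt_0_compat; lra.
    exists (Rmax y (Rmax Y1 (Y2 + y))). split. apply Rmax_l.
    intros x _. set (yy := Rmax y _). assert (K1 : y <= yy) by apply Rmax_l.
    assert (K2 : Rmax Y1 (Y2 + y) <= yy) by apply Rmax_r. assert (K3 := Rmax_l Y1 (Y2 + y)). assert (K4 := Rmax_r Y1 (Y2 + y)).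
    eapply Rle_trans. apply re_le_Cmod. rewrite Cmod_mult.
    replace e with (M * (e / M)) by (field; lra). apply Rmult_le_compat; try apply Cmod_ge_0. apply H1. lra. 
    change ((x, yy) - (x0, (y - (Y - y))%R))%C with (x + - x0, yy + - (y - (Y - y))). apply H2. lra. }
assert (Cc : forall t, A <= t <= A+1 -> cdiff (fun z => F (expi z) * (1 + cauchy_kernel ((x0,Y) - z)))%C (t,y)).
{ intros. apply cdiff_mult. apply cdiff_comp_expi. exact HF. lra. apply cdiff_plus. apply cdiff_const. apply cdiff_cauchy_kernel_refl. lra. }
assert (Cd : forall t, A <= t <= A+1 -> cdiff (fun z => F (expi z) * cauchy_kernel (z - (x0,(y - (Y - y))%R)))%C (t,y)).
{ intros. apply cdiff_mult. apply cdiff_comp_expi. exact HF. lra. apply cdiff_cauchy_kernel_shift. lra. }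
rewrite (RInt_extR _ (fun t => Re (F (expi (t,y)) * (1 + cauchy_kernel ((x0,Y) - (t,y)))) + Re (F (expi (t,y)) * cauchy_kernel ((t,y) - (x0,y - (Y - y)))))).
rewrite RInt_plusR, Z. ringR.
apply ex_RInt_cont; [lra|]; intros x Hx. apply (continuous_Re_h (fun z => F (expi z) * (1 + cauchy_kernel ((x0,Y) - z)))%C). now apply Cc.
apply ex_RInt_cont; [lra|]; intros x Hx. apply (continuous_Re_h (fun z => F (expi z) * cauchy_kernel (z - (x0,(y - (Y - y))%R)))%C). now apply Cd.
lra.
intros t Ht. rewrite poisson_kernel_cauchy by lra. 
change ((t, y) - (x0, (y - (Y - y))%R))%C with (t + - x0, y + - (y - (Y - y))). change ((x0, Y) - (t, y))%C with (x0 - t, Y - y).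
replace (t + - x0) with (- (x0 - t)) by ring. replace (y + - (y - (Y - y))) with (Y - y) by ring. rewrite cauchy_kernel_conj by lra.
unfold Re, Im; simpl. ring.
Qed.

(** In the form given by [poisson_as_cauchy] both integrands come from one function of z, periodic
    and holomorphic below height Y, so the line may be moved. *)
Lemma poisson_const F A x0 Y y1 y2 : disc_diff F -> 0 < y1 -> y1 <= y2 -> y2 < Y ->
  RInt (fun t => Re (F (expi (t,y1))) * poisson_kernel (Y - y1) (x0 - t)) A (A + 1) = RInt (fun t => Re (F (expi (t,y2))) * poisson_kernel (Y - y2) (x0 - t)) A (A + 1).
Proof.
intros HF H1 H2 H3. rewrite !poisson_as_cauchy by (assumption || lra).
apply (hline_const (fun z => F (expi z) * (1 + cauchy_kernel ((x0,Y) - z)))%C).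
- exact H2.
- intros. apply cdiff_mult. apply cdiff_comp_expi. exact HF. lra. apply cdiff_plus. apply cdiff_const. apply cdiff_cauchy_kernel_refl. lra.
- intros y Hy. rewrite expi_period. f_equal. f_equal. change ((x0, Y) - (A, y))%C with (x0 + - A, Y + - y).
  change ((x0, Y) - ((A + 1)%R, y))%C with (x0 + - (A + 1), Y + - y). rewrite <- cauchy_kernel_period. f_equal. f_equal. ring.
Qed.

Lemma ex_RInt_poisson F A y n x0 : disc_diff F -> 0 < y -> 0 < n -> ex_RInt (fun t => Re (F (expi (t,y))) * poisson_kernel n (x0 - t)) A (A + 1).
Proof.
intros HF Hy Hn. apply ex_RInt_cont. lra. intros t _. 
apply (continuous_mult (K:=R_AbsRing)). apply (continuous_Re_h (fun z => F (expi z))). now apply cdiff_comp_expi. now apply continuous_poisson_kernel_r.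
Qed.

(* |w - w0|^2 cancels the kernel's denominator, which makes the approximate identity explicit *)
Lemma poisson_kernel_dist n x0 t y : 0 < n -> 0 <= y -> poisson_kernel n (x0 - t) * Cmod (expi (t,y) - expi (x0,(y + n)%R)) ^ 2 <= 1 - exp (- (2 * PI * n)) * exp (- (2 * PI * n)).
Proof.
intros Hn Hy.
assert (D := poisson_kernel_den n (x0 - t) Hn). unfold poisson_kernel in *. rewrite Cmod2_alt, !expi_pair. 
replace (- (2 * PI * (y + n))) with (- (2 * PI * y) + - (2 * PI * n)) by ring. rewrite exp_plus.
assert (E1 : exp (- (2 * PI * y)) <= 1). { rewrite <- exp_0. assert (P := PI_RGT_0). destruct (Req_dec y 0). subst. right. f_equal. ring. left. apply exp_increasing. nra. }
assert (E0 := exp_pos (- (2 * PI * y))). assert (E2 := exp_lt_1 n Hn). assert (E3 := exp_pos (- (2 * PI * n))).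
set (q := exp (- (2 * PI * y))) in *. set (r := exp (- (2 * PI * n))) in *.
replace (2 * PI * (x0 - t)) with (2 * PI * x0 - 2 * PI * t) in * by ring. rewrite cos_minus in *.
set (c0 := cos (2 * PI * x0)) in *. set (s0 := sin (2 * PI * x0)) in *. set (c1 := cos (2 * PI * t)) in *. set (s1 := sin (2 * PI * t)) in *.
assert (S0 : s0 * s0 + c0 * c0 = 1) by apply sin2_cos2. assert (S1 : s1 * s1 + c1 * c1 = 1) by apply sin2_cos2.
unfold Re, Im; simpl.
match goal with |- _ * ?X <= _ => replace X with (q * q * (1 - 2 * r * (c0 * c1 + s0 * s1) + r * r)) end.
2:{ replace (1 - 2 * r * (c0 * c1 + s0 * s1) + r * r) with ((s1 * s1 + c1 * c1) - 2 * r * (c0 * c1 + s0 * s1) + r * r * (s0 * s0 + c0 * c0)) by (rewrite S0, S1; ring). ring. }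
match goal with |- ?X <= _ => replace X with (q * q * (1 - r * r)) by (field; lra) end.
assert (0 <= 1 - r * r) by nra. assert (q * q <= 1) by nra. nra.
Qed.

Lemma derive_nonneg_incr (f df : R -> R) a b : a <= b -> (forall x, a <= x <= b -> is_derive f x (df x)) ->
  (forall x, a <= x <= b -> 0 <= df x) -> f a <= f b.
Proof.
intros Hab H P. destruct (MVT_gen f a b df) as [c [Hc E]].
- intros x Hx. rewrite Rmin_left, Rmax_right in Hx by lra. apply H. lra.
- intros x Hx. rewrite Rmin_left, Rmax_right in Hx by lra. apply continuity_pt_filterlim. 
  apply (ex_derive_continuous (V:=R_NormedModule)). eexists. apply H. lra.
- rewrite Rmin_left, Rmax_right in Hc by lra. specialize (P c Hc). nra.
Qed.

(* The integral does not depend on the height [y] below [y + n]; let [y] tend to [y + n]. *)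
Lemma poisson F A x0 y n : disc_diff F -> 0 < y -> 0 < n ->
  RInt (fun t => Re (F (expi (t,y))) * poisson_kernel n (x0 - t)) A (A + 1) = Re (F (expi (x0,y + n))).
Proof.
intros HF Hy Hn. set (Y := y + n). set (U0 := Re (F (expi (x0,Y)))).
apply Rminus_diag_uniq. apply Rabs_eq_0. apply Rle_antisym; [|apply Rabs_pos]. apply le_epsilon. intros e He. rewrite Rplus_0_l.
assert (HY : 0 < Y) by (unfold Y; lra).
destruct (cdiff_continuity F (expi (x0,Y)) (HF _ (Cmod_expi_lt x0 Y HY)) (e/2) ltac:(lra)) as [d [Hd H]].
(* The tolerance 1 is enough: this serves only to bound F on the lines slightly below height Y. *)
destruct (uniform_continuity_2d_1d (fun u v => Re (F (expi (u,v)))) A (A+1) Y) with (eps := mkposreal 1 Rlt_0_1) as [d2 H2].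
{ intros x _. destruct (cdiff_comp_expi F x Y HF HY) as [l Hl]. exact (cderiv_cont_Re _ _ _ _ Hl). }
destruct (bounded_continuity (K:=R_AbsRing) (V:=R_NormedModule) (fun t => Re (F (expi (t,Y)))) A (A+1)) as [M HM].
{ intros x _. apply (continuous_Re_h (fun z => F (expi z))). now apply cdiff_comp_expi. }
assert (P0 := Rabs_pos U0). assert (PM : 0 < M). { eapply Rle_lt_trans. 2: apply (HM A); lra. apply norm_ge_0. }
(* At points whose image is at distance N >= d from [expi (x0, Y)], the difference of real parts is
   at most Bd N^2, and [poisson_kernel_dist] controls N^2 times the kernel. *)
set (Bd := (M + 1 + Rabs U0) / (d * d)). assert (PB : 0 < Bd) by (apply Rdiv_lt_0_compat; nra).
assert (P := PI_RGT_0).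
(* The line at Y - m must lie above height y, within the range of uniform continuity, and so close
   to Y that Bd (1 - exp (- 4 pi m)) <= e / 2. *)
set (m := Rmin (n/2) (Rmin (d2/2) (e / (8 * PI * Bd)))).
assert (Pm : 0 < m). { repeat apply Rmin_pos. lra. assert (Q := cond_pos d2). lra. apply Rdiv_lt_0_compat; nra. }
assert (m1 : m <= n/2) by apply Rmin_l. 
assert (m2 : m <= d2/2). { eapply Rle_trans. apply Rmin_r. apply Rmin_l. }
assert (m3 : m <= e / (8 * PI * Bd)). { eapply Rle_trans. apply Rmin_r. apply Rmin_r. }
clearbody m.
assert (C1 := poisson_const F A x0 Y y (Y - m) HF Hy ltac:(unfold Y; lra) ltac:(lra)).
replace (Y - y) with n in C1 by (unfold Y; ring). replace (Y - (Y - m)) with m in C1 by ring. rewrite C1. clear C1.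
assert (Py : 0 < Y - m) by (unfold Y; lra).
assert (I1 := poisson_kernel_RInt A x0 m Pm).
assert (X1 := ex_RInt_poisson F A (Y - m) m x0 HF Py Pm).
assert (X2 : ex_RInt (fun t => poisson_kernel m (x0 - t)) A (A + 1)). { apply ex_RInt_cont. lra. intros t _. now apply continuous_poisson_kernel_r. }
replace (RInt (fun t => Re (F (expi (t, Y - m))) * poisson_kernel m (x0 - t)) A (A + 1) - U0) with
 (RInt (fun t => Re (F (expi (t, Y - m))) * poisson_kernel m (x0 - t) - U0 * poisson_kernel m (x0 - t)) A (A + 1)).
2:{ rewrite RInt_minusR. rewrite RInt_scalR by exact X2. rewrite I1. ringR. exact X1. apply (ex_RInt_scal (V:=R_NormedModule)). exact X2. }
assert (X3 : ex_RInt (fun t => Re (F (expi (t, Y - m))) * poisson_kernel m (x0 - t) - U0 * poisson_kernel m (x0 - t)) A (A + 1)).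
{ apply ex_RInt_minusR. exact X1. apply (ex_RInt_scal (V:=R_NormedModule)). exact X2. }
set (r2 := 1 - exp (- (2 * PI * m)) * exp (- (2 * PI * m))).
assert (Hr2 : r2 <= 4 * PI * m). { unfold r2. rewrite <- exp_plus. assert (E := exp_ineq1_le (- (2 * PI * m) + - (2 * PI * m))). lra. }
apply Rle_trans with (RInt (fun t => e / 2 * poisson_kernel m (x0 - t) + Bd * r2) A (A + 1)).
{ eapply Rle_trans. apply abs_RInt_le. lra. exact X3. apply RInt_le. lra. 
  apply ex_RInt_norm. exact X3. 
  apply (ex_RInt_plus (V:=R_NormedModule)). apply (ex_RInt_scal (V:=R_NormedModule)). exact X2. apply ex_RInt_constR.
  intros t Ht. assert (Pk := poisson_kernel_pos m (x0 - t) Pm). 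
  replace (Re (F (expi (t, Y - m))) * poisson_kernel m (x0 - t) - U0 * poisson_kernel m (x0 - t)) with ((Re (F (expi (t, Y - m))) - U0) * poisson_kernel m (x0 - t)) by ring.
  rewrite Rabs_mult, (Rabs_right (poisson_kernel _ _)) by lra.
  assert (D := poisson_kernel_dist m x0 t (Y - m) Pm ltac:(lra)). replace (Y - m + m) with Y in D by ring. fold r2 in D.
  set (N := Cmod (expi (t, Y - m) - expi (x0, Y))) in *. assert (PN : 0 <= N) by apply Cmod_ge_0.
  assert (K : Rabs (Re (F (expi (t, Y - m))) - U0) <= e / 2 + Bd * N ^ 2).
  { destruct (Rlt_dec N d) as [L|L].
    - specialize (H _ L). assert (Q : 0 <= Bd * N ^ 2). { apply Rmult_le_pos. lra. apply pow2_ge_0. }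
      apply Rle_trans with (e/2); [|lra]. left. eapply Rle_lt_trans; [|exact H]. eapply Rle_trans; [|apply re_le_Cmod]. apply Req_le. reflexivity.
    - assert (T : Rabs (Re (F (expi (t, Y - m))) - Re (F (expi (t, Y)))) < 1).
      { assert (Q := cond_pos d2). apply (H2 t Y t (Y - m)); try lra. rewrite Rminus_diag, Rabs_R0. apply cond_pos. }
      assert (T2 : Rabs (Re (F (expi (t, Y)))) < M). { apply (HM t). lra. }
      assert (T3 : Rabs (Re (F (expi (t, Y - m))) - U0) <= M + 1 + Rabs U0).
      { replace (Re (F (expi (t, Y - m))) - U0) with ((Re (F (expi (t, Y - m))) - Re (F (expi (t, Y)))) + (Re (F (expi (t, Y))) + - U0)) by ring.
        eapply Rle_trans. apply Rabs_triang. assert (T4 := Rabs_triang (Re (F (expi (t, Y)))) (- U0)). rewrite Rabs_Ropp in T4. lra. }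
      assert (T5 : M + 1 + Rabs U0 <= Bd * N ^ 2). { unfold Bd. apply Rle_trans with ((M + 1 + Rabs U0) / (d * d) * (d * d)). right. field. lra. 
        apply Rmult_le_compat_l. exact (Rlt_le _ _ PB). nra. }
      lra. }
  nra. }
rewrite RInt_plusR. 2: apply (ex_RInt_scal (V:=R_NormedModule)); exact X2. 2: apply ex_RInt_constR.
rewrite RInt_scalR by exact X2. rewrite I1, RInt_constR.
assert (Bd * r2 <= e / 2). { apply Rle_trans with (Bd * (4 * PI * (e / (8 * PI * Bd)))). apply Rmult_le_compat_l. lra. eapply Rle_trans. exact Hr2. apply Rmult_le_compat_l; lra. right. field. lra. }
lra.
Qed.

(** Its real part is Im F, which transfers the mean value and Poisson formulas from u to v. *)
Definition mul_neg_i (F : C -> C) (z : C) : C := ((0,(-1)%R) * F z)%C.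
Lemma disc_diff_mul_neg_i F : disc_diff F -> disc_diff (mul_neg_i F).
Proof. intros H z Hz. apply cdiff_mult. apply cdiff_const. now apply H. Qed.
Lemma Re_mul_neg_i F z : Re (mul_neg_i F z) = Im (F z).
Proof. unfold mul_neg_i, Re, Im; simpl. ring. Qed.

(** * Comparison with the half-plane kernel *)

Lemma exp_sub_inv_ge L : 0 <= L -> 2 * L <= exp L - exp (- L).
Proof.
intros HL. assert (A := derive_nonneg_incr (fun x => exp x - exp (- x) - 2 * x) (fun x => exp x + exp (- x) - 2) 0 L HL).
simpl in A. rewrite Ropp_0, exp_0 in A. apply Rminus_le. assert (0 <= exp L - exp (- L) - 2 * L); [|lra].
replace 0 with (1 - 1 - 2 * 0) by ring. apply A; clear A.
- intros x _. auto_derive. exact I. ring.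
- intros x _. rewrite exp_Ropp. assert (P := exp_pos x). assert (Q : exp x * / exp x = 1) by (apply Rinv_r; lra).
  assert (0 < / exp x) by now apply Rinv_0_lt_compat.
  replace (exp x + / exp x - 2) with ((exp x - 1) * (exp x - 1) * / exp x) by (field; lra).
  apply Rmult_le_pos; [apply Rle_0_sqr|lra].
Qed.
(** Equivalent to tanh (L / 2) <= L / 2, as the preceding lemma is to L <= sinh L; together they
    handle the two parts of the kernel's denominator below. *)
Lemma exp_pade L : 0 <= L -> 2 * (exp L - 1) <= (exp L + 1) * L.
Proof.
intros HL. assert (A := derive_nonneg_incr (fun x => (exp x + 1) * x - 2 * (exp x - 1)) (fun x => (x - 1) * exp x + 1) 0 L HL).
simpl in A. rewrite exp_0 in A. assert (0 <= (exp L + 1) * L - 2 * (exp L - 1)); [|lra].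
replace 0 with ((1 + 1) * 0 - 2 * (1 - 1)) at 1 by ring. apply A; clear A.
- intros x _. auto_derive. exact I. ring.
- intros x _. assert (E := exp_ineq1_le (- x)). rewrite exp_Ropp in E. assert (P := exp_pos x). assert (Q : exp x * / exp x = 1) by (apply Rinv_r; lra). nra.
Qed.
Lemma sin_sq_le x : sin x * sin x <= x * x.
Proof.
assert (G : forall x, 0 <= x -> sin x * sin x <= x * x).
{ intros y Hy. assert (S := SIN_bound y). destruct (Rle_dec 1 y). nra.
  assert (sin y <= y). { destruct (Req_dec y 0). subst. rewrite sin_0. lra. left. apply sin_lt_x. lra. }
  assert (0 <= sin y). { apply sin_ge_0. lra. assert (P := PI2_1). lra. } nra. }
destruct (Rle_dec 0 x). now apply G. specialize (G (-x) ltac:(lra)). rewrite sin_neg in G. nra.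
Qed.

(** The periodic kernel is the sum of the integer translates of the half-plane kernel, all positive,
    and this keeps one term. The proof avoids the series: the denominator is (1 - r)^2 + 4 r sin (pi
    s)^2, and [T1], [T2] compare its two terms with the s^2 and n^2 parts separately. *)
Lemma poisson_kernel_ge_halfplane n s : 0 < n -> n / (PI * (s * s + n * n)) <= poisson_kernel n s.
Proof.
intros Hn. assert (P := PI_RGT_0). assert (D := poisson_kernel_den n s Hn). unfold poisson_kernel. set (L := 2 * PI * n) in *.
assert (HL : 0 < L) by (unfold L; nra).
assert (S1 := exp_sub_inv_ge L ltac:(lra)). assert (S2 := exp_pade L ltac:(lra)).
rewrite exp_Ropp in *. assert (Pe := exp_pos L). set (E := exp L) in *.
assert (Pr := Rinv_0_lt_compat _ Pe). assert (Er : E * / E = 1) by (apply Rinv_r; lra). set (r := / E) in *.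
assert (K1 : 2 * L * r <= 1 - r * r). { replace (1 - r * r) with ((E - r) * r) by (replace 1 with (E * r) by lra; ring). nra. }
assert (K2 : 2 * (1 - r) <= (1 + r) * L). { replace (2 * (1 - r)) with (2 * (E - 1) * r) by (replace (E - 1) with (E - E * r) by lra; nra). 
  replace ((1 + r) * L) with ((E + 1) * L * r). nra. replace ((E + 1) * L * r) with ((E * r + r) * L) by ring. rewrite Er. reflexivity. }
assert (R1 : r < 1). { assert (X := exp_lt_1 n Hn). fold L in X. rewrite exp_Ropp in X. exact X. }
clearbody r. clear E Pe S1 S2 Er.
assert (C2 : cos (2 * PI * s) = 1 - 2 * (sin (PI * s) * sin (PI * s))). { replace (2 * PI * s) with (2 * (PI * s)) by ring. rewrite cos_2a_sin. ring. }
assert (S3 := sin_sq_le (PI * s)). rewrite C2 in *. set (q := sin (PI * s) * sin (PI * s)) in *.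
assert (0 < s * s + n * n) by nra.
apply Rle_div_l. nra. unfold Rdiv. rewrite Rmult_assoc, (Rmult_comm (/ _)), <- Rmult_assoc. apply Rle_div_r. exact D.
assert (T1 : n * (4 * r * q) <= (1 - r * r) * (PI * (s * s))).
{ apply Rle_trans with (n * (4 * r * (PI * s * (PI * s)))). apply Rmult_le_compat_l. lra. apply Rmult_le_compat_l. lra. exact S3.
  replace (n * (4 * r * (PI * s * (PI * s)))) with (2 * L * r * (PI * (s * s))) by (unfold L; ring). apply Rmult_le_compat_r. nra. exact K1. }
assert (T2 : n * ((1 - r) * (1 - r)) <= (1 - r * r) * (PI * (n * n))).
{ replace (1 - r * r) with ((1 - r) * (1 + r)) by ring. 
  replace ((1 - r) * (1 + r) * (PI * (n * n))) with ((n * (1 - r)) * ((1 + r) * L / 2)) by (unfold L; field).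
  replace (n * ((1 - r) * (1 - r))) with ((n * (1 - r)) * (1 - r)) by ring. apply Rmult_le_compat_l. nra. lra. }
lra.
Qed.

(** * Half-ellipses and stadiums *)

Lemma Cneq_Re z : Re z <> 0 -> z <> RtoC 0.
Proof. intros H E. apply H. now rewrite E. Qed.
Lemma Cneq_Re_pos z : 0 < Re z -> z <> RtoC 0.
Proof. intros H. apply Cneq_Re. lra. Qed.
Lemma Cmult_reg_l (a b c : C) : a <> RtoC 0 -> (a * b = a * c)%C -> b = c.
Proof. intros Ha H. replace b with (/ a * (a * b))%C by (field; exact Ha). rewrite H. field. exact Ha. Qed.
Lemma cexp_plus z w : cexp (z + w) = (cexp z * cexp w)%C.
Proof.
destruct z as [a b], w as [c d]. unfold cexp, Cmult; simpl. rewrite exp_plus, cos_plus, sin_plus. f_equal; ring.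
Qed.
Lemma cexp_neq_0 z : cexp z <> RtoC 0.
Proof.
intros E. assert (H := cexp_plus z (-z)). rewrite E in H. replace (z + - z)%C with (RtoC 0) in H by ring.
rewrite Cmult_0_l in H. apply (f_equal Re) in H. revert H. simpl. rewrite exp_0, cos_0. lra.
Qed.

(* sin^2/(zeta - cos) in terms of the Joukowski parameter q, zeta = (q + 1/q)/2, and T = e^{i phi} *)
Lemma joukowski_fraction (q T : C) : q <> RtoC 0 -> T <> RtoC 0 -> (1 - q * T <> 0)%C -> (1 - q * / T <> 0)%C ->
  ((1 - ((T + / T) / 2) * ((T + / T) / 2)) / ((q + / q) / 2 - (T + / T) / 2) =
   q + (T + / T) / 2 - (1 - q * q) / 2 * (T / (1 - q * T) + / T / (1 - q * / T)))%C.
Proof.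
intros H1 H2 H3 H4.
assert (T - q <> 0)%C. { intros E. apply H4. replace (1 - q * / T)%C with ((T - q) / T)%C by (field; exact H2). rewrite E. unfold Cdiv. ring. }
assert (N2 : RtoC 2 <> RtoC 0) by (apply Cneq_Re; simpl; lra).
field. repeat split; try assumption.
replace ((q * q + 1) * T - (T * T + 1) * q)%C with ((1 - q * T) * (T - q))%C by ring. now apply Cmult_neq_0.
Qed.

Definition ci : C := (0, 1).
Lemma cexp_i_conj x : cexp (ci * (x,0)) = (cos x, sin x) /\ cexp (- ci * (x,0)) = (cos x, - sin x)%R.
Proof.
unfold cexp, ci; split; simpl.
replace (0 * x - 1 * 0) with 0 by ring. replace (0 * 0 + 1 * x) with x by ring. rewrite exp_0. f_equal; ring.
replace (-0 * x - - (1) * 0) with 0 by ring. replace (-0 * 0 + - (1) * x) with (- x) by ring. rewrite exp_0, cos_neg, sin_neg. f_equal; ring.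
Qed.
Lemma cexp_i_inv w : (/ cexp (ci * w) = cexp (- ci * w))%C.
Proof.
assert (H := cexp_plus (ci * w) (- ci * w)). replace (ci * w + - ci * w)%C with (RtoC 0) in H by ring.
assert (E0 : cexp 0 = RtoC 1). { unfold cexp; simpl. rewrite exp_0, cos_0, sin_0. unfold RtoC. f_equal; ring. }
rewrite E0 in H. assert (N := cexp_neq_0 (ci * w)). apply Cmult_reg_l with (cexp (ci * w)). exact N. rewrite <- H. field. exact N.
Qed.
Lemma Cmod_cexp_i x : Cmod (cexp (ci * (x,0))) = 1 /\ Cmod (cexp (- ci * (x,0))) = 1.
Proof.
destruct (cexp_i_conj x) as [-> ->]. unfold Cmod; simpl.
assert (H := sin2_cos2 x). unfold Rsqr in H. split.
replace (cos x * (cos x * 1) + sin x * (sin x * 1)) with (sin x * sin x + cos x * cos x) by ring. rewrite H. apply sqrt_1.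
replace (cos x * (cos x * 1) + - sin x * (- sin x * 1)) with (sin x * sin x + cos x * cos x) by ring. rewrite H. apply sqrt_1.
Qed.

Lemma one_minus_Re q T : Cmod q < 1 -> Cmod T = 1 -> 0 < Re (1 - q * T).
Proof.
intros Hq HT. assert (A := re_le_Cmod (q * T)%C). rewrite Cmod_mult, HT, Rmult_1_r in A. apply Rabs_le_between in A.
replace (Re (1 - q * T)) with (1 - Re (q * T)) by (unfold Re; simpl; ring). lra.
Qed.

(** A primitive of the right side of [joukowski_fraction] without its cosine. On the real axis the
    cosine is real and drops out of the imaginary part, the only part used. *)
Definition semicircle_prim (q w : C) : C :=
  (q * w + (1 - q * q) / (2 * ci * q) * (Ln (1 - q * cexp (ci * w)) - Ln (1 - q * cexp (- ci * w))))%C.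
Lemma cderiv_semicircle_prim q x : q <> RtoC 0 -> Cmod q < 1 ->
  cderiv (semicircle_prim q) (x,0) (q - (1 - q * q) / 2 * (cexp (ci * (x,0)) / (1 - q * cexp (ci * (x,0))) + / cexp (ci * (x,0)) / (1 - q * / cexp (ci * (x,0))))).
Proof.
intros Hq0 Hq. destruct (Cmod_cexp_i x) as [M1 M2].
assert (R1 := one_minus_Re _ _ Hq M1). assert (R2 := one_minus_Re _ _ Hq M2).
assert (N1 : (1 - q * cexp (ci * (x, 0)) <> 0)%C) by (apply Cneq_Re; lra).
assert (N2 : (1 - q * cexp (- ci * (x, 0)) <> 0)%C) by (apply Cneq_Re; lra).
assert (G : forall c, (0 < Re (1 - q * cexp (c * (x,0)))) -> cderiv (fun w => Ln (1 - q * cexp (c * w))) (x,0) (- (q * (c * cexp (c * (x,0)))) * / (1 - q * cexp (c * (x,0))))).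
{ intros c Hc. apply (cderiv_comp Ln (fun w => 1 - q * cexp (c * w))%C). now apply cderiv_Ln.
  replace (- (q * (c * cexp (c * (x, 0)))))%C with (0 - (q * (c * 1 * cexp (c * (x, 0)))))%C by ring.
  apply cderiv_minus. apply cderiv_const. apply cderiv_scal. apply (cderiv_comp cexp (fun w => c * w)%C). apply cderiv_cexp.
  apply cderiv_scal. apply cderiv_id. }
assert (D := cderiv_plus _ _ _ _ _ (cderiv_scal q _ _ _ (cderiv_id (x,0))) (cderiv_scal ((1 - q * q) / (2 * ci * q)) _ _ _ (cderiv_minus _ _ _ _ _ (G ci R1) (G (- ci)%C R2)))).
unfold semicircle_prim. eapply eq_rect with (P := cderiv _ _). exact D.
rewrite cexp_i_inv. field. repeat split; first [assumption | apply Cneq_Re; simpl; lra | intros E; apply (f_equal Im) in E; simpl in E; lra].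
Qed.

(** * Harmonic extension of the semicircle *)

Section Semicircle.
Variables x n : R.
Hypothesis Hn : 0 < n.
Let zeta : C := (x, n).
Let s := csqrt (1 - zeta * zeta).
(** The root of q + 1 / q = 2 zeta inside the unit disc; the other root is zeta + i s. *)
Let q := (zeta - ci * s)%C.
Lemma semicircle_slit : slit (1 - zeta * zeta).
Proof. unfold slit, zeta; simpl. destruct (Req_dec x 0) as [->|H]. left. nra. right. 
  replace (0 + - (x * n + n * x)) with (-2 * (x * n)) by ring. apply Rmult_integral_contrapositive_currified. lra. apply Rmult_integral_contrapositive_currified; lra. Qed.
Lemma semicircle_s : 0 < Re s /\ Re s * Re s - Im s * Im s = 1 - x * x + n * n /\ Re s * Im s = - (x * n).
Proof.
assert (P := csqrt_Re _ semicircle_slit). assert (Q := csqrt_sqr _ semicircle_slit). fold s in P, Q. split. exact P.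
assert (Q1 := f_equal Re Q). assert (Q2 := f_equal Im Q). unfold Re, Im, zeta in *; simpl in *. lra.
Qed.
Lemma semicircle_inv : (q * (zeta + ci * s) = 1)%C.
Proof.
assert (Q := csqrt_sqr _ semicircle_slit). fold s in Q. unfold q.
replace ((zeta - ci * s) * (zeta + ci * s))%C with (zeta * zeta - ci * ci * (s * s))%C by ring. rewrite Q.
replace (ci * ci)%C with (- (1))%C. ring. unfold ci, Cmult, Copp, RtoC; simpl. f_equal; ring.
Qed.
Lemma semicircle_q0 : q <> RtoC 0.
Proof. intros E. assert (H := semicircle_inv). rewrite E, Cmult_0_l in H. apply (f_equal Re) in H. simpl in H. lra. Qed.
Lemma semicircle_zeta : ((q + / q) / 2 = zeta)%C.
Proof.
assert (Q0 := semicircle_q0). replace (/ q)%C with (zeta + ci * s)%C. unfold q. field.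
apply Cmult_reg_l with q. exact Q0. rewrite semicircle_inv. field. exact Q0.
Qed.
(** The two roots have product 1, so it suffices that q is the smaller. The squared moduli differ by
    4 (n Re s - x Im s), which is positive because Re s Im s = - x n. *)
Lemma semicircle_q1 : Cmod q < 1.
Proof.
destruct semicircle_s as [P [_ Q]]. assert (I := f_equal Cmod semicircle_inv). rewrite Cmod_mult, Cmod_1 in I.
assert (L : Cmod q ^ 2 < Cmod (zeta + ci * s) ^ 2).
{ rewrite !Cmod2_alt. unfold q in *. clear q. clearbody s. unfold zeta, ci, Re, Im in *; simpl. set (a := fst s) in *. set (b := snd s) in *.
  assert (0 < n * a - x * b). { apply Rmult_lt_reg_r with a. exact P. rewrite Rmult_0_l. replace ((n * a - x * b) * a) with (n * (a * a) - x * (a * b)) by ring. rewrite Q. 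
    assert (0 < a * a) by nra. assert (0 <= x * x) by nra. nra. }
  nra. }
assert (A := Cmod_ge_0 q). assert (B := Cmod_ge_0 (zeta + ci * s)). nra.
Qed.
(** With u = cos t this is pi times the half-plane Poisson extension of sqrt (1 - u^2) at (x, n).
    The integrand is - Im (sin^2 / (zeta - cos)); at 0 and at PI the two logarithms of the primitive
    cancel, which leaves - pi Im q. *)
Lemma semicircle_RInt : RInt (fun t => sin t * sin t * n / ((x - cos t) ^ 2 + n ^ 2)) 0 PI = PI * (Re s - n).
Proof.
assert (Q0 := semicircle_q0). assert (Q1 := semicircle_q1).
assert (D : forall t, is_derive (fun t => - Im (semicircle_prim q (t,0))) t (sin t * sin t * n / ((x - cos t) ^ 2 + n ^ 2))).
{ intros t. destruct (Cmod_cexp_i t) as [M1 M2].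
  assert (R1 := one_minus_Re _ _ Q1 M1). assert (R2 := one_minus_Re _ _ Q1 M2).
  assert (N1 : (1 - q * cexp (ci * (t,0)) <> 0)%C) by exact (Cneq_Re_pos _ R1).
  assert (N2 : (1 - q * / cexp (ci * (t,0)) <> 0)%C) by (rewrite cexp_i_inv; exact (Cneq_Re_pos _ R2)).
  assert (J := joukowski_fraction q (cexp (ci * (t,0))) Q0 (cexp_neq_0 _) N1 N2).
  assert (Dv := cderiv_path _ (fun t => t) (fun _ => 0) t 1 0 _ (cderiv_semicircle_prim q t Q0 Q1) (is_derive_id t) (is_derive_const 0 t)).
  destruct Dv as [_ Dv]. apply (is_derive_opp (V:=R_NormedModule)) in Dv. eapply eq_rect with (P := is_derive _ _). exact Dv.
  rewrite semicircle_zeta in J. set (X := ((1 - q * q) / 2 * _)%C) in *.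
  replace (q - X)%C with ((q + (cexp (ci * (t, 0)) + / cexp (ci * (t, 0))) / 2 - X) - (cexp (ci * (t, 0)) + / cexp (ci * (t, 0))) / 2)%C by ring.
  rewrite <- J. clear J X Dv. rewrite cexp_i_inv. change (AbsRing.sort R_AbsRing) with R. change (NormedModule.sort R_AbsRing R_NormedModule) with R. destruct (cexp_i_conj t) as [-> ->].
  replace (((cos t, sin t) + (cos t, (- sin t)%R)) / 2)%C with (RtoC (cos t)).
  2:{ unfold Cdiv, Cmult, Cinv, Cplus, RtoC; simpl. f_equal; field. }
  replace ((1 - cos t * cos t) : C)%C with (RtoC (sin t * sin t)).
  2:{ rewrite <- RtoC_mult, <- RtoC_minus. f_equal. assert (H := sin2_cos2 t). unfold Rsqr in H. lra. }
  unfold zeta, Im, Cdiv, Cmult, Cinv, Cminus, Cplus, Copp, RtoC, opp; simpl. field. apply Rgt_not_eq. assert (Ps := Rle_0_sqr (x - cos t)). assert (Pn := Rmult_lt_0_compat _ _ Hn Hn). unfold Rsqr in Ps. lra. }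
assert (IR : is_RInt (fun t => sin t * sin t * n / ((x - cos t) ^ 2 + n ^ 2)) 0 PI (minus (- Im (semicircle_prim q (PI,0))) (- Im (semicircle_prim q (0,0))))).
{ apply (is_RInt_derive (V:=R_CompleteNormedModule) (fun t => - Im (semicircle_prim q (t,0)))). intros t _. apply D.
  intros t _. apply (ex_derive_continuous (V:=R_NormedModule)). auto_derive. apply Rgt_not_eq. assert (Ps := Rle_0_sqr (x - cos t)). assert (Pn := Rmult_lt_0_compat _ _ Hn Hn). unfold Rsqr, Rminus in Ps. lra. }
rewrite (is_RInt_unique _ _ _ _ IR).
unfold semicircle_prim. destruct (cexp_i_conj PI) as [-> ->]. destruct (cexp_i_conj 0) as [-> ->].
rewrite cos_PI, sin_PI, cos_0, sin_0, Ropp_0.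
set (c := ((1 - q * q) / (2 * ci * q))%C). 
replace (Ln (1 - q * ((-1)%R, 0)) - Ln (1 - q * ((-1)%R, 0)))%C with (RtoC 0) by ring.
replace (Ln (1 - q * (1, 0)) - Ln (1 - q * (1, 0)))%C with (RtoC 0) by ring.
unfold minus, plus, opp; simpl. unfold q. clearbody s. unfold zeta, ci; simpl. unfold Re. ring.
Qed.
(** (Re s)^2 = 1 - x^2 + n^2 + (Im s)^2 is at least 1 - x^2. For |x| > 1 the left root is 0, since
    [sqrt] vanishes on negative numbers. *)
Lemma semicircle_lower : sqrt (1 - x * x) - n <= RInt (fun t => sin t * sin t * n / ((x - cos t) ^ 2 + n ^ 2)) 0 PI / PI.
Proof.
rewrite semicircle_RInt. replace (PI * (Re s - n) / PI) with (Re s - n) by (field; assert (P := PI_RGT_0); lra).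
destruct semicircle_s as [P [Q _]]. apply Rplus_le_compat_r.
destruct (Rle_dec 0 (1 - x * x)) as [H|H]. 
- rewrite <- (sqrt_square (Re s)) by lra. apply sqrt_le_1; nra.
- rewrite sqrt_neg_0 by lra. lra.
Qed.
End Semicircle.

(** * Integrals depending on a parameter *)

Lemma continuous_param (f : R -> R -> R) c d x0 : c <= d -> (forall x y, continuity_2d_pt f x y) -> continuous (fun x => RInt (f x) c d) x0.
Proof.
intros Hcd Hf. apply continuity_pt_filterlim. intros e He.
destruct (uniform_continuity_2d_1d' f c d x0) with (eps := mkposreal (e / (d - c + 1) / 2) ltac:(apply Rdiv_lt_0_compat; [apply Rdiv_lt_0_compat|]; lra)) as [dl Hdl].
intros; apply Hf. simpl in Hdl.
exists dl. split. apply cond_pos. intros x [_ Hx]. simpl in *. unfold R_dist in *.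
apply Rabs_lt_between in Hx. 
assert (X : forall x, ex_RInt (f x) c d). { intros u. apply ex_RInt_cont. exact Hcd. intros v _. 
  apply continuity_pt_filterlim. intros e' He'. destruct (Hf u v (mkposreal e' He')) as [q Hq]. exists q. split. apply cond_pos.
  intros w [_ Hw]. apply Hq. rewrite Rminus_diag, Rabs_R0. apply cond_pos. exact Hw. }
rewrite <- RInt_minusR by apply X.
apply Rle_lt_trans with ((d - c) * (e / (d - c + 1) / 2)).
apply abs_RInt_le_const. exact Hcd. apply ex_RInt_minusR; apply X.
intros t Ht. left. assert (P := cond_pos dl). apply Hdl; try lra. rewrite Rminus_diag, Rabs_R0. exact P.
apply Rlt_le_trans with ((d - c + 1) * (e / (d - c + 1) / 2 * 2)). 2: right; field; lra.
assert (0 < e / (d - c + 1)) by (apply Rdiv_lt_0_compat; lra). nra.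
Qed.

Lemma continuity_2d_continuous_x (f : R -> R -> R) x y : continuity_2d_pt f x y -> continuous (fun u => f u y) x.
Proof.
intros Hf. apply continuity_pt_filterlim. intros e' He'. destruct (Hf (mkposreal e' He')) as [q Hq]. exists q. split. apply cond_pos.
intros w [_ Hw]. apply Hq. exact Hw. rewrite Rminus_diag, Rabs_R0. apply cond_pos.
Qed.
Lemma continuity_2d_swap (f : R -> R -> R) x y : continuity_2d_pt f x y -> continuity_2d_pt (fun u v => f v u) y x.
Proof. intros H e. destruct (H e) as [d Hd]. exists d. intros u v Hu Hv. now apply Hd. Qed.

(** As functions of the upper limit b, both sides vanish at a and have the same derivative. *)
Lemma fubini (f : R -> R -> R) a b c d : a <= b -> c <= d -> (forall x y, continuity_2d_pt f x y) ->
  RInt (fun x => RInt (fun y => f x y) c d) a b = RInt (fun y => RInt (fun x => f x y) a b) c d.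
Proof.
intros Hab Hcd Hf.
assert (Cx : forall y x, continuous (fun x => f x y) x). { intros y x. apply continuity_2d_continuous_x. apply Hf. }
assert (Ex : forall y u v, ex_RInt (fun x => f x y) u v). { intros. apply (ex_RInt_continuous (V:=R_CompleteNormedModule)). intros; apply Cx. }
assert (Co : forall x, continuous (fun x => RInt (fun y => f x y) c d) x). { intros x. now apply continuous_param. }
set (Lf := fun u => RInt (fun x => RInt (fun y => f x y) c d) a u).
set (Rf := fun u => RInt (fun y => RInt (fun x => f x y) a u) c d).
assert (DL : forall u, is_derive Lf u (RInt (fun y => f u y) c d)).
{ intros u. apply (is_derive_RInt (V:=R_NormedModule) (fun x => RInt (fun y => f x y) c d) Lf a u). 2: apply Co. exists (mkposreal 1 Rlt_0_1). intros v _. apply (RInt_correct (V:=R_CompleteNormedModule)).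
  apply (ex_RInt_continuous (V:=R_CompleteNormedModule)). intros; apply Co. }
assert (Dp : forall y u, is_derive (fun u => RInt (fun x => f x y) a u) u (f u y)).
{ intros y u. apply (is_derive_RInt (V:=R_NormedModule) (fun x => f x y) (fun u => RInt (fun x => f x y) a u) a u). 2: apply Cx. exists (mkposreal 1 Rlt_0_1). intros v _. apply (RInt_correct (V:=R_CompleteNormedModule)). apply Ex. }
assert (DR : forall u, is_derive Rf u (RInt (fun y => f u y) c d)).
{ intros u. replace (RInt (fun y => f u y) c d) with (RInt (fun t => Derive (fun u => RInt (fun x => f x t) a u) u) c d).
  2:{ apply RInt_extR. exact Hcd. intros y _. apply is_derive_unique. apply Dp. }
  apply (is_derive_RInt_param (fun u t => RInt (fun x => f x t) a u)).
  - exists (mkposreal 1 Rlt_0_1). intros v _ t _. eexists. apply Dp.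
  - intros t _. apply continuity_2d_pt_ext with f. intros x y. symmetry. apply is_derive_unique. apply Dp. apply Hf.
  - exists (mkposreal 1 Rlt_0_1). intros v _. apply ex_RInt_cont. exact Hcd. intros y _.
    destruct (Rle_dec a v) as [L|L].
    + apply (continuous_param (fun y x => f x y) a v y L). intros. now apply continuity_2d_swap.
    + apply (continuous_ext (fun y => opp (RInt (fun x => f x y) v a))). intros w. apply (opp_RInt_swap (V:=R_CompleteNormedModule)). apply Ex.
      apply (continuous_opp (V:=R_NormedModule)). apply (continuous_param (fun y x => f x y) v a y ltac:(lra)). intros. now apply continuity_2d_swap. }
assert (Z : Lf a = 0 /\ Rf a = 0).
{ unfold Lf, Rf. split. apply (RInt_point (V:=R_CompleteNormedModule)). 
  rewrite (RInt_extR _ (fun _ => 0)), RInt_constR. ringR. exact Hcd. intros; apply (RInt_point (V:=R_CompleteNormedModule)). }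
change (Lf b = Rf b).
assert (D1 := derive_nonneg_incr (fun u => Lf u - Rf u) (fun _ => 0) a b Hab).
assert (D2 := derive_nonneg_incr (fun u => Rf u - Lf u) (fun _ => 0) a b Hab). simpl in D1, D2.
assert (E1 := D1 ltac:(intros x _; replace 0 with (RInt (fun y => f x y) c d - RInt (fun y => f x y) c d) by ring; apply (is_derive_minus (V:=R_NormedModule)); [apply DL|apply DR]) ltac:(intros; lra)).
assert (E2 := D2 ltac:(intros x _; replace 0 with (RInt (fun y => f x y) c d - RInt (fun y => f x y) c d) by ring; apply (is_derive_minus (V:=R_NormedModule)); [apply DR|apply DL]) ltac:(intros; lra)).
apply Rle_antisym; lra.
Qed.

(** * The half-ellipse and the stadium under the Poisson kernel *)

Lemma continuous_sqrt_comp (f : R -> R) x : continuous f x -> continuous (fun t => sqrt (f t)) x.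
Proof. intros H. apply (continuous_comp f sqrt). exact H. apply continuous_sqrt. Qed.

(** As [sqrt] is 0 on negative numbers, this is already extended by zero off [c - a, c + a]. *)
Definition ellipse c a s := sqrt (1 - ((s - c) / a) ^ 2).
Lemma continuous_ellipse c a s : continuous (ellipse c a) s.
Proof. apply (continuous_sqrt_comp (fun s => 1 - ((s - c) / a) ^ 2)). apply (ex_derive_continuous (V:=R_NormedModule)). auto_derive. exact I. Qed.
Lemma sum_sqr_pos w n : 0 < n -> 0 < w * w + n * n.
Proof. intros Hn. assert (0 <= w * w) by apply Rle_0_sqr. assert (0 < n * n) by now apply Rmult_lt_0_compat. lra. Qed.
Lemma continuous_halfplane n t s : 0 < n -> continuous (fun s => n / (PI * ((s - t) * (s - t) + n * n))) s.
Proof. 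
intros Hn. apply (ex_derive_continuous (V:=R_NormedModule)). auto_derive. apply Rgt_not_eq. assert (P := PI_RGT_0). apply Rmult_lt_0_compat. lra. now apply sum_sqr_pos.
Qed.
Lemma continuous_multR (f g : R -> R) x : continuous f x -> continuous g x -> continuous (fun t => f t * g t) x.
Proof. intros. apply (continuous_mult (K:=R_AbsRing)); assumption. Qed.
Lemma continuous_poisson_kernel_l n t s : 0 < n -> continuous (fun s => poisson_kernel n (s - t)) s.
Proof.
intros Hn. apply (ex_derive_continuous (V:=R_NormedModule)). unfold poisson_kernel. auto_derive.
assert (D := poisson_kernel_den n (s - t) Hn). unfold Rminus in *. lra.
Qed.

Lemma ellipse_cos c a t : 0 < a -> 0 <= t <= PI -> ellipse c a (c - a * cos t) = sin t.
Proof.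
intros Ha Ht. unfold ellipse. replace (1 - ((c - a * cos t - c) / a) ^ 2) with (sin t * sin t).
apply sqrt_square. now apply sin_ge_0.
assert (H := sin2_cos2 t). unfold Rsqr in H. rewrite <- H. field. lra.
Qed.

(** Replacing the periodic kernel by the smaller half-plane kernel, the substitution s = c - a cos u
    turns the integral into the one of [semicircle_lower] at ((c - t) / a, n / a). *)
Lemma ellipse_poisson c a n t : 0 < a -> 0 < n -> ellipse c a t - n / a <= RInt (fun s => ellipse c a s * poisson_kernel n (s - t)) (c - a) (c + a).
Proof.
intros Ha Hn. assert (P := PI_RGT_0).
apply Rle_trans with (RInt (fun s => ellipse c a s * (n / (PI * ((s - t) * (s - t) + n * n)))) (c - a) (c + a)).
2:{ apply RInt_le. lra. 
  apply ex_RInt_cont. lra. intros. apply continuous_multR. apply continuous_ellipse. now apply continuous_halfplane.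
  apply ex_RInt_cont. lra. intros. apply continuous_multR. apply continuous_ellipse. now apply continuous_poisson_kernel_l.
  intros s Hs. apply Rmult_le_compat_l. apply sqrt_pos. now apply poisson_kernel_ge_halfplane. }
assert (Q := semicircle_lower ((c - t) / a) (n / a) ltac:(apply Rdiv_lt_0_compat; lra)).
unfold ellipse at 1. replace (1 - ((t - c) / a) ^ 2) with (1 - (c - t) / a * ((c - t) / a)) by (field; lra).
eapply Rle_trans. exact Q. apply Req_le.
assert (E := RInt_comp (V:=R_CompleteNormedModule) (fun s => ellipse c a s * (n / (PI * ((s - t) * (s - t) + n * n)))) (fun u => c - a * cos u) (fun u => a * sin u) 0 PI).
simpl in E. rewrite cos_0, cos_PI in E. replace (c - a * 1) with (c - a) in E by ring. replace (c - a * -1) with (c + a) in E by ring. rewrite <- E; clear E.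
- unfold Rdiv at 1. rewrite Rmult_comm, <- RInt_scalR.
  + apply RInt_extR. lra. intros u Hu. rewrite ellipse_cos by lra. unfold scal; simpl; unfold mult; simpl.
    replace (c - a * cos u - t) with (a * ((c - t) / a - cos u)) by (field; lra). set (w := (c - t) / a - cos u).
    assert (0 < n * n) by nra. assert (0 <= w * w) by apply Rle_0_sqr. assert (0 < a * a) by nra. assert (0 <= a * a * (w * w)) by nra.
    field. repeat split; try lra; apply Rgt_not_eq; nra.
  + apply ex_RInt_cont. lra. intros u _. apply (ex_derive_continuous (V:=R_NormedModule)). auto_derive. apply Rgt_not_eq.
    assert (0 < n * / a). { apply Rmult_lt_0_compat. lra. now apply Rinv_0_lt_compat. } 
    assert (0 < (n * / a) * (n * / a)) by nra. set (w := (_ + - cos u)). assert (0 <= w * w) by apply Rle_0_sqr. lra.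
- intros u _. apply continuous_multR. apply continuous_ellipse. now apply continuous_halfplane.
- intros u _. split. auto_derive. exact I. ring. apply (ex_derive_continuous (V:=R_NormedModule)). auto_derive. exact I.
Qed.

(* (|s - x1| + |s - x2| - (x2 - x1)) / 2 is the distance from s to [x1, x2] *)
Definition stadium a x1 x2 s := sqrt (1 - ((Rabs (s - x1) + Rabs (s - x2) - (x2 - x1)) / (2 * a)) ^ 2).
Lemma continuous_stadium a x1 x2 s : continuous (stadium a x1 x2) s.
Proof.
apply (continuous_sqrt_comp (fun s => 1 - ((Rabs (s - x1) + Rabs (s - x2) - (x2 - x1)) / (2 * a)) ^ 2)).
apply (continuous_comp (fun s => Rabs (s - x1) + Rabs (s - x2)) (fun w => 1 - ((w - (x2 - x1)) / (2 * a)) ^ 2)).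
- apply (continuous_plus (V:=R_NormedModule)); apply (continuous_comp (fun s => s - _) Rabs); try apply continuous_Rabs;
  apply (continuous_minus (V:=R_NormedModule)); [apply continuous_id|apply continuous_const|apply continuous_id|apply continuous_const].
- apply (ex_derive_continuous (V:=R_NormedModule)); auto_derive; exact I.
Qed.
Lemma stadium_left a x1 x2 s : 0 < a -> x1 <= x2 -> s <= x1 -> stadium a x1 x2 s = ellipse x1 a s.
Proof.
intros Ha H H1. unfold stadium, ellipse. f_equal. rewrite !Rabs_left1 by lra. field. lra.
Qed.
Lemma stadium_mid a x1 x2 s : x1 <= s <= x2 -> stadium a x1 x2 s = 1.
Proof.
intros H. unfold stadium. rewrite Rabs_right, Rabs_left1 by lra. replace (1 - ((s - x1 + - (s - x2) - (x2 - x1)) / (2 * a)) ^ 2) with 1. apply sqrt_1.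
replace (s - x1 + - (s - x2) - (x2 - x1)) with 0 by ring. unfold Rdiv. ring.
Qed.
Lemma stadium_right a x1 x2 s : 0 < a -> x1 <= x2 -> x2 <= s -> stadium a x1 x2 s = ellipse x2 a s.
Proof.
intros Ha H H1. unfold stadium, ellipse. f_equal. rewrite !Rabs_right by lra. field. lra.
Qed.
Lemma stadium_ge a x1 x2 c s : 0 < a -> x1 <= c <= x2 -> ellipse c a s <= stadium a x1 x2 s.
Proof.
intros Ha Hc. unfold ellipse, stadium. apply sqrt_le_1_alt. apply Rplus_le_compat_l, Ropp_le_contravar.
assert (Rabs ((Rabs (s - x1) + Rabs (s - x2) - (x2 - x1)) / (2 * a)) <= Rabs ((s - c) / a)).
{ unfold Rdiv. rewrite !Rabs_mult. rewrite (Rabs_right (/ (2 * a))), (Rabs_right (/ a)) by (left; apply Rinv_0_lt_compat; lra).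
  replace (Rabs (s - c) * / a) with (2 * Rabs (s - c) * / (2 * a)) by (field; lra).
  apply Rmult_le_compat_r. left; apply Rinv_0_lt_compat; lra.
  unfold Rabs. repeat destruct Rcase_abs; lra. }
rewrite <- (pow2_abs (_ / (2 * a))), <- (pow2_abs ((s - c) / a)). apply pow_incr. split. apply Rabs_pos. exact H.
Qed.
(** The centre c is the point of [x1, x2] nearest to s. With [stadium_ge], the stadium is the
    maximum of the translated half-ellipses. *)
Lemma stadium_clamp a x1 x2 s : 0 < a -> x1 <= x2 -> exists c, x1 <= c <= x2 /\ stadium a x1 x2 s = ellipse c a s.
Proof.
intros Ha H. destruct (Rle_dec s x1). exists x1. split. lra. now apply stadium_left.
destruct (Rle_dec x2 s). exists x2. split. lra. apply stadium_right; lra.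
exists s. split. lra. rewrite stadium_mid by lra. unfold ellipse. replace (1 - ((s - s) / a) ^ 2) with 1 by (field; lra). now rewrite sqrt_1.
Qed.

(** The half-ellipse that touches the stadium at t lies below it everywhere, and the kernel is
    positive; so [ellipse_poisson] at t carries over to the stadium. *)
Lemma stadium_poisson a x1 x2 n t : 0 < a -> x1 <= x2 -> x2 + a <= x1 - a + 1 -> 0 < n -> 
  stadium a x1 x2 t - n / a <= RInt (fun s => stadium a x1 x2 s * poisson_kernel n (s - t)) (x1 - a) (x1 - a + 1).
Proof.
intros Ha Hx Hb Hn. destruct (stadium_clamp a x1 x2 t Ha Hx) as [c [Hc ->]].
assert (X : forall u v, u <= v -> ex_RInt (fun s => stadium a x1 x2 s * poisson_kernel n (s - t)) u v).
{ intros u v Huv. apply ex_RInt_cont. exact Huv. intros. apply continuous_multR. apply continuous_stadium. now apply continuous_poisson_kernel_l. }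
assert (N : forall u v, u <= v -> 0 <= RInt (fun s => stadium a x1 x2 s * poisson_kernel n (s - t)) u v).
{ intros u v Huv. apply RInt_ge_0. exact Huv. now apply X. intros. apply Rmult_le_pos. apply sqrt_pos. left. now apply poisson_kernel_pos. }
rewrite <- (RInt_ChaslesR _ (x1 - a) (c + a)), <- (RInt_ChaslesR _ (x1 - a) (c - a)) by (apply X; lra).
assert (N1 := N (x1 - a) (c - a) ltac:(lra)). assert (N2 := N (c + a) (x1 - a + 1) ltac:(lra)).
assert (M : RInt (fun s => ellipse c a s * poisson_kernel n (s - t)) (c - a) (c + a) <= RInt (fun s => stadium a x1 x2 s * poisson_kernel n (s - t)) (c - a) (c + a)).
{ apply RInt_le. lra. apply ex_RInt_cont. lra. intros. apply continuous_multR. apply continuous_ellipse. now apply continuous_poisson_kernel_l. apply X. lra.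
  intros s _. apply Rmult_le_compat_r. left. now apply poisson_kernel_pos. now apply stadium_ge. }
assert (E := ellipse_poisson c a n t Ha Hn). lra.
Qed.

Lemma sin_sq_RInt u v : u <= v -> RInt (fun t => sin t * sin t) u v = (v - sin v * cos v) / 2 - (u - sin u * cos u) / 2.
Proof.
intros H. apply is_RInt_unique. apply (is_RInt_derive (V:=R_CompleteNormedModule) (fun t => (t - sin t * cos t) / 2)).
- intros x _. auto_derive. exact I. assert (C := sin2_cos2 x). unfold Rsqr in C. lra.
- intros x _. apply (ex_derive_continuous (V:=R_NormedModule)). auto_derive. exact I.
Qed.
Lemma ellipse_RInt c a u v : 0 < a -> 0 <= u -> u <= v -> v <= PI -> RInt (ellipse c a) (c - a * cos u) (c - a * cos v) = a * ((v - sin v * cos v) / 2 - (u - sin u * cos u) / 2).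
Proof.
intros Ha Hu Huv Hv. rewrite <- sin_sq_RInt by exact Huv.
rewrite <- (RInt_comp (V:=R_CompleteNormedModule) (ellipse c a) (fun t => c - a * cos t) (fun t => a * sin t)).
rewrite <- RInt_scalR. apply RInt_extR. exact Huv. intros t Ht. rewrite ellipse_cos by lra. unfold scal; simpl; unfold mult; simpl. ring.
apply ex_RInt_cont. exact Huv. intros x _. apply (ex_derive_continuous (V:=R_NormedModule)). auto_derive. exact I.
intros. apply continuous_ellipse.
intros x _. split. auto_derive. exact I. ring. apply (ex_derive_continuous (V:=R_NormedModule)). auto_derive. exact I.
Qed.
Lemma ellipse_outside c a s : 0 < a -> a <= s - c -> ellipse c a s = 0.
Proof.
intros Ha H. apply sqrt_neg_0. assert (1 <= (s - c) / a). { apply Rle_div_r. lra. lra. } nra.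
Qed.
Lemma stadium_RInt a x1 x2 b : 0 < a -> x1 <= x2 -> x2 + a <= b -> RInt (stadium a x1 x2) (x1 - a) b = x2 - x1 + PI * a / 2.
Proof.
intros Ha Hx Hb. assert (P := PI_RGT_0).
assert (X : forall u v, u <= v -> ex_RInt (stadium a x1 x2) u v). { intros u v Huv. apply ex_RInt_cont. exact Huv. intros. apply continuous_stadium. }
rewrite <- (RInt_ChaslesR _ (x1 - a) (x2 + a)), <- (RInt_ChaslesR _ (x1 - a) x2), <- (RInt_ChaslesR _ (x1 - a) x1) by (apply X; lra).
rewrite (RInt_extR _ (ellipse x1 a) (x1 - a) x1) by (first [lra | intros; apply stadium_left; lra]).
rewrite (RInt_extR _ (fun _ => 1) x1 x2) by (first [lra | intros; apply stadium_mid; lra]).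
rewrite (RInt_extR _ (ellipse x2 a) x2 (x2 + a)) by (first [lra | intros; apply stadium_right; lra]).
rewrite (RInt_extR _ (fun _ => 0) (x2 + a) b) by (first [lra | intros; rewrite stadium_right by lra; apply ellipse_outside; lra]).
rewrite !RInt_constR.
assert (E1 := ellipse_RInt x1 a 0 (PI/2) Ha ltac:(lra) ltac:(lra) ltac:(lra)).
assert (E2 := ellipse_RInt x2 a (PI/2) PI Ha ltac:(lra) ltac:(lra) ltac:(lra)).
rewrite cos_0, cos_PI2, sin_0, sin_PI2 in *. rewrite cos_PI, sin_PI in E2.
replace (x1 - a * 1) with (x1 - a) in E1 by ring. replace (x1 - a * 0) with x1 in E1 by ring.
replace (x2 - a * -1) with (x2 + a) in E2 by ring. replace (x2 - a * 0) with x2 in E2 by ring.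
rewrite E1, E2. match goal with |- @eq _ ?a ?b => change (@eq R a b) end. field.
Qed.


(** * The duality estimate *)

Lemma continuity_2d_of_x (f : R -> R) x y : continuous f x -> continuity_2d_pt (fun u _ => f u) x y.
Proof. intros H. apply (continuity_1d_2d_pt_comp f (fun u _ => u)). now apply continuity_pt_filterlim. apply continuity_2d_pt_id1. Qed.
Lemma continuity_2d_of_y (f : R -> R) x y : continuous f y -> continuity_2d_pt (fun _ v => f v) x y.
Proof. intros H. apply (continuity_1d_2d_pt_comp f (fun _ v => v)). now apply continuity_pt_filterlim. apply continuity_2d_pt_id2. Qed.
Lemma continuity_2d_poisson_kernel n x y : 0 < n -> continuity_2d_pt (fun s t => poisson_kernel n (s - t)) x y.
Proof.
intros Hn. apply (continuity_1d_2d_pt_comp (poisson_kernel n) (fun s t => s - t)). apply continuity_pt_filterlim.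
apply (ex_derive_continuous (V:=R_NormedModule)). unfold poisson_kernel. auto_derive. assert (D := poisson_kernel_den n (x - y) Hn). unfold Rminus in *. lra.
apply continuity_2d_pt_minus. apply continuity_2d_pt_id1. apply continuity_2d_pt_id2.
Qed.

(** By [poisson] and Fubini the kernel moves from W to the stadium S, so the left side is the
    integral of W (S - P_n S). Here W >= 0 has mean H, and S - P_n S <= n / a. *)
Lemma stadium_dual F H a x1 x2 y n : disc_diff F -> F (RtoC 0) = RtoC 0 -> (forall z, Cmod z < 1 -> Re (F z) <= H) ->
  0 < a -> x1 <= x2 -> x2 + a <= x1 - a + 1 -> 0 < y -> 0 < n ->
  RInt (fun s => stadium a x1 x2 s * (Re (F (expi (s, y + n))) - Re (F (expi (s, y))))) (x1 - a) (x1 - a + 1) <= n / a * H.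
Proof.
intros HF F0 HH Ha Hx Hb Hy Hn. set (A := x1 - a) in *. set (S := stadium a x1 x2).
set (W := fun t => H - Re (F (expi (t, y)))).
assert (Wc : forall t, continuous W t). { intros t. apply (continuous_minus (V:=R_NormedModule)). apply continuous_const. apply (continuous_Re_h (fun z => F (expi z))). now apply cdiff_comp_expi. }
assert (W0 : forall t, 0 <= W t). { intros t. unfold W. assert (Q := HH (expi (t,y)) (Cmod_expi_lt t y Hy)). lra. }
assert (Sc : forall t, continuous S t) by (intros; apply continuous_stadium).
assert (Pc : forall t s, continuous (fun t => poisson_kernel n (s - t)) t) by (intros; now apply continuous_poisson_kernel_r).
assert (Pc' : forall t s, continuous (fun s => poisson_kernel n (s - t)) s) by (intros; now apply continuous_poisson_kernel_l).
assert (EW : RInt W A (A + 1) = H).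
{ unfold W. rewrite RInt_minusR, RInt_constR. rewrite mean_value by assumption. rewrite F0. simpl. ringR.
  apply ex_RInt_constR. apply ex_RInt_cont. lra. intros. apply (continuous_Re_h (fun z => F (expi z))). now apply cdiff_comp_expi. }
assert (Wn : forall s, H - Re (F (expi (s, y + n))) = RInt (fun t => W t * poisson_kernel n (s - t)) A (A + 1)).
{ intros s. rewrite <- (poisson F A) by assumption. unfold W.
  rewrite (RInt_extR (fun t => (H - Re (F (expi (t, y)))) * poisson_kernel n (s - t)) (fun t => H * poisson_kernel n (s - t) - Re (F (expi (t, y))) * poisson_kernel n (s - t))) by (lra || (intros; ring)).
  assert (X2 : ex_RInt (fun t => poisson_kernel n (s - t)) A (A + 1)) by (apply ex_RInt_cont; [lra|intros; apply Pc]).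
  assert (X3 : ex_RInt (fun t => H * poisson_kernel n (s - t)) A (A + 1)) by (apply ex_RInt_cont; [lra|intros; apply continuous_multR; [apply continuous_const|apply Pc]]).
  rewrite (RInt_minusR _ _ _ _ X3 (ex_RInt_poisson F A y n s HF Hy Hn)), (RInt_scalR _ _ _ _ X2), (poisson_kernel_RInt A s n Hn). ringR. }
assert (C1 : forall t, continuous (fun s => S s * (H - Re (F (expi (s, y + n))))) t).
{ intros t. apply continuous_multR. apply Sc. apply (continuous_minus (V:=R_NormedModule)). apply continuous_const. apply (continuous_Re_h (fun z => F (expi z))). apply cdiff_comp_expi. exact HF. lra. }
rewrite (RInt_extR _ (fun s => S s * W s - S s * (H - Re (F (expi (s, y + n))))) A) by (lra || (intros; unfold S, W; ring)).
assert (X1 : ex_RInt (fun s => S s * (H - Re (F (expi (s, y + n))))) A (A + 1)) by (apply ex_RInt_cont; [lra|intros; apply C1]).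
assert (X2 : ex_RInt (fun s => S s * W s) A (A + 1)) by (apply ex_RInt_cont; [lra|intros; apply continuous_multR; [apply Sc|apply Wc]]).
rewrite (RInt_minusR _ _ _ _ X2 X1).
assert (Fu : RInt (fun s => S s * (H - Re (F (expi (s, y + n))))) A (A + 1) = RInt (fun t => W t * RInt (fun s => S s * poisson_kernel n (s - t)) A (A + 1)) A (A + 1)).
{ transitivity (RInt (fun s => RInt (fun t => S s * (W t * poisson_kernel n (s - t))) A (A + 1)) A (A + 1)).
  - apply RInt_extR. lra. intros s _. rewrite RInt_scalR. now rewrite Wn. apply ex_RInt_cont. lra. intros; apply continuous_multR; [apply Wc|apply Pc].
  - rewrite (fubini (fun s t => S s * (W t * poisson_kernel n (s - t)))). 2,3: lra.
    + apply RInt_extR. lra. intros t _. rewrite <- RInt_scalR. apply RInt_extR. lra. intros; ring. apply ex_RInt_cont. lra. intros; apply continuous_multR; [apply Sc|apply Pc'].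
    + intros. apply continuity_2d_pt_mult. apply continuity_2d_of_x. apply Sc. apply continuity_2d_pt_mult. apply continuity_2d_of_y. apply Wc. now apply continuity_2d_poisson_kernel. }
rewrite Fu. replace (n / a * H) with (n / a * RInt W A (A + 1)) by now rewrite EW.
assert (Ct : forall t, continuous (fun t => RInt (fun s => S s * poisson_kernel n (s - t)) A (A + 1)) t).
{ intros t. apply (continuous_param (fun t s => S s * poisson_kernel n (s - t))). lra. intros u v. apply continuity_2d_swap.
  apply (continuity_2d_pt_mult (fun s _ => S s) (fun s t => poisson_kernel n (s - t))). apply continuity_2d_of_x. apply Sc. now apply continuity_2d_poisson_kernel. }
rewrite <- RInt_scalR by (apply ex_RInt_cont; [lra|]; intros; apply Wc).
rewrite <- RInt_minusR.
2: apply ex_RInt_cont; [lra|]; intros; apply continuous_multR; [apply Sc|apply Wc].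
2: apply ex_RInt_cont; [lra|]; intros; apply continuous_multR; [apply Wc|apply Ct].
apply RInt_le. lra.
apply ex_RInt_minusR; apply ex_RInt_cont; try lra; intros; apply continuous_multR; [apply Sc|apply Wc|apply Wc|apply Ct].
apply (ex_RInt_scal (V:=R_NormedModule)). apply ex_RInt_cont; [lra|]; intros; apply Wc.
intros t _. assert (K := stadium_poisson a x1 x2 n t Ha Hx Hb Hn). fold A S in K. specialize (W0 t). nra.
Qed.

(** The drop g is first bounded in mean over every interval [y, y + n], where Goursat exchanges it
    for the increment D of u; continuity of g then gives the bound at y. *)
Lemma drop_le_stadium F H K a x1 x2 y : disc_diff F -> F (RtoC 0) = RtoC 0 -> (forall z, Cmod z < 1 -> Re (F z) <= H) ->
  (forall x y n, 0 < y -> 0 <= n -> Re (F (expi (x,y))) - Re (F (expi (x,y+n))) <= K * n) ->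
  0 < a -> x1 <= x2 -> x2 + a <= x1 - a + 1 -> 0 < y ->
  Im (F (expi (x1,y))) - Im (F (expi (x2,y))) <= H / a + K * (PI * a / 2).
Proof.
intros HF F0 HH HK Ha Hx Hb Hy. set (S := H / a + K * (PI * a / 2)).
set (g := fun r => Im (F (expi (x1,r))) - Im (F (expi (x2,r)))). change (g y <= S).
assert (gc : forall r, 0 < r -> continuous g r).
{ intros r Hr. apply (continuous_minus (V:=R_NormedModule)); apply (continuous_Im_v (fun z => F (expi z))); now apply cdiff_comp_expi. }
assert (G : forall n, 0 < n -> RInt g y (y + n) <= n * S).
{ intros n Hn. set (D := fun s => Re (F (expi (s, y + n))) - Re (F (expi (s, y)))).
  assert (Dc : forall s, continuous D s).
  { intros s. apply (continuous_minus (V:=R_NormedModule)); apply (continuous_Re_h (fun z => F (expi z))); apply cdiff_comp_expi; assumption || lra. }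
  assert (Go := goursat (fun z => F (expi z)) x1 x2 y (y + n) Hx ltac:(lra) ltac:(intros u v _ Hv; apply cdiff_comp_expi; [exact HF|lra])).
  unfold rect_int in Go.
  assert (E : RInt g y (y + n) = RInt D x1 x2).
  { unfold g, D. 
    rewrite (RInt_extR (fun r => Im (F (expi (x1, r))) - Im (F (expi (x2, r)))) (fun r => -1 * (Im (F (expi (x2, r))) - Im (F (expi (x1, r)))))) by (lra || (intros; ring)).
    rewrite (RInt_extR (fun s => Re (F (expi (s, y + n))) - Re (F (expi (s, y)))) (fun s => -1 * (Re (F (expi (s, y))) - Re (F (expi (s, y + n)))))) by (lra || (intros; ring)).
    rewrite !RInt_scalR. f_equal. symmetry. apply Rminus_diag_uniq. exact Go.
    apply ex_RInt_cont; [lra|]; intros s _; apply (continuous_minus (V:=R_NormedModule)); apply (continuous_Re_h (fun z => F (expi z))); apply cdiff_comp_expi; assumption || lra.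
    apply ex_RInt_cont; [lra|]; intros s Hs; apply (continuous_minus (V:=R_NormedModule)); apply (continuous_Im_v (fun z => F (expi z))); apply cdiff_comp_expi; assumption || lra. }
  rewrite E.
  assert (Dual := stadium_dual F H a x1 x2 y n HF F0 HH Ha Hx Hb Hy Hn). fold D in Dual.
  assert (I := stadium_RInt a x1 x2 (x1 - a + 1) Ha Hx Hb).
  assert (Kn : forall s, 0 <= D s + K * n). { intros s. unfold D. assert (Q := HK s y n Hy ltac:(lra)). lra. }
  (* Adding K n makes the increment nonnegative, so the part of the weighted integral off [x1, x2]
     can be discarded; on [x1, x2] the weight is 1. *)
  set (T := fun s => stadium a x1 x2 s * (D s + K * n)).
  assert (Tc : forall s, continuous T s). { intros s. apply continuous_multR. apply continuous_stadium. apply (continuous_plus (V:=R_NormedModule)). apply Dc. apply continuous_const. }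
  assert (T0 : forall s, 0 <= T s). { intros s. apply Rmult_le_pos. apply sqrt_pos. apply Kn. }
  assert (TX : forall u v, u <= v -> ex_RInt T u v) by (intros u v Huv; apply ex_RInt_cont; [exact Huv|intros; apply Tc]).
  assert (TE : RInt T (x1 - a) (x1 - a + 1) = RInt (fun s => stadium a x1 x2 s * D s) (x1 - a) (x1 - a + 1) + K * n * RInt (stadium a x1 x2) (x1 - a) (x1 - a + 1)).
  { rewrite <- RInt_scalR, <- RInt_plusR. apply RInt_extR. lra. intros; unfold T; ring.
    apply ex_RInt_cont; [lra|intros]. apply continuous_multR. apply continuous_stadium. apply Dc.
    apply (ex_RInt_scal (V:=R_NormedModule)). apply ex_RInt_cont; [lra|intros]. apply continuous_stadium.
    apply ex_RInt_cont; [lra|intros]. apply continuous_stadium. }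
  rewrite <- (RInt_ChaslesR T (x1 - a) x2), <- (RInt_ChaslesR T (x1 - a) x1) in TE by (apply TX; lra).
  assert (N1 := RInt_ge_0 T (x1 - a) x1 ltac:(lra) (TX (x1 - a) x1 ltac:(lra)) ltac:(intros; apply T0)).
  assert (N2 := RInt_ge_0 T x2 (x1 - a + 1) ltac:(lra) (TX x2 (x1 - a + 1) ltac:(lra)) ltac:(intros; apply T0)).
  assert (TM : RInt T x1 x2 = RInt D x1 x2 + (x2 - x1) * (K * n)).
  { rewrite <- RInt_constR, <- RInt_plusR. apply RInt_extR. lra. intros s Hs. unfold T. rewrite stadium_mid by lra. ring.
    apply ex_RInt_cont; [lra|intros; apply Dc]. apply ex_RInt_constR. }
  rewrite I in TE. change (RInt (fun s => stadium a x1 x2 s * (Re (F (expi (s, y + n))) - Re (F (expi (s, y))))) (x1 - a) (x1 - a + 1)) with (RInt (fun s => stadium a x1 x2 s * D s) (x1 - a) (x1 - a + 1)) in Dual.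
  unfold S. replace (n * (H / a + K * (PI * a / 2))) with (n / a * H + K * n * (PI * a / 2)) by (field; lra). lra. }
(* If g y exceeded S, then g would exceed S + e just above y, against the mean bound on a short
   interval. *)
destruct (Rle_dec (g y) S) as [ok|no]. exact ok. exfalso.
set (e := (g y - S) / 2). assert (Pe : 0 < e) by (unfold e; lra).
assert (Cy := gc y Hy). apply continuity_pt_filterlim in Cy. destruct (Cy e Pe) as [d [Hd Hc]]. simpl in Hc. unfold R_dist in Hc.
set (n := d / 2). assert (Pn : 0 < n) by (unfold n; lra). specialize (G n Pn).
assert (L : RInt (fun _ => S + e) y (y + n) <= RInt g y (y + n)).
{ apply RInt_le. lra. apply ex_RInt_constR. apply ex_RInt_cont. lra. intros; apply gc; lra.
  intros r Hr. assert (Q : Rabs (g r - g y) < e). { apply Hc. split. split. exact Logic.I. lra. rewrite Rabs_right. unfold n in *. lra. lra. }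
  apply Rabs_lt_between in Q. unfold e in *. lra. }
rewrite RInt_constR in L. nra.
Qed.

(** * The upper bound *)

Lemma unit_angle u v : u * u + v * v = 1 -> exists t, 0 <= t < 1 /\ cos (2 * PI * t) = u /\ sin (2 * PI * t) = v.
Proof.
intros H. assert (P := PI_RGT_0). assert (Hu : -1 <= u <= 1) by nra. assert (B := acos_bound u).
assert (Sq : sqrt (1 - u²) = Rabs v). { rewrite <- sqrt_Rsqr_abs. f_equal. unfold Rsqr. lra. }
destruct (Rle_dec 0 v) as [Hv|Hv].
- exists (acos u / (2 * PI)). replace (2 * PI * (acos u / (2 * PI))) with (acos u) by (field; lra).
  rewrite cos_acos, sin_acos, Sq, Rabs_right by lra. split; [|split; reflexivity].
  split. apply Rdiv_le_0_compat; lra. apply Rlt_div_l; lra.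
- exists (1 - acos u / (2 * PI)). replace (2 * PI * (1 - acos u / (2 * PI))) with (- acos u + 2 * PI) by (field; lra).
  rewrite cos_plus, sin_plus, cos_2PI, sin_2PI, cos_neg, sin_neg, cos_acos, sin_acos, Sq, Rabs_left by lra.
  (* As v < 0 excludes u = 1, acos u is positive and the angle stays below one full turn. *)
  split; [|split; ring]. assert (0 < acos u). { destruct B as [[B|B] _]. exact B. exfalso. assert (E := cos_acos u Hu). rewrite <- B, cos_0 in E. subst u. nra. }
  assert (0 < acos u / (2 * PI)) by (apply Rdiv_lt_0_compat; lra). assert (acos u / (2 * PI) <= 1 / 2). { apply Rle_div_l; lra. } lra.
Qed.
Lemma polar_repr z : exists t, 0 <= t < 1 /\ z = polar (Cmod z) t.
Proof.
destruct (Req_dec (Cmod z) 0) as [E|E].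
- exists 0. split. lra. apply Cmod_eq_0 in E. subst z. rewrite Cmod_0. unfold polar, RtoC. f_equal; ring.
- assert (Pz : 0 < Cmod z) by (assert (Q := Cmod_ge_0 z); lra).
  destruct (unit_angle (Re z / Cmod z) (Im z / Cmod z)) as [t [Ht [Hc Hs]]].
  { assert (A := Cmod2_alt z). apply Rmult_eq_reg_r with (Cmod z ^ 2). 2: nra. rewrite Rmult_1_l. rewrite A at 2. field. exact E. }
  exists t. split. exact Ht. unfold polar. rewrite Hc, Hs. destruct z as [x y]; simpl in *. f_equal; field; exact E.
Qed.
Lemma expi_repr z : z <> RtoC 0 -> Cmod z < 1 -> exists x y, 0 <= x < 1 /\ 0 < y /\ z = expi (x,y).
Proof.
intros Hz H1. assert (P := PI_RGT_0). assert (P0 : 0 < Cmod z) by now apply Cmod_gt_0.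
destruct (polar_repr z) as [t [Ht E]]. exists t, (- ln (Cmod z) / (2 * PI)). split. exact Ht. split.
- apply Rdiv_lt_0_compat. 2: lra. assert (L := ln_increasing _ _ P0 H1). rewrite ln_1 in L. lra.
- rewrite expi_polar. replace (- (2 * PI * (- ln (Cmod z) / (2 * PI)))) with (ln (Cmod z)) by (field; lra). now rewrite exp_ln.
Qed.

Lemma derive_Im_polar F r t l : cderiv F (polar r t) l -> is_derive (fun s => Im (F (polar r s))) t (2 * PI * Re (polar r t * l)).
Proof.
intros H. 
assert (D1 : is_derive (fun s => r * cos (2 * PI * s)) t (- (2 * PI * (r * sin (2 * PI * t))))) by (auto_derive; [exact I|ring]).
assert (D2 : is_derive (fun s => r * sin (2 * PI * s)) t (2 * PI * (r * cos (2 * PI * t)))) by (auto_derive; [exact I|ring]).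
destruct (cderiv_path F _ _ t _ _ l H D1 D2) as [_ Q]. eapply eq_rect with (P := is_derive _ _). exact Q.
unfold polar, Re, Im; simpl. ring.
Qed.

(** By [derive_Im_polar] this expression is the derivative of v in theta; it is also minus the
    derivative of u in the height, so one hypothesis yields both [horizontal_rise] and
    [vertical_drop]. *)
Definition rot_deriv_le (F : C -> C) K := forall z l, Cmod z < 1 -> cderiv F z l -> 2 * PI * Re (z * l) <= K.

Lemma horizontal_rise F K : disc_diff F -> rot_deriv_le F K -> forall x x' y, 0 < y -> x <= x' -> 
  Im (F (expi (x',y))) - Im (F (expi (x,y))) <= K * (x' - x).
Proof.
intros HF HK x x' y Hy Hx.
assert (L : K * x - Im (F (expi (x,y))) <= K * x' - Im (F (expi (x',y)))); [|lra].
set (G := fun x : R => K * x - Im (F (expi (x,y)))). change (G x <= G x').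
assert (Dv : forall s l, cderiv F (expi (s,y)) l -> is_derive G s (K - 2 * PI * Re (expi (s,y) * l))).
{ intros s l Hl. apply (is_derive_minus (V:=R_NormedModule) (fun x => K * x) (fun x : R => Im (F (expi (x,y)))) s K (2 * PI * Re (expi (s,y) * l))). auto_derive. exact I. ring. rewrite expi_polar in *.
  apply is_derive_ext with (fun t => Im (F (polar (exp (- (2 * PI * y))) t))). intros t. apply (f_equal (fun w => Im (F w))). symmetry. apply expi_polar. now apply derive_Im_polar. }
apply (derive_nonneg_incr G (Derive G) x x' Hx).
- intros s _. destruct (HF _ (Cmod_expi_lt s y Hy)) as [l Hl]. apply Derive_correct. eexists. exact (Dv s l Hl).
- intros s _. destruct (HF _ (Cmod_expi_lt s y Hy)) as [l Hl]. rewrite (is_derive_unique _ _ _ (Dv s l Hl)).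
  specialize (HK _ l (Cmod_expi_lt s y Hy) Hl). lra.
Qed.
Lemma vertical_drop F K : disc_diff F -> rot_deriv_le F K -> forall x y n, 0 < y -> 0 <= n -> 
  Re (F (expi (x,y))) - Re (F (expi (x,y + n))) <= K * n.
Proof.
intros HF HK x y n Hy Hn.
assert (L : Re (F (expi (x,y))) + K * y <= Re (F (expi (x,y+n))) + K * (y + n)); [|lra].
set (G := fun y : R => Re (F (expi (x,y))) + K * y). change (G y <= G (y + n)).
assert (Dv : forall s l, 0 < s -> cderiv F (expi (x,s)) l -> is_derive G s (- (2 * PI * Re (expi (x,s) * l)) + K)).
{ intros s l Hs Hl. apply (is_derive_plus (V:=R_NormedModule) (fun y : R => Re (F (expi (x,y)))) (fun y => K * y)). 2: auto_derive; [exact I|ring].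
  assert (Dc := cderiv_comp F expi (x,s) _ _ Hl (cderiv_expi _)).
  destruct (cderiv_path (fun z => F (expi z)) (fun _ => x) (fun y => y) s 0 1 _ Dc (is_derive_const _ _) (is_derive_id _)) as [Q _].
  eapply eq_rect with (P := is_derive _ _). exact Q. generalize (expi (x,s)). intros w. unfold Re; simpl. ring. }
apply (derive_nonneg_incr G (Derive G) y (y + n) ltac:(lra)).
- intros s Hs. destruct (HF _ (Cmod_expi_lt x s ltac:(lra))) as [l Hl]. apply Derive_correct. eexists. exact (Dv s l ltac:(lra) Hl).
- intros s Hs. destruct (HF _ (Cmod_expi_lt x s ltac:(lra))) as [l Hl]. rewrite (is_derive_unique _ _ _ (Dv s l ltac:(lra) Hl)).
  specialize (HK _ l (Cmod_expi_lt x s ltac:(lra)) Hl). lra.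
Qed.

Section Upper.
Variables (F : C -> C) (H K : R).
Hypotheses (HF : disc_diff F) (F0 : F (RtoC 0) = RtoC 0) (H_pos : 0 < H) (K_pos : 0 < K).
Hypotheses (HH : forall z, Cmod z < 1 -> Re (F z) <= H) (HK : rot_deriv_le F K).
Let S := sqrt (2 * PI) * sqrt (H * K).

Lemma drop_arc x1 x2 y : 0 < y -> x1 <= x2 <= x1 + 1 -> Im (F (expi (x1,y))) - Im (F (expi (x2,y))) <= S.
Proof.
intros Hy Hx. assert (P := PI_RGT_0). assert (P2 := PI2_1). set (a := sqrt (2 * H / (PI * K))).
assert (Q : 0 < 2 * H / (PI * K)). { apply Rdiv_lt_0_compat. lra. apply Rmult_lt_0_compat; lra. }
assert (Ha : 0 < a) by now apply sqrt_lt_R0.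
assert (Ha2 : a * a = 2 * H / (PI * K)) by (apply sqrt_sqrt; lra).
assert (HS : S = PI * K * a).
{ unfold S. rewrite <- sqrt_mult by nra. rewrite <- (sqrt_square (PI * K * a)) by (apply Rmult_le_pos; nra). f_equal.
  replace (PI * K * a * (PI * K * a)) with (PI * K * (PI * K) * (a * a)) by ring. rewrite Ha2. field. lra. }
destruct (Rle_dec (x2 + a) (x1 - a + 1)) as [L|L].
- eapply Rle_trans. apply (drop_le_stadium F H K a x1 x2 y); try assumption. now apply vertical_drop. lra. 
  (* At the optimal a the terms H / a and pi a K / 2 are equal, each half of S. *)
  rewrite HS. replace (H / a) with (PI * K * a / 2). right. field.
  apply Rmult_eq_reg_r with a. 2: lra. replace (PI * K * a / 2 * a) with (PI * K / 2 * (a * a)) by field. rewrite Ha2. field. lra.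
(* The complementary arc from x2 to x1 + 1 is shorter than 2 a, and 2 a K <= pi a K = S. *)
- assert (R1 := horizontal_rise F K HF HK x2 (x1 + 1) y Hy ltac:(lra)). rewrite expi_period in R1.
  eapply Rle_trans. exact R1. rewrite HS. apply Rle_trans with (K * (2 * a)). apply Rmult_le_compat_l; lra.
  replace (PI * K * a) with (K * (PI * a)) by ring. apply Rmult_le_compat_l. lra. apply Rmult_le_compat_r; lra.
Qed.
Lemma drop_circle x1 x2 y : 0 < y -> 0 <= x1 <= 1 -> 0 <= x2 <= 1 -> Im (F (expi (x1,y))) - Im (F (expi (x2,y))) <= S.
Proof.
intros Hy H1 H2. destruct (Rle_dec x1 x2). apply drop_arc; lra. rewrite <- (expi_period x2). apply drop_arc; lra.
Qed.
Lemma continuous_ImF y t : 0 < y -> continuous (fun t => Im (F (expi (t,y)))) t.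
Proof. intros Hy. apply (continuous_Im_h (fun z => F (expi z))). now apply cdiff_comp_expi. Qed.
(** Here [g] is a probability density over one period: a Poisson kernel, or the constant 1 when one
    point is the origin. *)
Lemma Im_mean (g : R -> R) c y : 0 < y -> (forall t, continuous g t) -> (forall t, 0 <= g t) -> RInt g 0 1 = 1 ->
  (forall t, 0 <= t <= 1 -> Im (F (expi (t,y))) <= c) -> RInt (fun t => Im (F (expi (t,y))) * g t) 0 1 <= c.
Proof.
intros Hy gc g0 g1 Hc. assert (E : c = RInt (fun t => c * g t) 0 1). { rewrite RInt_scalR, g1. ringR. apply ex_RInt_cont. lra. intros; apply gc. }
rewrite E. apply RInt_le. lra. 
apply ex_RInt_cont. lra. intros. apply continuous_multR. now apply continuous_ImF. apply gc.
apply ex_RInt_cont. lra. intros. apply continuous_multR. apply continuous_const. apply gc.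
intros t Ht. apply Rmult_le_compat_r. apply g0. apply Hc. lra.
Qed.
Lemma Im_mean_ge (g : R -> R) c y : 0 < y -> (forall t, continuous g t) -> (forall t, 0 <= g t) -> RInt g 0 1 = 1 ->
  (forall t, 0 <= t <= 1 -> c <= Im (F (expi (t,y)))) -> c <= RInt (fun t => Im (F (expi (t,y))) * g t) 0 1.
Proof.
intros Hy gc g0 g1 Hc. assert (E : c = RInt (fun t => c * g t) 0 1). { rewrite RInt_scalR, g1. ringR. apply ex_RInt_cont. lra. intros; apply gc. }
rewrite E. apply RInt_le. lra. 
apply ex_RInt_cont. lra. intros. apply continuous_multR. apply continuous_const. apply gc.
apply ex_RInt_cont. lra. intros. apply continuous_multR. now apply continuous_ImF. apply gc.
intros t Ht. apply Rmult_le_compat_r. apply g0. apply Hc. lra.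
Qed.
Lemma Im_poisson x y n : 0 < y -> 0 < n -> Im (F (expi (x,y+n))) = RInt (fun t => Im (F (expi (t,y))) * poisson_kernel n (x - t)) 0 1.
Proof.
intros Hy Hn. rewrite <- Re_mul_neg_i, <- (poisson (mul_neg_i F) 0) by (try apply disc_diff_mul_neg_i; assumption). rewrite Rplus_0_l.
apply RInt_extR. lra. intros. now rewrite Re_mul_neg_i.
Qed.
Lemma Im_mean_zero y : 0 < y -> 0 = RInt (fun t => Im (F (expi (t,y))) * 1) 0 1.
Proof.
intros Hy. assert (M := mean_value (mul_neg_i F) 0 y (disc_diff_mul_neg_i F HF) Hy). rewrite Re_mul_neg_i, F0, Rplus_0_l in M. change (Im (RtoC 0)) with 0 in M. symmetry. eapply eq_trans; [|exact M].
apply RInt_extR. lra. intros. rewrite Re_mul_neg_i. now rewrite Rmult_1_r.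
Qed.
Lemma one_mean : RInt (fun _ => 1) 0 1 = 1.
Proof. rewrite RInt_constR. ringR. Qed.
Lemma poisson_kernel_mean x n : 0 < n -> RInt (fun t => poisson_kernel n (x - t)) 0 1 = 1.
Proof. intros Hn. assert (I := poisson_kernel_RInt 0 x n Hn). rewrite Rplus_0_l in I. exact I. Qed.

(** The value at the greater height is an average of values on the lower line, and the value at 0 is
    the mean over any circle; both reduce to two points on one circle. *)
Lemma drop_le z1 z2 : Cmod z1 < 1 -> Cmod z2 < 1 -> Im (F z1) - Im (F z2) <= S.
Proof.
intros H1 H2. 
destruct (Ceq_dec z1 (RtoC 0)) as [E1|E1]; destruct (Ceq_dec z2 (RtoC 0)) as [E2|E2].
- subst. rewrite F0. replace (Im 0 - Im 0) with 0 by ring. apply Rmult_le_pos; apply sqrt_pos.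
- subst z1. destruct (expi_repr z2 E2 H2) as [x2 [y2 [Hx2 [Hy2 ->]]]]. rewrite F0. simpl.
  assert (G : 0 <= Im (F (expi (x2,y2))) + S); [|lra]. 
  rewrite (Im_mean_zero y2 Hy2). apply (Im_mean (fun _ => 1)). exact Hy2. intros; apply continuous_const. intros; lra. apply one_mean. 
  intros t Ht. assert (Q := drop_circle t x2 y2 Hy2 Ht ltac:(lra)). lra.
- subst z2. destruct (expi_repr z1 E1 H1) as [x1 [y1 [Hx1 [Hy1 ->]]]]. rewrite F0. simpl.
  assert (G : Im (F (expi (x1,y1))) - S <= 0); [|lra].
  rewrite (Im_mean_zero y1 Hy1). apply (Im_mean_ge (fun _ => 1)). exact Hy1. intros; apply continuous_const. intros; lra. apply one_mean. 
  intros t Ht. assert (Q := drop_circle x1 t y1 Hy1 ltac:(lra) Ht). lra.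
- destruct (expi_repr z1 E1 H1) as [x1 [y1 [Hx1 [Hy1 ->]]]]. destruct (expi_repr z2 E2 H2) as [x2 [y2 [Hx2 [Hy2 ->]]]].
  destruct (Rtotal_order y1 y2) as [L|[L|L]].
  + assert (G : Im (F (expi (x1,y1))) - S <= Im (F (expi (x2,y2)))); [|lra].
    replace y2 with (y1 + (y2 - y1)) by ring. rewrite Im_poisson by lra.
    apply (Im_mean_ge (fun t => poisson_kernel (y2 - y1) (x2 - t))). exact Hy1. intros; apply continuous_poisson_kernel_r; lra. intros; left; apply poisson_kernel_pos; lra. apply poisson_kernel_mean; lra.
    intros t Ht. assert (Q := drop_circle x1 t y1 Hy1 ltac:(lra) Ht). lra.
  + subst y2. apply drop_circle; lra.
  + assert (G : Im (F (expi (x1,y1))) <= Im (F (expi (x2,y2))) + S); [|lra].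
    replace y1 with (y2 + (y1 - y2)) by ring. rewrite Im_poisson by lra.
    apply (Im_mean (fun t => poisson_kernel (y1 - y2) (x1 - t))). exact Hy2. intros; apply continuous_poisson_kernel_r; lra. intros; left; apply poisson_kernel_pos; lra. apply poisson_kernel_mean; lra.
    intros t Ht. assert (Q := drop_circle t x2 y2 Hy2 Ht ltac:(lra)). lra.
Qed.
End Upper.

Lemma upper_bound f H K z1 z2 : admissible f H K -> Cmod z1 < 1 -> Cmod z2 < 1 ->
  Rabs (Im (f z1) - Im (f z2)) <= sqrt (2 * PI) * sqrt (H * K).
Proof.
intros [A1 [A2 [A3 [A4 [A5 A6]]]]] H1 H2.
assert (HF : disc_diff f) by (intros z Hz; exact (A1 z Hz)).
assert (HK : rot_deriv_le f K).
{ intros z l Hz Hl. destruct (polar_repr z) as [t [Ht E]]. assert (Pz := Cmod_ge_0 z). specialize (A6 (Cmod z) t ltac:(lra) Ht).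
  unfold dv_dtheta in A6. rewrite E in Hl. assert (Q := is_derive_unique _ _ _ (derive_Im_polar f (Cmod z) t l Hl)). rewrite <- E in Q. rewrite <- Q. exact A6. }
apply Rabs_le. assert (B1 := drop_le f H K HF A2 A3 A4 A5 HK z1 z2 H1 H2). assert (B2 := drop_le f H K HF A2 A3 A4 A5 HK z2 z1 H2 H1). lra.
Qed.

(** * Sharpness *)

Lemma csqrt_real r : 0 <= r -> csqrt (r,0) = (sqrt r, 0).
Proof.
intros H. unfold csqrt. simpl. assert (E : Cmod (r,0) = r). { change (r,0) with (RtoC r). rewrite Cmod_R. apply Rabs_right. lra. }
rewrite E. replace ((r + r) / 2) with r by field. f_equal. unfold Rdiv. ring.
Qed.
Lemma Ln_real x : 0 < x -> Ln (x,0) = (ln x, 0).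
Proof.
intros H. unfold Ln. simpl. replace (x * x + 0 * 0) with (x * x) by ring. rewrite ln_mult by lra. f_equal. field.
unfold Rdiv. rewrite Rmult_0_l. apply atan_0.
Qed.
Lemma ln_1m_le t : 0 <= t < 1 -> ln (1 - t) <= - t - t * t / 2.
Proof.
intros Ht. assert (L : - 0 - 0 * 0 / 2 - ln (1 - 0) <= - t - t * t / 2 - ln (1 - t)).
{ apply (derive_nonneg_incr (fun t => - t - t * t / 2 - ln (1 - t)) (fun t => t * t / (1 - t)) 0 t ltac:(lra)).
  intros s Hs. auto_derive. lra. field. lra. intros s Hs. apply Rdiv_le_0_compat. apply Rle_0_sqr. lra. }
rewrite Rminus_0_r, ln_1 in L. lra.
Qed.
Lemma ln_1p_le t : 0 <= t -> ln (1 + t) <= t - t * t / 2 + t * t * t / 3.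
Proof.
intros Ht. assert (L : 0 - 0 * 0 / 2 + 0 * 0 * 0 / 3 - ln (1 + 0) <= t - t * t / 2 + t * t * t / 3 - ln (1 + t)).
{ apply (derive_nonneg_incr (fun t => t - t * t / 2 + t * t * t / 3 - ln (1 + t)) (fun t => t * t * t / (1 + t)) 0 t Ht).
  intros s Hs. auto_derive. lra. field. lra. intros s Hs. apply Rdiv_le_0_compat. apply Rmult_le_pos. apply Rle_0_sqr. lra. lra. }
rewrite Rplus_0_r, ln_1 in L. lra.
Qed.
(** Maps the disc onto the right half-plane, 0 to 1 and the singular point 1 to infinity. *)
Definition cayley (z : C) : C := ((1 + z) / (1 - z))%C.
Lemma cayley_Re z : Cmod z < 1 -> 0 < Re (cayley z).
Proof.
intros H. assert (N := one_minus_neq z H). destruct z as [x y].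
assert (A := Cmod2_alt (x,y)). assert (B := Cmod_ge_0 (x,y)). simpl in A.
assert (D : 0 < (1 - x) * (1 - x) + y * y).
{ assert (Q := proj1 (Cmod_gt_0 _) N). assert (A' := Cmod2_alt (1 - (x,y))). unfold Re, Im in A'; simpl in A'. nra. }
assert (E : Re (cayley (x,y)) = (1 - x * x - y * y) / ((1 - x) * (1 - x) + y * y)).
{ unfold cayley, Re, Cdiv, Cmult, Cinv, Cminus, Cplus, Copp, RtoC; simpl. field. lra. }
rewrite E. apply Rdiv_lt_0_compat. nra. exact D.
Qed.
Lemma cayley_inv M : 0 < Re M -> Cmod ((M - 1) / (M + 1)) < 1 /\ cayley ((M - 1) / (M + 1)) = M.
Proof.
intros H. assert (P : 0 < Re (M + 1)) by (unfold Re in *; simpl in *; lra). assert (N := Cneq_Re_pos _ P). split.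
- rewrite Cmod_div by exact N. assert (Q := proj1 (Cmod_gt_0 _) N). apply Rlt_div_l. lra. rewrite Rmult_1_l.
  assert (A := Cmod2_alt (M - 1)). assert (B := Cmod2_alt (M + 1)). assert (G := Cmod_ge_0 (M - 1)). destruct M as [x y]. unfold Re, Im in *; simpl in *. nra.
- unfold cayley. field. split. exact N.
  replace (M + 1 - (M - 1))%C with (RtoC 2) by (replace (RtoC 2) with (1 + 1)%C by (rewrite <- RtoC_plus; f_equal; ring); ring). intros E. apply RtoC_inj in E. lra.
Qed.

(** * The extremal function *)

Section Extremal.
Variable p : R.
Hypothesis Hp : 0 < p < 1.

(** At M = i t this is 1 - p^2 - p^2 t^2. Its sign change at |t| = sqrt (1 - p^2) / p separates the
    arc where v rises at the full rate from the arc where u is maximal. *)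
Definition extr_rad (M : C) : C := (1 - p * p + p * p * (M * M))%C.
Definition extr_root (M : C) : C := csqrt (extr_rad M).
(** The last constant normalises the value at M = 1, that is z = 0, to 0. *)
Definition extremal (M : C) : C := (Ln (M + extr_root M) - Ln (M + 1) - p * Ln (p * M + extr_root M) + p * Ln (p + 1))%C.

Lemma extr_rad_pair x y : extr_rad (x,y) = (1 - p * p + p * p * (x * x - y * y), p * p * (2 * x * y))%R.
Proof. unfold extr_rad, Cmult, Cplus, Cminus, Copp, RtoC; simpl. f_equal; ring. Qed.
Lemma extr_rad_slit M : 0 < Re M -> slit (extr_rad M).
Proof.
destruct M as [x y]. simpl. intros Hx. rewrite extr_rad_pair. unfold slit; simpl. destruct (Req_dec y 0) as [->|Hy].
left. assert (0 < x * x) by nra. assert (0 < p * p) by nra. assert (0 < p * p * (x * x)) by nra. nra.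
right. repeat apply Rmult_integral_contrapositive_currified; lra.
Qed.
Lemma extr_root_Re M : 0 < Re M -> 0 < Re (extr_root M).
Proof. intros H. apply csqrt_Re. now apply extr_rad_slit. Qed.
Lemma extr_root_sqr M : 0 < Re M -> (extr_root M * extr_root M = 1 - p * p + p * p * (M * M))%C.
Proof. intros H. apply csqrt_sqr. now apply extr_rad_slit. Qed.
Lemma cderiv_extr_root M : 0 < Re M -> cderiv extr_root M (p * p * M / extr_root M).
Proof.
intros H. assert (N := Cneq_Re_pos _ (extr_root_Re M H)).
assert (D : cderiv extr_rad M (0 + p * p * (1 * M + M * 1))%C).
{ apply cderiv_plus. apply cderiv_const. apply cderiv_scal. apply cderiv_mult; apply cderiv_id. }
assert (Dc := cderiv_comp csqrt extr_rad M _ _ (cderiv_csqrt _ (extr_rad_slit M H)) D). fold (extr_root M) in Dc.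
eapply eq_rect with (P := cderiv _ _). exact Dc. field. exact N.
Qed.
(** The difference of the two sides is a fraction whose numerator is 1 - p^2 + p^2 M^2 - S^2. *)
Lemma extr_deriv_alg (M S : C) : (S * S = 1 - p * p + p * p * (M * M))%C -> S <> RtoC 0 -> (M + S <> 0)%C -> (M + 1 <> 0)%C -> (p * M + S <> 0)%C -> (1 + S <> 0)%C ->
  ((1 + p * p * M / S) * / (M + S) - / (M + 1) - p * ((p + p * p * M / S) * / (p * M + S)) = - (p * p) / (1 + S))%C.
Proof.
intros HS N1 N2 N3 N4 N5.
assert (E : ((1 + p * p * M / S) * / (M + S) - / (M + 1) - p * ((p + p * p * M / S) * / (p * M + S)) - - (p * p) / (1 + S) =
  (1 - p * p + p * p * (M * M) - S * S) / ((M + S) * (M + 1) * (1 + S)))%C) by (field; repeat split; assumption).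
replace (1 - p * p + p * p * (M * M) - S * S)%C with (RtoC 0) in E by (rewrite HS; ring).
match type of E with ((?a - ?b)%C = _) => replace a with (a - b + b)%C by ring end. rewrite E. unfold Cdiv. ring.
Qed.
Lemma cderiv_extr M : 0 < Re M -> cderiv extremal M (- (p * p) / (1 + extr_root M)).
Proof.
intros H. assert (P := extr_root_Re M H). 
assert (P1 : 0 < Re (M + extr_root M)) by (unfold Re in *; simpl in *; lra).
assert (P2 : 0 < Re (M + 1)) by (unfold Re in *; simpl in *; lra).
assert (P3 : 0 < Re (p * M + extr_root M)) by (unfold Re in *; simpl in *; nra).
assert (P4 : 0 < Re (1 + extr_root M)) by (unfold Re in *; simpl in *; lra).
assert (D1 : cderiv (fun M => Ln (M + extr_root M)) M ((1 + p * p * M / extr_root M) * / (M + extr_root M))%C).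
{ apply (cderiv_comp Ln (fun M => M + extr_root M)%C). now apply cderiv_Ln. apply cderiv_plus. apply cderiv_id. now apply cderiv_extr_root. }
assert (D2 : cderiv (fun M => Ln (M + 1)) M ((1 + 0) * / (M + 1))%C).
{ apply (cderiv_comp Ln (fun M => M + 1)%C). now apply cderiv_Ln. apply cderiv_plus. apply cderiv_id. apply cderiv_const. }
assert (D3 : cderiv (fun M => Ln (p * M + extr_root M)) M ((p * 1 + p * p * M / extr_root M) * / (p * M + extr_root M))%C).
{ apply (cderiv_comp Ln (fun M => p * M + extr_root M)%C). now apply cderiv_Ln. apply cderiv_plus. apply cderiv_scal. apply cderiv_id. now apply cderiv_extr_root. }
assert (D := cderiv_plus _ _ _ _ _ (cderiv_minus _ _ _ _ _ (cderiv_minus _ _ _ _ _ D1 D2) (cderiv_scal p _ _ _ D3)) (cderiv_const (p * Ln (p + 1))%C M)).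
eapply eq_rect with (P := cderiv _ _). exact D.
rewrite <- (extr_deriv_alg M (extr_root M)); try (apply Cneq_Re_pos; assumption). 2: now apply extr_root_sqr.
field. repeat split; apply Cneq_Re_pos; assumption.
Qed.

Lemma extr_root_Im x y : 0 < x -> Im (extr_root (x,y)) = p * p * x * y / Re (extr_root (x,y)).
Proof.
intros H. assert (P := extr_root_Re (x,y) H). assert (Q := f_equal Im (extr_root_sqr (x,y) H)). change (1 - p * p + p * p * ((x, y) * (x, y)))%C with (extr_rad (x,y)) in Q. rewrite extr_rad_pair in Q.
set (w := extr_root (x,y)) in *. clearbody w. destruct w as [a b]. unfold Im, Re in *; simpl in *.
apply Rmult_eq_reg_r with a. 2: lra. replace (p * p * x * y / a * a) with (p * p * x * y) by (field; lra). lra.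
Qed.

(* [d/dy (Re extremal) = - p^2 Im R / |1 + R|^2], and [Im R] has the sign of [y]. *)
Lemma Re_extr_le_real x y : 0 < x -> Re (extremal (x,y)) <= Re (extremal (x,0)).
Proof.
intros Hx. assert (Ppx : 0 <= p * p * x) by (repeat apply Rmult_le_pos; lra). assert (Ppp : 0 <= p * p) by nra. set (g := fun y : R => Re (extremal (x,y))).
assert (D : forall y : R, is_derive g y (- (p * p) * Im (extr_root (x,y)) / ((1 + Re (extr_root (x,y))) ^ 2 + Im (extr_root (x,y)) ^ 2))).
{ intros t. assert (P := extr_root_Re (x,t) Hx). destruct (cderiv_path extremal (fun _ => x) (fun y => y) t 0 1 _ (cderiv_extr (x,t) Hx) (is_derive_const _ _) (is_derive_id _)) as [Q _].
  eapply eq_rect with (P := is_derive _ _). exact Q. generalize dependent (extr_root (x,t)). intros w P Q. destruct w as [u v]. unfold Re in *; simpl in *.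
  assert (0 < (1 + u) * (1 + u) + v * v) by nra. field. apply Rgt_not_eq; nra. }
assert (DEN : forall y, 0 < (1 + Re (extr_root (x,y))) ^ 2 + Im (extr_root (x,y)) ^ 2).
{ intros t. assert (P := extr_root_Re (x,t) Hx). assert (0 <= Im (extr_root (x,t)) ^ 2) by apply pow2_ge_0. nra. }
change (g y <= g 0).
destruct (Rle_dec 0 y) as [Hy|Hy].
- assert (L : - g 0 <= - g y); [|lra].
  apply (derive_nonneg_incr (fun y => - g y) (fun y => - (- (p * p) * Im (extr_root (x,y)) / ((1 + Re (extr_root (x,y))) ^ 2 + Im (extr_root (x,y)) ^ 2))) 0 y Hy).
  intros t _. apply (is_derive_opp (V:=R_NormedModule)). apply D.
  intros t Ht. replace (- (- (p * p) * Im (extr_root (x, t)) / ((1 + Re (extr_root (x, t))) ^ 2 + Im (extr_root (x, t)) ^ 2))) with ((p * p) * Im (extr_root (x, t)) / ((1 + Re (extr_root (x, t))) ^ 2 + Im (extr_root (x, t)) ^ 2)) by (field; apply Rgt_not_eq, DEN).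
  apply Rdiv_le_0_compat. 2: apply DEN. apply Rmult_le_pos. nra. rewrite extr_root_Im by exact Hx. apply Rdiv_le_0_compat. 2: now apply extr_root_Re. apply Rmult_le_pos; lra.
- apply (derive_nonneg_incr g _ y 0 ltac:(lra) (fun t _ => D t)).
  intros t Ht. apply Rdiv_le_0_compat. 2: apply DEN. 
  replace (- (p * p) * Im (extr_root (x, t))) with (p * p * (- Im (extr_root (x,t)))) by ring. apply Rmult_le_pos. exact Ppp.
  rewrite extr_root_Im by exact Hx. replace (- (p * p * x * t / Re (extr_root (x, t)))) with (p * p * x * (- t) / Re (extr_root (x, t))) by (field; apply Rgt_not_eq; now apply extr_root_Re).
  apply Rdiv_le_0_compat. 2: now apply extr_root_Re. apply Rmult_le_pos; lra.
Qed.

Definition root_real x := sqrt (1 - p * p + p * p * (x * x)).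
Lemma root_arg_pos x : 0 < 1 - p * p + p * p * (x * x).
Proof. assert (0 <= p * p * (x * x)) by (apply Rmult_le_pos; [nra|apply Rle_0_sqr]). nra. Qed.
Lemma extremal_on_reals x : 0 < x -> extremal (x,0) = (ln (x + root_real x) - ln (x + 1) - p * ln (p * x + root_real x) + p * ln (1 + p), 0).
Proof.
intros H. assert (Q := root_arg_pos x). assert (P : 0 < root_real x) by now apply sqrt_lt_R0.
assert (E : extr_root (x,0) = (root_real x, 0)).
{ unfold extr_root. rewrite extr_rad_pair. replace (p * p * (2 * x * 0)) with 0 by ring. replace (x * x - 0 * 0) with (x * x) by ring. apply csqrt_real. lra. }
unfold extremal. rewrite E.
replace ((x, 0) + (root_real x, 0))%C with (x + root_real x, 0) by (unfold Cplus; simpl; f_equal; ring).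
replace ((x, 0) + 1)%C with (x + 1, 0) by (unfold Cplus, RtoC; simpl; f_equal; ring).
replace (p * (x, 0) + (root_real x, 0))%C with (p * x + root_real x, 0) by (unfold Cplus, Cmult, RtoC; simpl; f_equal; ring).
replace (p + 1)%C with (1 + p, 0) by (unfold Cplus, RtoC; simpl; f_equal; ring).
rewrite !Ln_real by nra. unfold Cplus, Cminus, Cmult, Copp, RtoC; simpl. f_equal; ring.
Qed.
Definition extremal_real x := ln (x + root_real x) - ln (x + 1) - p * ln (p * x + root_real x) + p * ln (1 + p).
(** The point x = 0 is on the boundary of the half-plane, but the real formula extends to it; its
    value there is the supremum of the real part. *)
Lemma extremal_real_decr x : 0 <= x -> extremal_real x <= extremal_real 0.
Proof.
intros Hx. assert (L : - extremal_real 0 <= - extremal_real x); [|lra].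
apply (derive_nonneg_incr (fun x => - extremal_real x) (fun x => p * p / (1 + root_real x)) 0 x Hx).
- intros t Ht. assert (Q := root_arg_pos t). assert (P : 0 < root_real t) by now apply sqrt_lt_R0.
  assert (S2 : root_real t * root_real t = 1 - p * p + p * p * (t * t)) by (apply sqrt_sqrt; lra).
  assert (0 <= p * t) by (apply Rmult_le_pos; lra).
  unfold extremal_real, root_real in *. auto_derive. repeat split; lra. set (s := sqrt _) in *.
  apply Rminus_diag_uniq.
  match goal with |- ?X = 0 => replace X with ((s * s - (1 - p * p + p * p * (t * t))) / ((t + s) * (t + 1) * (1 + s))) by (field; lra) end.
  rewrite S2. unfold Rdiv. ring.
- intros t _. assert (P : 0 < root_real t) by (apply sqrt_lt_R0, root_arg_pos). apply Rdiv_le_0_compat; nra.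
Qed.
(** The value is ((1 - p) ln (1 - p) + (1 + p) ln (1 + p)) / 2: the first-order terms cancel, p^2 /
    2 remains, and p^3 / 2 absorbs the higher terms. *)
Lemma extremal_real_0_le : extremal_real 0 <= p * p * (1 + p) / 2.
Proof.
assert (E : extremal_real 0 = ((1 - p) * ln (1 - p) + (1 + p) * ln (1 + p)) / 2).
{ unfold extremal_real, root_real. replace (1 - p * p + p * p * (0 * 0)) with ((1 - p) * (1 + p)) by ring.
  rewrite Rmult_0_r, !Rplus_0_l, ln_1, <- Rpower_sqrt by nra. unfold Rpower. rewrite ln_exp, ln_mult by lra. field. }
rewrite E. assert (A := ln_1m_le p ltac:(lra)). assert (B := ln_1p_le p ltac:(lra)).
assert ((1 - p) * ln (1 - p) <= (1 - p) * (- p - p * p / 2)) by (apply Rmult_le_compat_l; lra).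
assert ((1 + p) * ln (1 + p) <= (1 + p) * (p - p * p / 2 + p * p * p / 3)) by (apply Rmult_le_compat_l; lra).
assert (0 < p * p * p) by (repeat apply Rmult_lt_0_compat; lra). assert (p * p * p * p <= p * p * p) by nra. nra.
Qed.
Lemma Re_extr_le M : 0 < Re M -> Re (extremal M) <= p * p * (1 + p) / 2.
Proof.
destruct M as [x y]. simpl. intros Hx. eapply Rle_trans. now apply Re_extr_le_real. rewrite extremal_on_reals by exact Hx.
eapply Rle_trans. 2: apply extremal_real_0_le. apply extremal_real_decr. lra.
Qed.

Definition extr_disc (z : C) : C := extremal (cayley z).
Lemma cderiv_extr_disc z : Cmod z < 1 -> cderiv extr_disc z (2 / ((1 - z) * (1 - z)) * (- (p * p) / (1 + extr_root (cayley z))))%C.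
Proof.
intros H. assert (N := one_minus_neq z H).
apply (cderiv_comp extremal cayley). apply cderiv_extr. now apply cayley_Re.
assert (D1 : cderiv (fun w => 1 + w)%C z (0 + 1)%C) by (apply cderiv_plus; [apply cderiv_const|apply cderiv_id]).
assert (D2 : cderiv (fun w => 1 - w)%C z (0 - 1)%C) by (apply cderiv_minus; [apply cderiv_const|apply cderiv_id]).
assert (D3 := cderiv_comp Cinv _ z _ _ (cderiv_inv _ N) D2).
assert (D := cderiv_mult _ _ _ _ _ D1 D3). eapply eq_rect with (P := cderiv _ _). exact D. replace (RtoC 2) with (1 + 1)%C by (rewrite <- RtoC_plus; f_equal; ring). field. exact N.
Qed.
Lemma extr_disc_rot z : Cmod z < 1 -> (z * (2 / ((1 - z) * (1 - z)) * (- (p * p) / (1 + extr_root (cayley z)))) = (1 - extr_root (cayley z)) / 2)%C.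
Proof.
intros H. assert (N := one_minus_neq z H). assert (P := cayley_Re z H). assert (PR := extr_root_Re _ P).
assert (N1 : (1 + extr_root (cayley z) <> 0)%C) by (apply Cneq_Re_pos; unfold Re in *; simpl in *; lra).
assert (S := extr_root_sqr _ P). set (s := extr_root (cayley z)) in *.
(* Indeed 1 - R^2 = p^2 (1 - M^2) and 1 - M^2 = - 4 z / (1 - z)^2. *)
assert (E : (1 - s * s = - (p * p) * ((1 + 1) * (1 + 1) * z / ((1 - z) * (1 - z))))%C). { rewrite S. unfold cayley. field. exact N. }
replace ((1 - s) / 2)%C with ((1 - s * s) / (2 * (1 + s)))%C by (field; exact N1). rewrite E. replace (RtoC 2) with (1 + 1)%C by (rewrite <- RtoC_plus; f_equal; ring). field. repeat split; try assumption.
Qed.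
Lemma extr_root_1 : extr_root (RtoC 1) = RtoC 1.
Proof.
unfold extr_root. change (RtoC 1) with ((1, 0) : C). rewrite extr_rad_pair. replace (1 - p * p + p * p * (1 * 1 - 0 * 0)) with 1 by ring. replace (p * p * (2 * 1 * 0)) with 0 by ring.
rewrite csqrt_real, sqrt_1 by lra. reflexivity.
Qed.
Lemma extr_disc_0 : extr_disc (RtoC 0) = RtoC 0.
Proof.
unfold extr_disc, cayley. replace ((1 + 0) / (1 - 0))%C with (RtoC 1) by (field; apply Cneq_Re_pos; simpl; lra). unfold extremal. rewrite extr_root_1.
replace (p * 1 + 1)%C with (p + 1)%C by ring. ring.
Qed.
(** The bound K = pi comes from the angular derivative 2 pi Re ((1 - R) / 2) = pi (1 - Re R), where
    Re R > 0. *)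
Lemma extr_disc_admissible : admissible extr_disc (p * p * (1 + p) / 2) PI.
Proof.
assert (PP := PI_RGT_0). split; [|split; [|split; [|split; [|split]]]].
- intros z Hz. eexists. exact (cderiv_extr_disc z Hz).
- apply extr_disc_0.
- assert (0 < p * p) by nra. nra.
- exact PP.
- intros z Hz. apply Re_extr_le. now apply cayley_Re.
- intros r t Hr Ht. assert (Hz : Cmod (polar r t) < 1) by (rewrite Cmod_polar; lra).
  unfold dv_dtheta. assert (Q := is_derive_unique _ _ _ (derive_Im_polar extr_disc r t _ (cderiv_extr_disc _ Hz))). rewrite extr_disc_rot in Q by exact Hz.
  eapply Rle_trans. right. exact Q.
  assert (P := extr_root_Re _ (cayley_Re _ Hz)). set (s := extr_root _) in *. clearbody s. destruct s as [u v]. simpl in P.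
  replace (Re ((1 - (u,v)) / 2)) with ((1 - u) / 2) by (unfold Re, Cdiv, Cmult, Cinv, Cminus, Cplus, Copp, RtoC; simpl; field). nra.
Qed.

(** The test points for sharpness are conjugate, so their difference in v is twice a single
    value. *)
Lemma extr_conj x y : 0 < x -> Im (extremal (x, - y)) = - Im (extremal (x,y)).
Proof.
intros H. assert (E : extr_root (x, - y) = (Re (extr_root (x,y)), - Im (extr_root (x,y)))).
{ unfold extr_root. rewrite !extr_rad_pair. replace (x * x - - y * - y) with (x * x - y * y) by ring. replace (p * p * (2 * x * - y)) with (- (p * p * (2 * x * y))) by ring.
  unfold csqrt. unfold Re, Im; simpl. 
  assert (M : forall a b, Cmod (a, - b) = Cmod (a, b)). { intros a b. unfold Cmod; simpl. f_equal. ring. } rewrite M. f_equal. unfold Rdiv. ring. }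
unfold extremal. rewrite E. set (s := extr_root (x,y)). clearbody s. destruct s as [u v]. 
assert (L : forall a b, Im (Ln (a, - b)) = - Im (Ln (a,b))). { intros a b. unfold Ln, Im; simpl. replace (- b / a) with (- (b / a)) by (unfold Rdiv; ring). apply atan_opp. }
assert (L0 : Im (Ln (p + 1)) = 0). { unfold Ln, Im; simpl. unfold Rdiv. replace ((0 + 0) * / (p + 1)) with 0 by ring. apply atan_0. }
replace ((x, (- y)%R) + (Re (u, v), (- Im (u, v))%R))%C with (x + u, - (y + v)) by (unfold Cplus, Re, Im; simpl; f_equal; ring).
replace ((x, (- y)%R) + 1)%C with (x + 1, - y) by (unfold Cplus, RtoC; simpl; f_equal; ring).
replace (p * (x, (- y)%R) + (Re (u, v), (- Im (u, v))%R))%C with (p * x + u, - (p * y + v)) by (unfold Cplus, Cmult, RtoC, Re, Im; simpl; f_equal; ring).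
replace ((x, y) + (u, v))%C with (x + u, y + v) by reflexivity.
replace ((x, y) + 1)%C with (x + 1, y) by (unfold Cplus, RtoC; simpl; f_equal; ring).
replace (p * (x, y) + (u, v))%C with (p * x + u, p * y + v) by (unfold Cplus, Cmult, RtoC; simpl; f_equal; ring).
assert (G : forall A B D E : C, Im (A - B - p * D + p * E) = Im A - Im B - p * Im D + p * Im E) by (intros; unfold Im; simpl; ring).
rewrite !G, !L, L0. ring.
Qed.
(** On Re M = 1, R^2 has real part 1 - p^2 y^2 and modulus at most 1 + p^2 y^2; (Re R)^2 is half
    their sum. *)
Lemma extr_root_line_le y : Re (extr_root (1,y)) <= 1.
Proof.
unfold extr_root. rewrite extr_rad_pair. unfold csqrt. unfold Re at 1. simpl.
apply Rle_trans with (sqrt 1); [apply sqrt_le_1_alt|rewrite sqrt_1; lra].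
set (a := 1 - p * p + p * p * (1 * 1 - y * y)). set (b := p * p * (2 * 1 * y)).
assert (Cmod (a,b) <= 1 + p * p * (y * y)); [|unfold a in *; lra].
assert (0 <= p * p * (y * y)) by (apply Rmult_le_pos; [nra|apply Rle_0_sqr]).
unfold Cmod; simpl. rewrite <- (sqrt_square (1 + p * p * (y * y))) by lra. apply sqrt_le_1_alt.
unfold a, b. assert (p * p * (p * p * (y * y)) <= 1 * (p * p * (y * y))). { apply Rmult_le_compat_r. assumption. nra. } nra.
Qed.
(** Of the three arguments, the first is below pi / 2 and the other two are at least atan (p y / 2),
    the last because p + Re R <= 2. The bound tends to - p pi / 2, half the jump, as y grows. *)
Lemma extr_Im_line y : 0 < y -> Im (extremal (1,y)) <= PI / 2 - (1 + p) * atan (p * y / 2).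
Proof.
intros Hy. assert (P := extr_root_Re (1,y) ltac:(simpl; lra)). assert (Q := extr_root_line_le y). assert (I := extr_root_Im 1 y ltac:(lra)).
assert (I0 : 0 <= Im (extr_root (1,y))). { rewrite I. apply Rdiv_le_0_compat. 2: exact P. apply Rmult_le_pos; nra. }
unfold extremal. set (s := extr_root (1,y)) in *. clearbody s. destruct s as [u v]. unfold Re, Im in P, Q, I0; simpl in P, Q, I0.
replace ((1, y) + (u, v))%C with (1 + u, y + v) by reflexivity.
replace ((1, y) + 1)%C with (1 + 1, y) by (unfold Cplus, RtoC; simpl; f_equal; ring).
replace (p * (1, y) + (u, v))%C with (p + u, p * y + v) by (unfold Cplus, Cmult, RtoC; simpl; f_equal; ring).
replace (Im (Ln (1 + u, (y + v)%R) - Ln ((1 + 1)%R, y) - p * Ln ((p + u)%R, (p * y + v)%R) + p * Ln (p + 1)))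
 with (atan ((y + v) / (1 + u)) - atan (y / 2) - p * atan ((p * y + v) / (p + u))).
2:{ replace (p + 1)%C with (1 + p, 0) by (unfold Cplus, RtoC; simpl; f_equal; ring). rewrite Ln_real by lra. unfold Ln, Im; simpl. replace (1 + 1) with 2 by ring. ring. }
assert (B := atan_bound ((y + v) / (1 + u))).
assert (Mono : forall a b, a <= b -> atan a <= atan b). { intros a b [L| ->]. left. now apply atan_increasing. right. reflexivity. }
assert (M1 : atan (p * y / 2) <= atan (y / 2)). { apply Mono. nra. }
assert (M2 : atan (p * y / 2) <= atan ((p * y + v) / (p + u))).
{ apply Mono. apply Rmult_le_reg_r with (p + u). lra. replace ((p * y + v) / (p + u) * (p + u)) with (p * y + v) by (field; lra).
  assert (0 < p * y) by (apply Rmult_lt_0_compat; lra). assert (p * y * (p + u) <= p * y * 2) by (apply Rmult_le_compat_l; lra). lra. }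
nra.
Qed.
End Extremal.

Lemma sharpness c : c < sqrt (2 * PI) -> exists (f : C -> C) (H K : R) (z1 z2 : C),
   admissible f H K /\ Cmod z1 < 1 /\ Cmod z2 < 1 /\ Rabs (Im (f z1) - Im (f z2)) > c * sqrt (H * K).
Proof.
(* Replacing c by max (c, 1) keeps it below sqrt (2 pi) and makes squaring safe. *)
intros Hc. assert (PP := PI_RGT_0). assert (P2 := PI2_1). set (c1 := Rmax c 1).
assert (H1 : 1 <= c1) by apply Rmax_r. assert (Hcc : c <= c1) by apply Rmax_l.
assert (S2 : sqrt (2 * PI) * sqrt (2 * PI) = 2 * PI) by (apply sqrt_sqrt; lra).
assert (Ps : 0 < sqrt (2 * PI)) by (apply sqrt_lt_R0; lra).
assert (Hc1 : c1 * c1 < 2 * PI). { unfold c1, Rmax. destruct Rle_dec. lra. nra. }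
(* The jump p pi divided by sqrt (H K) is sqrt (2 pi / (1 + p)), which exceeds c1 when p < 2 pi /
   c1^2 - 1; half of this range is taken, capped at 1/2. *)
set (p := Rmin (1/2) ((2 * PI - c1 * c1) / (2 * (c1 * c1)))).
assert (Q : 0 < (2 * PI - c1 * c1) / (2 * (c1 * c1))) by (apply Rdiv_lt_0_compat; nra).
assert (Hp : 0 < p) by (apply Rmin_pos; lra). assert (Hp2 : p <= 1/2) by apply Rmin_l.
assert (Hp3 : c1 * c1 * (1 + p) < 2 * PI).
{ assert (B := Rmin_r (1/2) ((2 * PI - c1 * c1) / (2 * (c1 * c1)))). fold p in B. 
  apply Rle_lt_trans with (c1 * c1 * (1 + (2 * PI - c1 * c1) / (2 * (c1 * c1)))). apply Rmult_le_compat_l; nra.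
  replace (c1 * c1 * (1 + (2 * PI - c1 * c1) / (2 * (c1 * c1)))) with ((2 * PI + c1 * c1) / 2) by (field; nra). lra. }
clearbody p.
set (B := c1 * sqrt (p * p * (1 + p) / 2 * PI)).
assert (B0 : 0 <= B) by (apply Rmult_le_pos; [lra|apply sqrt_pos]).
assert (HB : B < p * PI).
{ apply Rsqr_incrst_0. 2: exact B0. 2: nra. unfold B, Rsqr. 
  assert (Sq : sqrt (p * p * (1 + p) / 2 * PI) * sqrt (p * p * (1 + p) / 2 * PI) = p * p * (1 + p) / 2 * PI). { apply sqrt_sqrt. apply Rmult_le_pos. nra. lra. }
  set (s := sqrt (p * p * (1 + p) / 2 * PI)) in *. replace (c1 * s * (c1 * s)) with (c1 * c1 * (s * s)) by ring. rewrite Sq.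
  replace (c1 * c1 * (p * p * (1 + p) / 2 * PI)) with (p * p * PI / 2 * (c1 * c1 * (1 + p))) by field.
  replace (p * PI * (p * PI)) with (p * p * PI / 2 * (2 * PI)) by field. apply Rmult_lt_compat_l. 2: exact Hp3. assert (0 < p * p) by nra. nra. }
(* With atan (p y / 2) = pi / 2 - e the drop is at least p pi - 2 (1 + p) e >= p pi - 4 e, the
   midpoint of B and p pi; y is chosen to produce this angle. *)
set (e := (p * PI - B) / 8). assert (He : 0 < e) by (unfold e; lra). assert (He2 : e < PI / 2) by (unfold e; nra).
set (y := 2 * tan (PI / 2 - e) / p).
assert (Ht : 0 < tan (PI / 2 - e)) by (apply tan_gt_0; lra).
assert (Hy : 0 < y) by (apply Rdiv_lt_0_compat; lra).
assert (Ey : atan (p * y / 2) = PI / 2 - e). { replace (p * y / 2) with (tan (PI / 2 - e)) by (unfold y; field; lra). apply atan_tan. lra. }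
assert (L := extr_Im_line p ltac:(lra) y Hy). rewrite Ey in L.
assert (Lc := extr_conj p 1 y ltac:(lra)).
destruct (cayley_inv (1, - y) ltac:(simpl; lra)) as [Z1 E1]. destruct (cayley_inv (1, y) ltac:(simpl; lra)) as [Z2 E2].
exists (extr_disc p), (p * p * (1 + p) / 2), PI, (((1, (- y)%R) - 1) / ((1, (- y)%R) + 1))%C, (((1, y) - 1) / ((1, y) + 1))%C.
split; [apply extr_disc_admissible; lra|]. split; [exact Z1|]. split; [exact Z2|].
unfold extr_disc. rewrite E1, E2, Lc. apply Rlt_gt. apply Rle_lt_trans with B.
unfold B. apply Rmult_le_compat_r. apply sqrt_pos. exact Hcc.
eapply Rlt_le_trans; [|apply Rle_abs]. assert (p * e <= e) by nra. unfold e in *. nra.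
Qed.

Theorem theorem1p3 :
  (forall (f : C -> C) (H K : R), admissible f H K ->
     forall z1 z2 : C, Cmod z1 < 1 -> Cmod z2 < 1 ->
       Rabs (Im (f z1) - Im (f z2)) <= sqrt (2 * PI) * sqrt (H * K)) /\
  (forall c : R, c < sqrt (2 * PI) ->
     exists (f : C -> C) (H K : R) (z1 z2 : C),
       admissible f H K /\ Cmod z1 < 1 /\ Cmod z2 < 1 /\
       Rabs (Im (f z1) - Im (f z2)) > c * sqrt (H * K)).
Proof.
split.
- intros f H K Hf z1 z2 H1 H2. now apply upper_bound.
- intros c Hc. now apply sharpness.
Qed.
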